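(* Suppose that $K(x)=\Omega(x/|x|)/|x|^n$ for $x\in\mathbb{R}^n\setminus\{0\}$, where $\Omega\in L\log L(S^{n-1})$ has zero mean value on the unit sphere $S^{n-1}\subset\mathbb{R}^n$, i.e. $\int_{S^{n-1}}\Omega(x')\,d\sigma_{n-1}(x')=0$. There exists an absolute positive constant $c$ such that $$\sup_{P\in\mathcal{P}_{d,n}}\left|\mathrm{p.v.}\int_{\mathbb{R}^n} e^{iP(x)}K(x)\,dx\right|\leq c\,\log d\,\left(\|\Omega\|_{L\log L(S^{n-1})}+1\right).$$
   Context: Here $n$ and $d$ are positive integers, and $\mathcal{P}_{d,n}$ denotes the vector space of all real polynomials of degree at most $d$ on $\mathbb{R}^n$. $\sigma_{n-1}$ is the (unnormalized) surface measure on $S^{n-1}$ (counting measure on $S^0=\{-1,1\}$ when $n=1$). The class $L\log L(S^{n-1})$ consists of the functions $\Omega$ on $S^{n-1}$ with $$\|\Omega\|_{L\log L(S^{n-1})}=\int_{S^{n-1}}|\Omega(x')|\,(1+\log^+|\Omega(x')|)\,d\sigma_{n-1}(x')<\infty,$$ where $\log^+ t=\max(\log t,0)$ for $t>0$ and $\log^+0=0$. The principal value is $\mathrm{p.v.}\int_{\mathbb{R}^n} e^{iP(x)}K(x)\,dx=\lim_{\epsilon\to0^+,\,R\to\infty}\int_{\epsilon\le|x|\le R}e^{iP(x)}K(x)\,dx$. ''Absolute constant'' means that $c$ does not depend on $n$, $d$, $\Omega$ or $P$.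
   Formalization: The bound is stated for d ≥ 2 only: for d = 1 the right side c log d is 0, while n = 1, Ω = sign, P(x) = x gives a principal value of iπ, so the claim fails there. *)

(* Defs.v *)
From HB Require Import structures.
From mathcomp Require Import all_boot all_order all_algebra.
From mathcomp Require Import -(notations) mpoly.
From mathcomp Require Import all_classical all_reals all_analysis.
From mathcomp Require Import measurable_realfun.
From mathcomp Require Import complex.

Set Implicit Arguments.
Unset Strict Implicit.
Unset Printing Implicit Defensive.

Import Order.TTheory GRing.Theory Num.Theory.
Import numFieldNormedType.Exports.

Local Open Scope classical_set_scope.
Local Open Scope ring_scope.

Notation Rn R n := (n.-tuple (measurableTypeR R)).

Section lebesgue_Rn.
Variable R : realType.

Definition consRn n (p : measurableTypeR R * Rn R n) : Rn R n.+1 :=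
  [tuple of p.1 :: p.2].

Definition unconsRn n (x : Rn R n.+1) : measurableTypeR R * Rn R n :=
  (thead x, [tuple of behead x]).

Lemma measurable_consRn n : measurable_fun setT (@consRn n).
Proof. exact: (measurable_cons measurable_fst measurable_snd). Qed.

Lemma measurable_unconsRn n : measurable_fun setT (@unconsRn n).
Proof.
apply/measurable_fun_pairP; split => /=.
- exact: (measurable_tnth ord0).
- exact: measurable_behead.
Qed.

Lemma unconsRnK n : cancel (@unconsRn n) (@consRn n).
Proof. by move=> x; rewrite /consRn /unconsRn/= [RHS]tuple_eta. Qed.

Lemma consRnK n : cancel (@consRn n) (@unconsRn n).
Proof.
by move=> [a x]; rewrite /consRn /unconsRn/= theadE; congr pair; exact/val_inj.
Qed.

Section lebesgue_Rn_succ.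
Variables (n : nat) (mu : {sigma_finite_measure set (Rn R n) -> \bar R}).

Definition lebesgue_Rn_succ : set (Rn R n.+1) -> \bar R :=
  pushforward (lebesgue_measure \x mu)%E (@consRn n).

Let mpre (A : set (Rn R n.+1)) :
  measurable A -> measurable (@consRn n @^-1` A).
Proof.
by move=> mA; rewrite -[X in measurable X]setTI; exact: measurable_consRn.
Qed.

Let succ0 : lebesgue_Rn_succ set0 = 0%E.
Proof. by rewrite /lebesgue_Rn_succ /pushforward preimage_set0 measure0. Qed.

Let succ_ge0 A : (0 <= lebesgue_Rn_succ A)%E.
Proof. exact: (@measure_ge0 _ _ _ (lebesgue_measure \x mu)%E). Qed.

Let succ_sigma_additive : semi_sigma_additive lebesgue_Rn_succ.
Proof.
move=> F mF tF mUF; rewrite /lebesgue_Rn_succ /pushforward preimage_bigcup.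
apply: (@measure_semi_sigma_additive _ _ _ (lebesgue_measure \x mu)%E).
- by move=> k; exact: mpre.
- apply/trivIsetP => /= i j _ _ ij; rewrite -preimage_setI.
  by move/trivIsetP : tF => /(_ _ _ _ _ ij) ->//; rewrite preimage_set0.
- by rewrite -preimage_bigcup; exact: mpre.
Qed.

HB.instance Definition _ := isMeasure.Build _ _ _ lebesgue_Rn_succ
  succ0 succ_ge0 succ_sigma_additive.

Let succ_sigma_finite : sigma_finite setT lebesgue_Rn_succ.
Proof.
have /sigma_finiteP[F [TF ndF Foo]] := sigma_finiteT (@lebesgue_measure R).
have /sigma_finiteP[G [TG ndG Goo]] := sigma_finiteT mu.
exists (fun k => @unconsRn n @^-1` (F k `*` G k)).
  rewrite -preimage_bigcup -[LHS](@preimage_setT _ _ (@unconsRn n)).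
  congr (_ @^-1` _); rewrite -setXTT TF TG predeqE => -[x y]; split.
    move=> [/= [i _ Fix] [j _ Gjy]]; exists (maxn i j) => //; split.
    - by move: x Fix; exact/subsetPset/ndF/leq_maxl.
    - by move: y Gjy; exact/subsetPset/ndG/leq_maxr.
  by move=> [i _ []/= ? ?]; split; exists i.
move=> k; have [mF Fk] := Foo k; have [mG Gk] := Goo k; split.
  rewrite -[X in measurable X]setTI; apply: measurable_unconsRn => //.
  exact: measurableX.
rewrite /lebesgue_Rn_succ /pushforward -comp_preimage.
rewrite (_ : _ \o _ = id); last by apply/funext => x; exact: consRnK.
by rewrite preimage_id product_measure1E// lte_mul_pinfty// ge0_fin_numE.
Qed.

HB.instance Definition _ := Measure_isSigmaFinite.Build _ _ _
  lebesgue_Rn_succ succ_sigma_finite.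

End lebesgue_Rn_succ.

Fixpoint lebesgue_Rn n : {sigma_finite_measure set (Rn R n) -> \bar R} :=
  match n with
  | 0 => \d_([tuple] : Rn R 0)
  | m.+1 => lebesgue_Rn_succ (lebesgue_Rn m)
  end.

End lebesgue_Rn.

Section sphere.
Variables (R : realType) (n : nat).
Implicit Type x : Rn R n.

(* The library norm on products and matrices is the sup norm. *)
Definition enorm x : R := Num.sqrt (\sum_(i < n) tnth x i ^+ 2).

(* normalize 0 = 0 *)
Definition normalize x : Rn R n := [tuple tnth x i / enorm x | i < n].

Definition sphere : set (Rn R n) := [set x | enorm x = 1].

(* Surface measure defined by cones:
   sigma(A) = n * vol {x | 0 < |x| <= 1, x / |x| \in A}.  This is the measure
   of the polar coordinate formula dx = r ^ (n - 1) dr dsigma; it is the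
   counting measure on {-1, 1} when n = 1. *)
Definition sphere_measure (A : set (Rn R n)) : \bar R :=
  (n%:R%:E * lebesgue_Rn R n
     ([set x | (0 < enorm x <= 1)%R] `&` normalize @^-1` A))%E.

Lemma measurable_enorm : measurable_fun setT enorm.
Proof.
apply: (measurableT_comp
  (continuous_measurable_fun (@sqrt_continuous R))) => //.
apply: measurable_sum => i; apply: measurable_funX.
  exact: (measurable_tnth i).
Qed.

Lemma measurable_normalize : measurable_fun setT normalize.
Proof.
apply/measurable_fun_tnthP => i.
rewrite (_ : _ \o _ = fun x : Rn R n => tnth x i * (enorm x) `^ (-1)).
  apply: measurable_funM; first exact: measurable_tnth.
  exact: (measurableT_comp (measurable_powR (-1)) measurable_enorm).
by apply/funext => x; rewrite /= tnth_mktuple powR_inv1// sqrtr_ge0.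
Qed.

Lemma measurable_sphere : measurable sphere.
Proof.
rewrite (_ : sphere = enorm @^-1` [set 1])//.
by rewrite -[X in measurable X]setTI; exact: measurable_enorm.
Qed.

Let sphere_cone (A : set (Rn R n)) : measurable A ->
  measurable ([set x | (0 < enorm x <= 1)%R] `&` normalize @^-1` A).
Proof.
move=> mA; apply: measurableI.
  rewrite (_ : mkset _ = enorm @^-1` `]0, 1]%classic).
    by rewrite -[X in measurable X]setTI; exact: measurable_enorm.
  by apply/seteqP; split => x /=; rewrite in_itv.
by rewrite -[X in measurable X]setTI; exact: measurable_normalize.
Qed.

Let sphere_measure0 : sphere_measure set0 = 0%E.
Proof. by rewrite /sphere_measure preimage_set0 setI0 measure0 mule0. Qed.

Let sphere_measure_ge0 A : (0 <= sphere_measure A)%E.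
Proof. by rewrite mule_ge0// lee_fin. Qed.

Let sphere_measure_sigma_additive : semi_sigma_additive sphere_measure.
Proof.
move=> F mF tF mUF; rewrite /sphere_measure preimage_bigcup setI_bigcupr.
rewrite (_ : (fun _ => _) = (fun k => (n%:R%:E * \sum_(0 <= i < k)
  lebesgue_Rn R n ([set x | (0 < enorm x <= 1)%R] `&` normalize @^-1` F i))%E)).
  apply: cvgeZl => //; apply: measure_semi_sigma_additive.
  - by move=> k; exact: sphere_cone.
  - apply/trivIsetP => i j _ _ ij; rewrite setIACA setIid -preimage_setI.
    by move/trivIsetP : tF => /(_ _ _ _ _ ij) ->//; rewrite preimage_set0 setI0.
  - by rewrite -setI_bigcupr -preimage_bigcup; exact: sphere_cone.
by apply/funext => k; rewrite ge0_sume_distrr.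
Qed.

HB.instance Definition _ := isMeasure.Build _ _ _ sphere_measure
  sphere_measure0 sphere_measure_ge0 sphere_measure_sigma_additive.

End sphere.

Local Open Scope complex_scope.

Definition Cintegral d (T : measurableType d) (R : realType)
    (mu : {measure set T -> \bar R}) (D : set T) (f : T -> R[i]) : R[i] :=
  (\int[mu]_(x in D) complex.Re (f x))%R
    +i* (\int[mu]_(x in D) complex.Im (f x))%R.

Definition Cmeasurable_fun d (T : measurableType d) (R : realType)
    (D : set T) (f : T -> R[i]) : Prop :=
  measurable_fun D (fun x => complex.Re (f x)) /\
  measurable_fun D (fun x => complex.Im (f x)).

Definition expi (R : realType) (t : R) : R[i] := cos t +i* sin t.

(* ln is 0 on nonpositive arguments *)
Definition logp (R : realType) (t : R) : R := Num.max (ln t) 0.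

Section oscillatory.
Variables (R : realType) (n : nat).

Definition poly_le (d : nat) : set (mpoly n R) :=
  [set P | (msize P <= d.+1)%N].

Definition peval (P : mpoly n R) (x : Rn R n) : R :=
  meval (tnth x) P.

(* Only the values of Omega on the sphere matter below. *)
Implicit Type Omega : Rn R n -> R[i].

Definition LlogL_norm Omega : \bar R :=
  (\int[@sphere_measure R n]_(x in @sphere R n)
    (Normc.normc (Omega x) * (1 + logp (Normc.normc (Omega x))))%:E)%E.

Definition LlogL Omega : Prop :=
  Cmeasurable_fun (@sphere R n) Omega /\ (LlogL_norm Omega < +oo)%E.

Definition hkernel Omega (x : Rn R n) : R[i] :=
  Omega (normalize x) / (enorm x ^+ n)%:C.

Definition truncated_integral Omega (P : mpoly n R) (e r : R) : R[i] :=
  Cintegral (lebesgue_Rn R n) [set x | e <= enorm x <= r]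
    (fun x => expi (peval P x) * hkernel Omega x).

(* The topology on R[i] is the one of its canonical norm, carried by R[i]^o. *)
Definition truncations Omega (P : mpoly n R) (q : R * R) : R[i]^o :=
  truncated_integral Omega P q.1 q.2.

Definition pv_filter : set_system (R * R) := filter_prod 0^'+ (pinfty_nbhs R).

Definition pv_exists Omega P : Prop := cvg (truncations Omega P @ pv_filter).

Definition pv_integral Omega P : R[i] := lim (truncations Omega P @ pv_filter).

End oscillatory.

(* Main.v *)
(* Taking real and imaginary parts and shifting the phase by pi / 2, it suffices to
   bound J = \int_S w(x) u(x) dsigma(x), where u(x) is the integral of cos(P(r x)) / r
   over a <= r <= b and w has mean zero.  Let P_j be the homogeneous parts of P and
   M_j the sums of the absolute values of their coefficients.  Choose lam with
   M_j lam^j <= 1 for d / 2 < j <= d, with equality for some j = j0.  For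
   r <= lam / 2 the parts of degree > d / 2 change cos P by O(r / lam), so they may be
   dropped, which halves the degree.  For r >= lam / 2, a van der Corput type
   argument gives |u(x)| <= C + 2 log(1 + (M_j0 / |P_j0(x)|)^(1 / (2 j0))), with C
   absolute because d <= 2 j0.  Since (M_j / |P_j|)^(1 / (2 j)) has an integral over the
   sphere bounded independently of n and P, Young's inequality
   s log(1 + y) <= s log^+ s + 1 + y bounds this part by a multiple of
   ||w||_{L log L} + 1.  After log2 d halvings the phase is constant and the mean-zero
   condition finishes the proof. *)
Require Import Defs.
From mathcomp Require Import all_boot all_order all_algebra.
From mathcomp Require Import -(notations) mpoly.
From mathcomp Require Import all_classical all_reals all_analysis.
From mathcomp Require Import measurable_realfun.
From mathcomp Require Import complex ring lra zify.
Set Implicit Arguments.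
Unset Strict Implicit.
Unset Printing Implicit Defensive.
Import Order.TTheory GRing.Theory Num.Theory.
Import numFieldNormedType.Exports.
Local Open Scope classical_set_scope.
Local Open Scope ring_scope.

(** * Polynomials in one variable *)

(** The obstacle is to keep every constant free of the dimension. Passing between the unit ball and
    the sphere costs a factor n, and replacing the sum of the coefficients of P_j by the largest one
    costs up to 2^n. To pay for this, the one-variable estimate is iterated over the coordinates
    with a Gaussian weight, whose parameter s makes each integration gain a factor 1/4; on the unit
    ball the weight is still at least exp(-s), whatever n is. The exponent 1 / (2 j) is half of 1 /
    j: the power of a polynomial of degree j is compared with the geometric mean of the inverse
    square roots of its j root factors, so every singularity remains integrable after AM-GM. In the
    van der Corput step, the integration by parts leaves a total variation of order d divided by a
    free parameter D. The choice D = d absorbs it, and the remainder then contains D only through (D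
    / j)^(1 / (2 d)), which stays bounded. *)

Section roots.
Variable R : realType.
Implicit Types (p : {poly R}) (z : R[i]) (zs : seq R[i]).
Local Open Scope complex_scope.

Lemma normc_ge0 z : 0 <= Normc.normc z.
Proof. by case: z => a b; exact: sqrtr_ge0. Qed.

Lemma normc_real (x : R) : Normc.normc x%:C = `|x|.
Proof. by rewrite /= expr0n/= addr0 sqrtr_sqr. Qed.

Lemma ger_Re_normc z : `|complex.Re z| <= Normc.normc z.
Proof.
by case: z => a b /=; rewrite -sqrtr_sqr; apply: ler_wsqrtr; rewrite lerDl sqr_ge0.
Qed.

Lemma normc_prod (I : Type) (r : seq I) (F : I -> R[i]) :
  Normc.normc (\prod_(i <- r) F i) = \prod_(i <- r) Normc.normc (F i).
Proof.
elim: r => [|i r ih]; first by rewrite !big_nil Normc.normc1.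
by rewrite !big_cons Normc.normcM ih.
Qed.

(** The product of the 1 + |z| expands into the sum of |z_1 ... z_m| over all subsets of the roots,
    so it dominates every coefficient at once. This is why an arbitrary coefficient may be chosen
    later on. *)
Lemma coef_prod_XsubC_le zs (k : nat) :
  Normc.normc (\prod_(z <- zs) ('X - z%:P))`_k <= \prod_(z <- zs) (1 + Normc.normc z).
Proof.
elim: zs k => [|z zs ih] k.
  rewrite !big_nil coefC; case: eqP => _; first by rewrite Normc.normc1.
  by rewrite Normc.normc0 ler01.
rewrite !big_cons mulrBl coefB coefXM coefCM.
have h : 0 <= \prod_(j <- zs) (1 + Normc.normc j).
  by apply: prodr_ge0 => w _; rewrite addr_ge0 ?normc_ge0.
apply: (le_trans (le_normcD _ _)); rewrite normcN Normc.normcM mulrDl mul1r lerD//.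
  by case: eqP => _; [rewrite Normc.normc0|exact: ih].
by rewrite ler_wpM2l// normc_ge0.
Qed.

Lemma real_poly_roots p : exists zs : seq R[i],
  [/\ (size zs <= (size p).-1)%N,
      forall t : R, `|p.[t]| = `|lead_coef p| * \prod_(z <- zs) Normc.normc (t%:C - z)
    & forall k, `|p`_k| <= `|lead_coef p| * \prod_(z <- zs) (1 + Normc.normc z)].
Proof.
pose q := map_poly (real_complex R) p.
have [zs hq] := closed_field_poly_normal q.
have lq : lead_coef q = (lead_coef p)%:C by rewrite lead_coef_map.
have [->|p0] := eqVneq p 0.
  exists [::]; split => //.
  - by move=> t; rewrite horner0 lead_coef0 normr0 mul0r.
  - by move=> k; rewrite coef0 lead_coef0 normr0 mul0r.
have l0 : lead_coef q != 0.
  by rewrite lq -[0]/(0%:C) (inj_eq (@complexI R)) lead_coef_eq0.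
exists zs; split.
- have: size q = size p by rewrite size_map_poly.
  by rewrite hq size_scale// size_prod_XsubC => <-.
- move=> t; rewrite -!normc_real -normc_prod -Normc.normcM -lq.
  have -> : (p.[t])%:C = q.[t%:C] by rewrite horner_map.
  rewrite [in LHS]hq hornerZ horner_prod; congr (Normc.normc (_ * _)).
  by apply: eq_bigr => z _; rewrite hornerXsubC.
- move=> k; rewrite -!normc_real -lq.
  have -> : (p`_k)%:C = q`_k by rewrite coef_map.
  rewrite {1}hq coefZ Normc.normcM ler_wpM2l ?normc_ge0//.
  exact: coef_prod_XsubC_le.
Qed.

End roots.

(** * Negative powers of a polynomial, controlled by any of its coefficients *)

Section singular_power.
Variable R : realType.

(* [y `^ (- b)] on [0, +oo[; powR would give the junk value 0 at y = 0. *)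
Definition psi (b y : R) : \bar R := if y == 0 then +oo%E else (y `^ (- b))%:E.

Lemma psi_ge0 b y : (0 <= psi b y)%E.
Proof. by rewrite /psi; case: ifP => // _; rewrite lee_fin powR_ge0. Qed.

Lemma psi_gt0 b y : 0 <= y -> (0 < psi b y)%E.
Proof.
move=> y0; rewrite /psi; case: eqVneq => // yN0.
by rewrite lte_fin powR_gt0// lt_neqAle eq_sym yN0.
Qed.

Lemma psi1 b : psi b 1 = 1%E.
Proof. by rewrite /psi oner_eq0 powR1. Qed.

Lemma le_psi b x y : 0 <= b -> 0 <= x -> x <= y -> (psi b y <= psi b x)%E.
Proof.
move=> b0 x0 xy; rewrite /psi; case: (eqVneq x 0) => [_|xN0]; first exact: leey.
have x1 : 0 < x by rewrite lt_neqAle eq_sym xN0.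
have y1 := lt_le_trans x1 xy.
rewrite gt_eqF// lee_fin !powRN lef_pV2 ?posrE ?powR_gt0//.
by apply: ge0_ler_powR => //; rewrite nnegrE ltW.
Qed.

Lemma psiM b x y : 0 < x -> 0 <= y -> psi b (x * y) = ((x `^ (- b))%:E * psi b y)%E.
Proof.
move=> x0 y0; rewrite /psi mulf_eq0 gt_eqF//=; case: eqVneq => [_|yN0].
  by rewrite gt0_muley// lte_fin powR_gt0.
by rewrite powRM// ltW.
Qed.

Lemma measurable_psi b : measurable_fun setT (psi b).
Proof.
apply: measurable_fun_ifT => //=.
- exact: measurable_fun_eqr.
- by apply/measurable_EFinP; exact: measurable_powR.
Qed.

(** The inverse square root of the distance, cut off so that it is never below 1: a factor coming
    from a far root or from padding can only enlarge a product. *)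
Definition hsing (u : R) : \bar R := psi 2^-1 (Num.min 1 `|u|).

Lemma hsing_ge1 u : (1 <= hsing u)%E.
Proof.
by rewrite /hsing -(psi1 2^-1) le_psi ?invr_ge0// ?le_min ?ler01 ?normr_ge0// ge_min lexx.
Qed.

Lemma AGM_seq (T : Type) (s : seq T) (E : T -> R) : (forall x, 0 <= E x) ->
  \prod_(x <- s) E x <= ((\sum_(x <- s) E x) / (size s)%:R) ^+ size s.
Proof.
move=> E0; rewrite !(big_tnth _ _ s).
have := @leif_AGM R 'I_(size s) predT (fun i => E (tnth (in_tuple s) i)) (fun i _ => E0 _).
by rewrite /= card_ord => -[].
Qed.

(* Write p as a constant times the product of t - z over its complex roots z.
   For |t| <= 1, (1 + |z|) / |t - z| <= 4 max(1, 1 / |t - Re z|), while |p_k| is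
   at most the same constant times the product of the 1 + |z|; AM-GM then turns
   the product of singularities into a sum. *)
Lemma poly_psi_bound (p : {poly R}) (d k : nat) : (0 < d)%N -> (size p <= d.+1)%N ->
  exists2 xs : seq R, size xs = d & forall t : R, `|t| <= 1 ->
  (psi (2 * d%:R)^-1 `|p.[t]| <= psi (2 * d%:R)^-1 `|p`_k| *
     ((2 / d%:R)%:E * \sum_(x <- xs) hsing (t - x)))%E.
Proof.
move=> d0 sp.
have d0' : 0 < d%:R :> R by rewrite ltr0n.
have [zs [szs pE pk]] := real_poly_roots p.
(* Only the real parts matter, as |t - Re z| <= |t - z|. Zeros pad the list to length exactly [d],
   the number of factors in the AM-GM step. *)
pose ws := [seq complex.Re z | z <- zs] ++ nseq (d - size zs) 0.
have szsd : (size zs <= d)%N by rewrite (leq_trans szs)// -subn1 leq_subLR.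
exists ws; first by rewrite size_cat size_map size_nseq subnKC.
move=> t t1.
have sws : size ws = d by rewrite size_cat size_map size_nseq subnKC.
have S0 : (0 < \sum_(x <- ws) hsing (t - x))%E.
  case: (ws) sws d0 => [<-//|w ws' _ _].
  rewrite big_cons; apply: (lt_le_trans (lt_le_trans lte01 (hsing_ge1 (t - w)))).
  by rewrite leeDl//; apply: sume_ge0 => i _; apply: le_trans (hsing_ge1 _).
have S1 : (0 < (2 / d%:R)%:E * \sum_(x <- ws) hsing (t - x))%E.
  by rewrite mule_gt0// lte_fin divr_gt0.
have [pk0|pk0] := eqVneq `|p`_k| 0; first by rewrite pk0 {2}/psi eqxx gt0_mulye// leey.
(* If [t] lies in [ws], one summand is +oo and so is the right-hand side, the factor coming from p_k
   being positive. *)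
have [/hasP[x xws /eqP tx]|/hasPn tws] := boolP (has (fun x => t - x == 0) ws).
  suff -> : (\sum_(x <- ws) hsing (t - x) = +oo)%E.
    rewrite gt0_muley ?lte_fin ?divr_gt0// gt0_muley ?leey//.
    exact: psi_gt0.
  rewrite (big_rem x)//= /hsing tx normr0 /Num.min ltr10 /psi eqxx addye//.
  rewrite -ltNye; apply: (lt_le_trans (ltNyr 0)); apply: sume_ge0 => i _.
  by apply: le_trans (hsing_ge1 _).
pose g x : R := (Num.min 1 `|t - x|) `^ (- 2^-1).
have m0 x : x \in ws -> 0 < Num.min 1 `|t - x|.
  by move=> /tws h; rewrite lt_min ltr01 normr_gt0.
have hE x : x \in ws -> hsing (t - x) = (g x)%:E.
  by move=> xws; rewrite /hsing /psi gt_eqF// m0.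
have g1 x : x \in ws -> 1 <= g x.
  by move=> xws; rewrite -lee_fin -hE// hsing_ge1.
have g0 x : 0 <= g x by exact: powR_ge0.
have gE x : x \in ws -> (g x) ^+ 2 = (Num.min 1 `|t - x|)^-1.
  move=> xws; rewrite /g -powR_mulrn ?powR_ge0// -powRrM mulNr mulVf ?pnatr_eq0//.
  by rewrite powR_inv1// ltW// m0.
rewrite (eq_big_seq (fun x => (g x)%:E)); last by move=> x xws; rewrite hE.
rewrite sumEFin -EFinM.
(* The claim before the root of order 2 d is taken. The power is 2 d because 1 / min(1, |t - x|) is
   the square of [g x]; the 4 = 2^2 of each factor becomes the 2 in front of the mean. *)
have key : `|p`_k| <= `|p.[t]| * ((2 / d%:R) * \sum_(x <- ws) g x) ^+ (2 * d)%N.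
  apply: (@le_trans _ _ (`|p.[t]| * \prod_(x <- ws) (4 * g x ^+ 2))).
    apply: (le_trans (pk k)); rewrite pE -mulrA ler_wpM2l//.
    rewrite {1}/ws big_cat/= big_map mulrA -[leLHS]mulr1 -big_split/=.
    have h1 : 1 <= \prod_(i <- nseq (d - size zs) 0) (4 * g i ^+ 2).
      rewrite big_seq; apply: (big_ind (fun x : R => 1 <= x)) => //.
        by move=> x y x1 y1; rewrite -[1]mulr1 ler_pM.
      move=> x xn; have : 1 <= g x by apply: g1; rewrite mem_cat xn orbT.
      move=> h; nra.
    apply: ler_pM => //.
      by apply: prodr_ge0 => z _; rewrite addr_ge0// normc_ge0.
    rewrite !big_seq; apply: ler_prod => z zz; rewrite addr_ge0 ?normc_ge0//=.
    have zws : complex.Re z \in ws by rewrite mem_cat map_f.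
    rewrite gE//.
    have mz := m0 _ zws; set m := Num.min _ _ in mz *.
    rewrite mulrCA mulrA mulrC -ler_pdivrMl ?invr_gt0// invrK.
    have m1 : m <= 1 by rewrite /m ge_min lexx.
    have m2 : m <= Normc.normc (t%:C%C - z).
      apply: (@le_trans _ _ `|t - complex.Re z|); first by rewrite /m ge_min lexx orbT.
      have -> : t - complex.Re z = complex.Re (t%:C%C - z) by case: (z).
      exact: ger_Re_normc.
    have m3 : Normc.normc z <= 1 + Normc.normc (t%:C%C - z).
      have {1}-> : z = t%:C%C - (t%:C%C - z) by rewrite opprB addrC subrK.
      by apply: (le_trans (le_normcD _ _)); rewrite normcN normc_real lerD.
    have := normc_ge0 (t%:C%C - z); have := normc_ge0 z.
    move: (Normc.normc z) (Normc.normc (t%:C%C - z)) m2 m3 => a b *; nra.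
  rewrite ler_wpM2l// exprM.
  rewrite (_ : \prod_(x <- ws) _ = (\prod_(x <- ws) (2 * g x)) ^+ 2); last first.
    rewrite -prodrXl; apply: eq_bigr => x _; rewrite exprMn; congr (_ * _); ring.
  rewrite -exprM mulnC exprM lerXn2r// ?nnegrE.
    by apply: prodr_ge0 => x _; rewrite mulr_ge0.
    by rewrite exprn_ge0// mulr_ge0 ?divr_ge0// ?sumr_ge0.
  apply: (le_trans (AGM_seq _ _)) => [x|]; first by rewrite mulr_ge0.
  by rewrite sws -mulr_sumr mulrAC.
set S := 2 / d%:R * _ in key *.
have S0' : 0 <= S by rewrite mulr_ge0 ?sumr_ge0// divr_ge0.
have pt0 : 0 < `|p.[t]|.
  rewrite lt_neqAle normr_ge0 andbT eq_sym; apply: contra_neq pk0 => pt0.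
  by apply/eqP; rewrite eq_le normr_ge0 andbT (le_trans key)// pt0 mul0r.
rewrite /psi (negbTE pk0) gt_eqF// -EFinM lee_fin.
have pk1 : 0 < `|p`_k| by rewrite lt_neqAle eq_sym pk0 normr_ge0.
rewrite !powRN -(ler_pM2l (powR_gt0 (2 * d%:R)^-1 pk1)) mulrA divff ?mul1r; last first.
  by rewrite gt_eqF// powR_gt0.
rewrite ler_pdivrMr ?powR_gt0//.
have := ge0_ler_powR (r := (2 * d%:R)^-1) _ _ _ key.
rewrite !nnegrE invr_ge0 mulr_ge0// normr_ge0 mulr_ge0 ?exprn_ge0//.
move=> /(_ isT isT isT) /le_trans; apply.
rewrite powRM ?exprn_ge0// -(powR_mulrn (2 * d)%N S0') -powRrM natrM divff; last first.
  by rewrite mulf_neq0 ?pnatr_eq0 -?lt0n.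
by rewrite powRr1// mulrC.
Qed.

End singular_power.

(** * Integral of an inverse square root near the origin, uniformly in the position of the
    singularity *)

Section singular_integral.
Variable R : realType.
Local Notation mu := (@lebesgue_measure R).

Let D (x : R) (k : nat) : set R := `[x - 16 ^- k, x + 16 ^- k].
Let T (x : R) (k : nat) (u : R) : \bar R := ((4 : R) ^+ k.+1 * \1_(D x k) u)%:E.

Lemma measurable_EFin_indic (A B : set R) : measurable B ->
  measurable_fun A (fun t : R => (\1_B t : R)%:E).
Proof. by move=> mB; apply/measurable_EFinP; exact: measurable_indic. Qed.

Lemma exp16_lt (e : R) : 0 < e -> exists k : nat, 16 ^- k < e.
Proof.
move=> e0; have [k _ /(_ k (leqnn k))] := near_infty_natSinv_expn_lt (PosNum e0).
rewrite /= => h; exists k; apply: le_lt_trans h; rewrite div1r lef_pV2 ?posrE ?exprn_gt0//.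
by rewrite lerXn2r// ?nnegrE// ler_nat.
Qed.

(* |u|^(-1/2) is dominated by the sum of 4^(k+1) over the k with |u| <= 16^-k. *)
Lemma hsing_le_series (u x : R) :
  (hsing (u - x) <= 1 + \sum_(0 <= k <oo) T x k u)%E.
Proof.
have t0 k : (0 <= T x k u)%E by rewrite lee_fin mulr_ge0 ?exprn_ge0.
have S0 : (0 <= \sum_(0 <= k <oo) T x k u)%E by apply: nneseries_ge0.
have term k : `|u - x| <= 16 ^- k ->
    (((4 : R) ^+ k.+1)%:E <= \sum_(0 <= k <oo) T x k u)%E.
  move=> uk; have e1 : (\1_(D x k) u : R) = 1.
    rewrite indicE mem_set// /D/= in_itv/=; move: uk; rewrite ler_norml => /andP[].
    by move: (16 ^- k) => e h1 h2; apply/andP; split; lra.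
  suff : (T x k u <= \sum_(0 <= k <oo) T x k u)%E by rewrite {1}/T e1 mulr1.
  apply: le_trans (nneseries_lim_ge k.+1 _) => //.
  by rewrite big_nat_recr//= leeDr// sume_ge0.
(* At [u = x] the series is +oo: it exceeds 4^(k+1) >= k for every [k]. *)
have [ux0|ux0] := eqVneq (u - x) 0.
  suff -> : (\sum_(0 <= k <oo) T x k u)%E = +oo%E by rewrite addey// leey.
  apply/eqP; rewrite eq_le leey/= leNgt; apply/negP => h.
  have hf : (\sum_(0 <= k <oo) T x k u)%E \is a fin_num.
    by rewrite ge0_fin_numE// (lt_le_trans h)// leey.
  have h1 k : (k%:R <= fine (\sum_(0 <= k <oo) T x k u)%E).
    rewrite -lee_fin fineK//; apply: le_trans (term k _); last first.
      by rewrite ux0 normr0 invr_ge0 exprn_ge0.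
    rewrite lee_fin -natrX ler_nat ltnW// (leq_trans (ltn_expl k (isT : 1 < 2)%N))//.
    by rewrite (leq_trans (leq_pexp2l _ (leqnSn k)))// leq_exp2r.
  have := h1 (Num.Def.archi_bound (fine (\sum_(0 <= k <oo) T x k u)%E)).
  by rewrite leNgt archi_boundP// fine_ge0.
have v0 : 0 < `|u - x| by rewrite normr_gt0.
have [v1|v1] := leP 1 `|u - x|.
  by rewrite /hsing (min_idPl v1) psi1 leeDl.
rewrite /hsing (min_idPr (ltW v1)) /psi gt_eqF//.
(* If k + 1 is the least index with 16^-(k+1) < |u - x|, then |u - x| <= 16^-k, so term k is
   present, and its weight 4^(k+1) is at least |u - x|^(-1/2). Index 0 is excluded by |u - x| <
   1. *)
have [k hk kmin] := ex_minnP (exp16_lt v0).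
case: k hk kmin => [|k] hk kmin; first by move: hk; rewrite expr0 invr1 ltNge ltW.
have uk : `|u - x| <= 16 ^- k.
  by rewrite leNgt; apply/negP => /kmin; rewrite ltnn.
apply: (le_trans _ (le_trans (term k uk) (leeDr _ _))) => //.
rewrite lee_fin powRN invf_ple ?posrE ?powR_gt0 ?exprn_gt0//.
have -> : 4 ^- k.+1 = (16 ^- k.+1) `^ 2^-1 :> R.
  have h4 : (4 : R) `^ (- k.+1%:R) = 4 ^- k.+1 by rewrite powRN powR_mulrn.
  have -> : 16 ^- k.+1 = (4 ^- k.+1) `^ 2 :> R.
    rewrite powR_mulrn ?invr_ge0 ?exprn_ge0// exprVn -exprM mulnC exprM.
    by congr (_ ^- _); rewrite -natrX.
  by rewrite -powRrM divff// powRr1// invr_ge0 exprn_ge0.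
by apply: ge0_ler_powR; rewrite ?nnegrE ?invr_ge0 ?exprn_ge0// ltW.
Qed.

Lemma measurable_hsing (x : R) : measurable_fun setT (fun u : R => hsing (u - x)).
Proof.
apply: (measurableT_comp (measurable_psi _)) => /=.
apply: measurable_minr => //; apply: measurableT_comp => //.
by apply: measurable_funB.
Qed.

(** What matters is the decay in [K], uniform in [x]. The constant 1 in front of the series
    contributes 2 / 16^K <= 2 / 2^K, and term k at most 8 / 2^(K+k), which sums to 16 / 2^K. *)
Lemma integral_hsing_le (x : R) (K : nat) :
  (\int[mu]_(t in `[(- 16 ^- K)%R, (16 ^- K)%R]) hsing (t - x) <= (18 / 2 ^+ K)%:E)%E.
Proof.
set I := [set` _].
have mI : measurable I by exact: measurable_itv.
have mD k : measurable (D x k) by exact: measurable_itv.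
have mT k : measurable_fun I (T x k).
  by apply/measurable_EFinP; apply: measurable_funM => //; exact: measurable_indic.
have mDI k : measurable (D x k `&` I) by exact: measurableI.
have t0 k u : (0 <= T x k u)%E by rewrite lee_fin mulr_ge0 ?exprn_ge0.
have p16 k : 0 < 16 ^- k :> R by rewrite invr_gt0 exprn_gt0.
have muI : mu I = (2 * 16 ^- K)%:E.
  rewrite /I lebesgue_measure_itv/= lte_fin gtrN// -EFinD; congr EFin; ring.
have muD k : mu (D x k) = (2 * 16 ^- k)%:E.
  rewrite /D lebesgue_measure_itv/= lte_fin ifT.
    by rewrite -EFinD; congr EFin; ring.
  have := p16 k; lra.
apply: (@le_trans _ _ (\int[mu]_(t in I) (1 + \sum_(0 <= k <oo) T x k t))%E).
  apply: ge0_le_integral => //.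
  - by move=> t _; exact: psi_ge0.
  - exact: measurable_funTS (measurable_hsing x).
  - by apply: emeasurable_funD => //; apply: ge0_emeasurable_sum => // k _; exact: mT.
  - by move=> t _; exact: hsing_le_series.
rewrite ge0_integralD//; last 2 first.
  - by move=> t _; rewrite nneseries_ge0.
  - by apply: ge0_emeasurable_sum => // k _; exact: mT.
rewrite integral_cst//= mul1e muI integral_nneseries//.
apply: (@le_trans _ _ ((2 * 16 ^- K)%:E + (16 / 2 ^+ K)%:E)%E); last first.
  rewrite -EFinD lee_fin; suff : 16 ^- K <= 2 ^- K :> R by lra.
  by rewrite lef_pV2 ?posrE ?exprn_gt0// lerXn2r ?nnegrE// ler_nat.
apply: leeD2l; apply: le_trans (epsilon_trick0 (eps := 16 / 2 ^+ K) xpredT _); last first.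
  by rewrite divr_ge0// exprn_ge0.
apply: lee_nneseries => k _; first by move=> _; apply: integral_ge0.
rewrite /T; under eq_integral do rewrite EFinM.
rewrite ge0_integralZl; last 4 first.
  - by [].
  - exact: measurable_EFin_indic.
  - by move=> t _; rewrite lee_fin.
  - by rewrite lee_fin exprn_ge0.
rewrite integral_indic; [|exact: mI|exact: mD].
(* The measure is at most 2 / 16^max(k, K), and 16^max(k, K) >= 2^K 8^k: the factor 8^k beats the
   weight 4^(k+1), the factor 2^K is the decay wanted. *)
have h : (mu (D x k `&` I) <= (2 * (2 ^- K * 8 ^- k))%:E)%E.
  have [Kk|kK] := leqP K k.
    apply: (@le_trans _ _ (mu (D x k))).
      by apply: le_measure; rewrite ?inE; [exact: mDI|exact: mD|exact: subIsetl].
    rewrite muD lee_fin ler_wpM2l// -invfM lef_pV2 ?posrE ?mulr_gt0 ?exprn_gt0//.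
    rewrite -[X in _ <= X ^+ _](_ : 2 * 8 = 16 :> R); last by rewrite -natrM.
    rewrite exprMn ler_wpM2r ?exprn_ge0//.
    by rewrite ler_weXn2l// ler1n.
  apply: (@le_trans _ _ (mu I)).
    by apply: le_measure; rewrite ?inE; [exact: mDI|exact: mI|exact: subIsetr].
  rewrite muI lee_fin ler_wpM2l// -invfM lef_pV2 ?posrE ?mulr_gt0 ?exprn_gt0//.
  rewrite -[X in _ <= X ^+ _](_ : 2 * 8 = 16 :> R); last by rewrite -natrM.
  rewrite exprMn ler_wpM2l ?exprn_ge0//.
  by rewrite ler_weXn2l// ?ler1n// ltnW.
apply: (le_trans (lee_wpmul2l _ h)); first by rewrite lee_fin exprn_ge0.
rewrite -EFinM lee_fin exprS.
have -> : (8 : R) ^- k = 4 ^- k * 2 ^- k.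
  by rewrite -invfM -exprMn; congr (_ ^- _); rewrite -natrM.
rewrite natrX exprS le_eqVlt; apply/orP; left; apply/eqP.
have h2 : (2 : R) ^+ k != 0 by rewrite expf_neq0.
have h2' : (2 : R) ^+ K != 0 by rewrite expf_neq0.
have h4 : (4 : R) ^+ k != 0 by rewrite expf_neq0.
field; by rewrite ?h2 ?h2' ?h4.
Qed.

End singular_integral.

(** * One-variable estimate with a Gaussian weight *)

Section weighted_poly.
Variable R : realType.
Local Notation mu := (@lebesgue_measure R).

(* The Gaussian weight makes the constant eta as small as desired, which pays for
   the dimension-dependent factors when the bound is iterated over n variables. *)
Lemma poly_psi_integral_small (eta : R) : 0 < eta -> exists2 s : R, 0 <= s &
  forall (p : {poly R}) (d k : nat), (0 < d)%N -> (size p <= d.+1)%N ->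
  (\int[mu]_(t in `[(-1)%R, 1%R])
     (psi (2 * d%:R)^-1 `|p.[t]| * (expR (- (s * t ^+ 2)))%:E)
   <= psi (2 * d%:R)^-1 `|p`_k| * eta%:E)%E.
Proof.
move=> eta0.

have e72 : 0 < eta / 72 by rewrite divr_gt0.
(* On [-16^-K, 16^-K] smallness comes from the short interval, as 18 / 2^K < eta / 4. Outside it
   comes from the weight, at most eta / 72 there, against the full integral 18. Hence [s] is chosen
   after [K]. *)
have [K hK] : exists K, 36 / 2 ^+ K < eta / 2.
  have [K _ /(_ K (leqnn K))] := near_infty_natSinv_expn_lt (PosNum e72).
  by rewrite /= div1r => h; exists K; lra.
have e16 : 0 < (16 : R) ^- K ^+ 2 by rewrite exprn_gt0// invr_gt0 exprn_gt0.
have [s s0 hs] : exists2 s : R, 0 <= s & 36 * expR (- (s * 16 ^- K ^+ 2)) <= eta / 2.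
  exists (Num.max 0 (- ln (eta / 72) / 16 ^- K ^+ 2)); first by rewrite le_max lexx.
  have : expR (- (Num.max 0 (- ln (eta / 72) / 16 ^- K ^+ 2) * 16 ^- K ^+ 2)) <= eta / 72.
    rewrite -[leRHS](lnK (x := eta / 72)) ?posrE// ler_expR lerNl.
    by rewrite -ler_pdivrMr// le_max lexx orbT.
  by move: (expR _) => y; lra.
exists s => // p d k d0 sp.
have d0' : 0 < d%:R :> R by rewrite ltr0n.
have [xs sxs hx] := poly_psi_bound k d0 sp.
set I := [set` _].
have mI : measurable I by exact: measurable_itv.
have mp : measurable_fun setT (fun t : R => psi (2 * d%:R)^-1 `|p.[t]|).
  apply: (measurableT_comp (measurable_psi _)) => /=; apply: measurableT_comp => //.
  by apply: continuous_measurable_fun; exact: continuous_horner.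
have mexp : measurable_fun setT (fun t : R => (expR (- (s * t ^+ 2)))%:E).
  apply/measurable_EFinP; apply: measurableT_comp => //; apply: measurableT_comp => //.
  by apply: measurable_funM => //; exact: measurable_funX.
have mexpI : measurable_fun I (fun t : R => (expR (- (s * t ^+ 2)))%:E).
  exact: measurable_funTS mexp.
have hp0 (u : R) : (0 <= hsing u)%E by exact: psi_ge0.
have mh x : measurable_fun I (fun t : R => hsing (t - x)).
  exact: measurable_funTS (measurable_hsing x).
have key x : (\int[mu]_(t in I) (hsing (t - x) * (expR (- (s * t ^+ 2)))%:E)
    <= (eta / 2)%:E)%E.
  pose J := [set` `[- (16 : R) ^- K, 16 ^- K]].
  have mJ : measurable J by exact: measurable_itv.
  apply: (@le_trans _ _ (\int[mu]_(t in I) (hsing (t - x) * (\1_J t)%:E +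
     (expR (- (s * 16 ^- K ^+ 2)))%:E * hsing (t - x))))%E.
    apply: ge0_le_integral => //.
    - by move=> t _; rewrite mule_ge0// lee_fin expR_ge0.
    - exact: emeasurable_funM (mh x) mexpI.
    - apply: emeasurable_funD.
        by apply: emeasurable_funM; [exact: mh|exact: measurable_EFin_indic].
      by apply: emeasurable_funM; [exact: measurable_cst|exact: mh].
    - move=> t _; rewrite [X in (_ <= _ + X)%E]muleC -ge0_muleDr ?lee_fin ?expR_ge0//.
      rewrite lee_wpmul2l// -EFinD lee_fin indicE.
      case: (boolP (t \in J)) => tJ.
        rewrite mulr1n; apply: (@le_trans _ _ 1); last by rewrite lerDl expR_ge0.
        by rewrite -expR0 ler_expR oppr_le0 mulr_ge0// sqr_ge0.
      rewrite mulr0n add0r ler_expR lerN2 ler_wpM2l//.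
      have : 16 ^- K <= `|t|.
        rewrite leNgt; apply: contra tJ => h; rewrite inE /J/= in_itv/=.
        by rewrite -ler_norml ltW.
      rewrite -[t ^+ 2]real_normK ?num_real// => h.
      by rewrite lerXn2r// nnegrE ?invr_ge0 ?exprn_ge0.
  rewrite ge0_integralD; last 5 first.
    - by [].
    - by move=> t _; rewrite mule_ge0// lee_fin.
    - by apply: emeasurable_funM; [exact: mh|exact: measurable_EFin_indic].
    - by move=> t _; rewrite mule_ge0// lee_fin expR_ge0.
    - by apply: emeasurable_funM; [exact: measurable_cst|exact: mh].
  rewrite ge0_integralZl; [|by []|exact: mh|by []|by rewrite lee_fin expR_ge0].
  have h1 : (\int[mu]_(t in I) (hsing (t - x) * (\1_J t)%:E) <= (18 / 2 ^+ K)%:E)%E.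
    apply: le_trans (integral_hsing_le x K); rewrite -/J.
    have -> : (\int[mu]_(t in J) hsing (t - x) = \int[mu]_t (hsing (t - x) * (\1_J t)%:E))%E.
      rewrite integral_mkcond; apply: eq_integral => t _; rewrite /patch indicE.
      by case: ifP; rewrite ?mule1 ?mule0.
    apply: ge0_subset_integral => //.
    - apply: emeasurable_funM; first exact: measurable_hsing.
      exact: measurable_EFin_indic.
    - by move=> t _; rewrite mule_ge0// lee_fin.
  have h2 : (\int[mu]_(t in I) hsing (t - x) <= (18 : R)%:E)%E.
    by have := integral_hsing_le x 0; rewrite !expr0 invr1 mulr1.
  apply: (le_trans (leeD h1 (lee_wpmul2l _ h2))); first by rewrite lee_fin expR_ge0.
  rewrite -EFinM -EFinD lee_fin; move: hs hK; move: (expR _) => y hs hK; lra.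
apply: (@le_trans _ _ (\int[mu]_(t in I) (psi (2 * d%:R)^-1 `|p`_k| * ((2 / d%:R)%:E *
   \sum_(x <- xs) hsing (t - x)) * (expR (- (s * t ^+ 2)))%:E)))%E.
  apply: ge0_le_integral => //.
  - by move=> t _; rewrite mule_ge0// ?psi_ge0// lee_fin expR_ge0.
  - by apply: emeasurable_funM mexpI; exact: measurable_funTS mp.
  - apply: emeasurable_funM mexpI.
    apply: emeasurable_funM; first exact: measurable_cst.
    apply: emeasurable_funM; first exact: measurable_cst.
    exact: emeasurable_sum.
  - move=> t; rewrite /I/= in_itv/= => t1; apply: lee_wpmul2r.
      by rewrite lee_fin expR_ge0.
    by apply: hx; rewrite ler_norml.
under eq_integral do rewrite -2!muleA.
have ms : measurable_fun I
    (fun t : R => (\sum_(x <- xs) hsing (t - x)) * (expR (- (s * t ^+ 2)))%:E)%E.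
  by apply: emeasurable_funM; [exact: emeasurable_sum|exact: mexpI].
have s0' t : (0 <= (\sum_(x <- xs) hsing (t - x)) * (expR (- (s * t ^+ 2)))%:E)%E.
  by rewrite mule_ge0 ?sume_ge0// lee_fin expR_ge0.
rewrite ge0_integralZl; last 4 first.
  - by [].
  - by apply: emeasurable_funM; [exact: measurable_cst|exact: ms].
  - by move=> t _; rewrite mule_ge0// lee_fin divr_ge0.
  - exact: psi_ge0.
rewrite ge0_integralZl; [|by []|exact: ms|by []|by rewrite lee_fin divr_ge0].
rewrite lee_wpmul2l ?psi_ge0//.
(* Each of the d singularities contributes eta / 2, and the factor 2 / d restores eta. *)
apply: (@le_trans _ _ ((2 / d%:R)%:E * (d%:R * (eta / 2))%:E))%E; last first.
  by rewrite -EFinM lee_fin le_eqVlt; apply/orP; left; apply/eqP; field; rewrite gt_eqF.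
apply: lee_wpmul2l; first by rewrite lee_fin divr_ge0.
under eq_integral do rewrite ge0_sume_distrl//.
rewrite ge0_integral_sum; last 3 first.
  - by [].
  - by move=> x; exact: emeasurable_funM (mh x) mexpI.
  - by move=> x t _; rewrite mule_ge0// lee_fin expR_ge0.
apply: (le_trans (lee_sum _ (fun x _ => key x))).
by rewrite sumEFin big_const_seq count_predT sxs iter_addr_0 mulr_natl.
Qed.

End weighted_poly.

(** * Calculus on a segment *)

Section one_dim_calculus.
Variable R : realType.
Local Notation mu := (@lebesgue_measure R).
Implicit Types (F f g : R -> R) (a b : R).

Lemma continuous_at_within f a b : (forall x, a <= x <= b -> {for x, continuous f}) ->
  {within `[a, b], continuous f}.
Proof.
by move=> cf; apply: continuous_in_subspaceT => x; rewrite inE/= in_itv/=; exact: cf.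
Qed.

Lemma is_derive_continuous_at f (x df : R) : is_derive x 1 f df -> {for x, continuous f}.
Proof.
by move=> h; apply: differentiable_continuous; apply/derivable1_diffP; apply: ex_derive.
Qed.

Lemma FTC2_is_derive F f a b : a < b ->
  (forall x, a <= x <= b -> is_derive x 1 F (f x)) ->
  (forall x, a <= x <= b -> {for x, continuous f}) ->
  (\int[mu]_(x in `[a, b]) (f x)%:E)%E = (F b - F a)%:E.
Proof.
move=> ab dF cf; have cF x : a <= x <= b -> {for x, continuous F}.
  by move=> /dF; exact: is_derive_continuous_at.
rewrite EFinB; apply: continuous_FTC2 => //.
- exact: continuous_at_within.
- split.
  + move=> x; rewrite in_itv/= => /andP[ax xb]; have h : a <= x <= b by rewrite !ltW.
    by have [] := dF _ h.
  + by apply: cvg_at_right_filter; apply: cF; rewrite lexx ltW.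
  + by apply: cvg_at_left_filter; apply: cF; rewrite lexx ltW.
- move=> x; rewrite in_itv/= => /andP[ax xb]; have h : a <= x <= b by rewrite !ltW.
  by rewrite derive1E; have [_ ->] := dF _ h.
Qed.

Lemma continuous_itv_integrable f a b :
  (forall x, a <= x <= b -> {for x, continuous f}) ->
  mu.-integrable `[a, b] (EFin \o f).
Proof.
move=> cf; apply: continuous_compact_integrable; first exact: segment_compact.
exact: continuous_at_within.
Qed.

Lemma continuous_itv_measurable f a b :
  (forall x, a <= x <= b -> {for x, continuous f}) ->
  measurable_fun `[a, b] f.
Proof. by move/continuous_itv_integrable/measurable_int/measurable_EFinP. Qed.

Lemma Rintegral_FTC2 F f a b : a < b ->
  (forall x, a <= x <= b -> is_derive x 1 F (f x)) ->
  (forall x, a <= x <= b -> {for x, continuous f}) ->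
  \int[mu]_(x in `[a, b]) f x = F b - F a.
Proof. by move=> ab dF cf; rewrite /Rintegral (FTC2_is_derive ab dF cf). Qed.

Lemma EFin_Rintegral_ge0 f a b :
  (forall x, a <= x <= b -> {for x, continuous f}) ->
  (\int[mu]_(x in `[a, b]) f x)%R%:E = (\int[mu]_(x in `[a, b]) (f x)%:E)%E.
Proof.
by move=> cf; rewrite /Rintegral fineK//; apply: integrable_fin_num => //;
  exact: continuous_itv_integrable.
Qed.

(** The primitive atan((r - x) / |y|) varies by less than pi on the whole line, whence a bound free
    of the segment. *)
Lemma poisson_kernel_integral (x y a b : R) : a < b -> y != 0 ->
  (\int[mu]_(r in `[a, b]) (`|y| / ((r - x) ^+ 2 + y ^+ 2))%:E <= (pi : R)%:E)%E.
Proof.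
move=> ab y0; have y1 : 0 < `|y| by rewrite normr_gt0.
have den r : (r - x) ^+ 2 + y ^+ 2 != 0.
  by rewrite gt_eqF// ltr_wpDl ?sqr_ge0// exprn_even_gt0.
pose F r := atan ((r - x) / `|y|).
have dF (r : R) : is_derive r (1 : R) F (`|y| / ((r - x) ^+ 2 + y ^+ 2)).
  have h : is_derive r (1 : R) (fun r : R => (r - x) / `|y|) (`|y|^-1).
    by apply: is_derive_eq; rewrite /GRing.scale/= mulr0 add0r subr0 mulr1.
  apply: is_derive_eq (is_derive1_comp (is_derive1_atan _) h) _.
  have := den r; rewrite -[y ^+ 2]real_normK ?num_real// => d.
  have n0 : `|y| != 0 by rewrite gt_eqF.
  have -> : 1 + ((r - x) / `|y|) ^+ 2 = ((r - x) ^+ 2 + `|y| ^+ 2) / `|y| ^+ 2 by field.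
  by rewrite invf_div mulrAC expr2 mulfK.
have cf (r : R) : {for r, continuous (fun r : R => `|y| / ((r - x) ^+ 2 + y ^+ 2))}.
  apply: cvgM; first exact: cvg_cst.
  apply: cvgV => //; apply: cvgD; last exact: cvg_cst.
  by apply: cvgM; apply: cvgB; [exact: cvg_id|exact: cvg_cst|exact: cvg_id|exact: cvg_cst].
rewrite (FTC2_is_derive ab (fun r _ => dF r) (fun r _ => cf r)) lee_fin /F.
have := atan_ltpi2 ((b - x) / `|y|); have := atan_gtNpi2 ((a - x) / `|y|).
move: (atan _) (atan _) => u v; lra.
Qed.

End one_dim_calculus.

(** * Oscillatory integrals in one variable *)

Section total_variation.
Variable R : realType.
Local Notation mu := (@lebesgue_measure R).
Local Open Scope complex_scope.

Lemma Im_sum (I : Type) (r : seq I) (F : I -> R[i]) :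
  complex.Im (\sum_(i <- r) F i) = \sum_(i <- r) complex.Im (F i).
Proof.
elim: r => [|i r ih]; first by rewrite !big_nil.
by rewrite !big_cons -ih; case: (F i) => a b; case: (\sum_(_ <- _) _).
Qed.

Lemma Im_div_real (c a b : R) :
  complex.Im (c%:C / (a +i* b)) = - (c * b) / (a ^+ 2 + b ^+ 2).
Proof.
change (c * - (b / (a ^+ 2 + b ^+ 2)) + 0 * (a / (a ^+ 2 + b ^+ 2)) =
  - (c * b) / (a ^+ 2 + b ^+ 2)).
by rewrite mul0r addr0 mulrN mulNr mulrA.
Qed.

Lemma horner_deriv_prod_XsubC (zs : seq R[i]) (w : R[i]) :
  (forall z, z \in zs -> w != z) ->
  (\prod_(z <- zs) ('X - z%:P))^`().[w] =
  (\prod_(z <- zs) ('X - z%:P)).[w] * \sum_(z <- zs) (w - z)^-1.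
Proof.
elim: zs => [|z zs ih] h; first by rewrite !big_nil derivC horner0 mulr0.
rewrite !big_cons derivM derivXsubC mul1r hornerD !hornerM hornerXsubC ih; last first.
  by move=> u uz; apply: h; rewrite inE uz orbT.
have wz : w - z != 0 by rewrite subr_eq0 h// inE eqxx.
by field.
Qed.

(** As D > 0, the polynomial q + i D has no zero on the real line. Its roots therefore have nonzero
    imaginary parts, and every summand is a genuine Poisson kernel. *)
Lemma deriv_quotient_bound (q : {poly R}) (D : R) : 0 < D ->
  exists zs : seq R[i], [/\ (size zs <= (size q).-1)%N,
    forall z, z \in zs -> complex.Im z != 0 &
    forall r : R, D * `|q^`().[r]| / (q.[r] ^+ 2 + D ^+ 2) <=
     \sum_(z <- zs) `|complex.Im z| / ((r - complex.Re z) ^+ 2 + complex.Im z ^+ 2)].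
Proof.
move=> D0; have [q1|q1] := leqP (size q) 1.
  exists [::]; split => // r.
  by rewrite big_nil [q]size1_polyC// derivC horner0 normr0 mulr0 mul0r.
pose q' := map_poly (real_complex R) q.
pose P := q' + (0 +i* D)%:P.
have sq : size q' = size q by rewrite size_map_poly.
have sP : size P = size q.
  rewrite /P size_polyDl ?sq// (leq_ltn_trans (size_polyC_leq1 _))//.
have [zs hP] := closed_field_poly_normal P.
have l0 : lead_coef P != 0 by rewrite lead_coef_eq0 -size_poly_eq0 sP; case: (size q) q1.
have PE (r : R) : P.[r%:C] = q.[r] +i* D.
  by rewrite hornerD hornerC /q' horner_map/=; apply/eqP; rewrite eq_complex/= add0r addr0 !eqxx.
have rN (r : R) : P.[r%:C] != 0.
  by rewrite PE eq_complex/= negb_and (gt_eqF D0) orbT.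
have rz (r : R) z : z \in zs -> r%:C != z.
  move=> zz; apply: contra_neq (rN r) => ->; rewrite hP hornerZ horner_prod.
  by rewrite (big_rem z)//= hornerXsubC subrr mul0r mulr0.
exists zs; split.
- by rewrite -sP hP size_scale// size_prod_XsubC.
- move=> z zz; apply/eqP => z0; have := rz (complex.Re z) z zz.
  by case: z z0 {zz} => a b /= ->; rewrite eqxx.
- move=> r.
  have E : (q^`().[r])%:C / (q.[r] +i* D) = \sum_(z <- zs) (r%:C - z)^-1.
    have : P^`().[r%:C] = P.[r%:C] * \sum_(z <- zs) (r%:C - z)^-1.
      rewrite {1 2}hP derivZ !hornerZ horner_deriv_prod_XsubC ?mulrA//.
      by move=> z; exact: rz.
    rewrite PE {1}/P derivD derivC addr0 /q' deriv_map horner_map/= => ->.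
    by rewrite mulrAC divff ?mul1r// -PE.
  have den0 : q.[r] ^+ 2 + D ^+ 2 != 0.
    by rewrite gt_eqF// ltr_wpDl ?sqr_ge0// exprn_gt0.
  have -> : D * `|q^`().[r]| / (q.[r] ^+ 2 + D ^+ 2) =
      `|complex.Im ((q^`().[r])%:C / (q.[r] +i* D))|.
    rewrite Im_div_real mulNr normrN 2!normrM normfV [D * _]mulrC (gtr0_norm D0).
    by rewrite (ger0_norm (addr_ge0 (sqr_ge0 _) (sqr_ge0 _))).
  rewrite E Im_sum; apply: (le_trans (ler_norm_sum _ _ _)).
  rewrite !big_seq; apply: ler_sum => z zz.
  case: z zz => a b zz; rewrite -[X in complex.Im X]mul1r.
  have -> : r%:C - (a +i* b) = (r - a) +i* (- b).
    by apply/eqP; rewrite eq_complex/= sub0r !eqxx.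
  rewrite -[1]/(1%:C) Im_div_real/= mul1r opprK sqrrN normrM normfV.
  by rewrite (ger0_norm (addr_ge0 (sqr_ge0 _) (sqr_ge0 _))).
Qed.

(* D q' / (q^2 + D^2) is minus the imaginary part of the logarithmic derivative of
   q + i D, hence bounded by a sum of Poisson kernels, one for each root. *)
Lemma arctan_total_variation (q : {poly R}) (D a b : R) : 0 < D -> a < b ->
  (\int[mu]_(r in `[a, b]) (D * `|q^`().[r]| / (q.[r] ^+ 2 + D ^+ 2))%:E
     <= ((pi : R) * (size q).-1%:R)%:E)%E.
Proof.
move=> D0 ab; have [zs [szs zs0 hzs]] := deriv_quotient_bound q D0.
pose G (z : R[i]) (r : R) := `|complex.Im z| / ((r - complex.Re z) ^+ 2 + complex.Im z ^+ 2).
have mI : measurable `[a, b] by exact: measurable_itv.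
have den r : q.[r] ^+ 2 + D ^+ 2 != 0.
  by rewrite gt_eqF// ltr_wpDl ?sqr_ge0// exprn_gt0.
have cp (p : {poly R}) (r : R) : {for r, continuous (horner p)}.
  exact: continuous_horner.
have G0 z r : 0 <= G z r by rewrite /G divr_ge0// addr_ge0 ?sqr_ge0.
have mG z : measurable_fun `[a, b] (EFin \o G z).
  apply/measurable_EFinP; apply: measurable_funTS; apply: measurable_funM => //.
  rewrite (_ : (fun r => _) = (fun r : R => ((r - complex.Re z) ^+ 2 + complex.Im z ^+ 2) `^ (-1))).
    apply: (measurableT_comp (measurable_powR _)).
    apply: measurable_funD => //; apply: measurable_funX.
    by apply: measurable_funB.
  by apply/funext => r; rewrite powR_inv1// addr_ge0 ?sqr_ge0.
have mq : measurable_fun `[a, b] (fun r => (D * `|q^`().[r]| / (q.[r] ^+ 2 + D ^+ 2))%:E).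
  apply/measurable_EFinP; apply: continuous_itv_measurable => r _.
  apply: cvgM.
    by apply: cvgM; [exact: cvg_cst|apply: cvg_norm; exact: cp].
  by apply: cvgV => //; apply: cvgD; [apply: cvgM; exact: cp|exact: cvg_cst].
apply: (@le_trans _ _ (\int[mu]_(r in `[a, b]) (\sum_(z <- zs) (G z r)%:E))%E).
  apply: ge0_le_integral => //.
  - move=> r _; rewrite lee_fin divr_ge0 ?mulr_ge0 ?(ltW D0)//.
    by rewrite addr_ge0 ?sqr_ge0.
  - by apply: emeasurable_sum => z; exact: mG.
  - by move=> r _; rewrite sumEFin lee_fin; exact: hzs.
rewrite ge0_integral_sum; [|exact: mI|exact: mG|by move=> z r _; rewrite lee_fin].
apply: (@le_trans _ _ (\sum_(z <- zs) (pi : R)%:E)%E).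
  rewrite !big_seq; apply: lee_sum => z zz.
  by apply: poisson_kernel_integral => //; exact: zs0.
rewrite sumEFin lee_fin big_const_seq count_predT iter_addr_0 -[leLHS]mulr_natr.
by rewrite ler_wpM2l ?pi_ge0// ler_nat.
Qed.

End total_variation.

(** * Integration by parts against the phase *)

Section oscillation.
Variable R : realType.
Local Notation mu := (@lebesgue_measure R).
Implicit Types p q : {poly R}.

(** For q = X p', the first summand is the main part of cos p / r and the second is the term in q'
    left over by the integration by parts, which is thus carried out as the fundamental theorem of
    calculus for this product. *)
Lemma is_derive_sin_poly_quotient p q (D r : R) : 0 < D ->
  is_derive r (1 : R) (fun x : R => sin p.[x] * (q.[x] / (q.[x] ^+ 2 + D ^+ 2)))
    (cos p.[r] * p^`().[r] * (q.[r] / (q.[r] ^+ 2 + D ^+ 2)) +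
     sin p.[r] * (q^`().[r] * (D ^+ 2 - q.[r] ^+ 2) / (q.[r] ^+ 2 + D ^+ 2) ^+ 2)).
Proof.
move=> D0.
have den0 : q.[r] ^+ 2 + D ^+ 2 != 0.
  by rewrite gt_eqF// ltr_wpDl ?sqr_ge0// exprn_gt0.
have hs : is_derive r (1 : R) (fun x : R => sin p.[x]) (cos p.[r] * p^`().[r]).
  exact: is_derive1_comp (is_derive_sin _) (is_derive_poly _ _).
have hq := is_derive_poly q r.
have hd : is_derive r (1 : R) (fun x : R => q.[x] ^+ 2 + D ^+ 2) (2 * q.[r] * q^`().[r]).
  apply: is_derive_eq; rewrite /GRing.scale/= ?mulr0 addr0 ?expr1//.
  by rewrite -mulr2n mulr_natl -mulrnAl.
have hv := @is_deriveV _ (fun x : R => q.[x] ^+ 2 + D ^+ 2) r _ _ den0 hd.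
have hm := is_deriveM hq hv.
have hm2 := is_deriveM hs hm.
apply: is_derive_eq hm2 _.
rewrite /GRing.scale/=.
change ((horner q * (fun y : R => (q.[y] ^+ 2 + D ^+ 2)^-1)) r)
  with (q.[r] * (q.[r] ^+ 2 + D ^+ 2)^-1).
by field.
Qed.

(* With q = X p', split 1 = q^2 / (q^2 + D^2) + D^2 / (q^2 + D^2): the first part of
   cos p / r equals (cos p) p' q / (q^2 + D^2), which is integrated by parts. *)
Lemma oscillatory_by_parts p (D : R) (d : nat) (a b : R) : 0 < D -> 0 < a -> a < b ->
  (size p <= d.+1)%N ->
  (`|\int[mu]_(r in `[a, b]) (cos p.[r] / r)|%:E <=
   ((1 + (pi : R) * d%:R) / D)%:E +
   \int[mu]_(r in `[a, b]) (D ^+ 2 / (r * (('X * p^`()).[r] ^+ 2 + D ^+ 2)))%:E)%E.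
Proof.
move=> D0 a0 ab sp; set q := 'X * p^`().
have sq : (size q <= d.+1)%N.
  have [p'0|p'0] := eqVneq p^`() 0; first by rewrite /q p'0 mulr0 size_poly0.
  rewrite /q mulrC size_mulX// (leq_trans _ sp)// lt_size_deriv//.
  by apply: contra_neq p'0 => ->; rewrite deriv0.
have den r : q.[r] ^+ 2 + D ^+ 2 != 0.
  by rewrite gt_eqF// ltr_wpDl ?sqr_ge0// exprn_gt0.
have dpos r : 0 < q.[r] ^+ 2 + D ^+ 2.
  by rewrite ltr_wpDl ?sqr_ge0// exprn_gt0.
pose f1 (r : R) := cos p.[r] * p^`().[r] * (q.[r] / (q.[r] ^+ 2 + D ^+ 2)).
pose f2 (r : R) := sin p.[r] * (q^`().[r] * (D ^+ 2 - q.[r] ^+ 2) / (q.[r] ^+ 2 + D ^+ 2) ^+ 2).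
pose f3 (r : R) := cos p.[r] * (D ^+ 2 / (r * (q.[r] ^+ 2 + D ^+ 2))).
pose H (r : R) := sin p.[r] * (q.[r] / (q.[r] ^+ 2 + D ^+ 2)).
have cp (g : {poly R}) (r : R) : {for r, continuous (horner g)}.
  exact: continuous_horner.
have cden (r : R) : {for r, continuous (fun x : R => q.[x] ^+ 2 + D ^+ 2)}.
  by apply: cvgD; [apply: cvgM; exact: cp|exact: cvg_cst].
have cdenV (r : R) : {for r, continuous (fun x : R => (q.[x] ^+ 2 + D ^+ 2)^-1)}.
  by apply: cvgV => //; exact: cden.
have csin (r : R) : {for r, continuous (fun x : R => sin p.[x])}.
  by apply: (@continuous_comp _ _ _ (horner p) sin); [exact: cp|exact: continuous_sin].
have ccos (r : R) : {for r, continuous (fun x : R => cos p.[x])}.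
  by apply: (@continuous_comp _ _ _ (horner p) cos); [exact: cp|exact: continuous_cos].
have cf1 (r : R) : {for r, continuous f1}.
  by apply: cvgM; [apply: cvgM; [exact: ccos|exact: cp]|apply: cvgM; [exact: cp|exact: cdenV]].
have cf2 (r : R) : {for r, continuous f2}.
  apply: cvgM; first exact: csin.
  apply: cvgM; first apply: cvgM.
  - exact: cp.
  - by apply: cvgB; [exact: cvg_cst|apply: cvgM; exact: cp].
  - apply: cvgV; first by rewrite expf_neq0.
    by apply: cvgM; exact: cden.
have cf3 (r : R) : a <= r <= b -> {for r, continuous f3}.
  move=> /andP[ar _]; have r0 : r != 0 by rewrite gt_eqF// (lt_le_trans a0).
  apply: cvgM; first exact: ccos.
  apply: cvgM; first exact: cvg_cst.
  apply: cvgV; first by rewrite mulf_neq0.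
  by apply: cvgM; [exact: cvg_id|exact: cden].
have I12 := Rintegral_FTC2 ab (fun r _ => is_derive_sin_poly_quotient p q r D0)
  (fun r _ => cvgD (cf1 r) (cf2 r)).
have {}I12 := I12 (fun r => nbhs_filter r).
have i1 := continuous_itv_integrable (fun r (_ : a <= r <= b) => cf1 r).
have i2 := continuous_itv_integrable (fun r (_ : a <= r <= b) => cf2 r).
have i3 := continuous_itv_integrable cf3.
have -> : \int[mu]_(r in `[a, b]) (cos p.[r] / r) =
   \int[mu]_(r in `[a, b]) (f1 r + f3 r).
  apply: eq_Rintegral => r; rewrite inE/= in_itv/= => /andP[ar _].
  have r0 : r != 0 by rewrite gt_eqF// (lt_le_trans a0).
  have qE : q.[r] = r * p^`().[r] by rewrite hornerM hornerX.
  rewrite /f1 /f3; have := den r; rewrite qE => d0.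
  by field; rewrite r0 d0.
rewrite RintegralD//.
(* By 2 |q| D <= q^2 + D^2; the two boundary values together give the 1 / D of the statement. *)
have H1 r : `|H r| <= (2 * D)^-1.
  rewrite /H normrM -[leRHS]mul1r ler_pM//.
    by rewrite ler_norml sin_geN1 sin_le1.
  rewrite normrM normfV (gtr0_norm (dpos r)) ler_pdivrMr// mulrC ler_pdivlMr ?mulr_gt0//.
  rewrite -[q.[r] ^+ 2]real_normK ?num_real//.
  have := sqr_ge0 (`|q.[r]| - D); move: `|q.[r]| => y; nra.
(* Since |D^2 - q^2| <= D^2 + q^2, |f2| is at most 1 / D times the integrand of
   [arctan_total_variation]. *)
have F2 : (`|\int[mu]_(r in `[a, b]) f2 r|%:E <= ((pi : R) * d%:R / D)%:E)%E.
  apply: (@le_trans _ _ (\int[mu]_(r in `[a, b]) `|f2 r|)%R%:E).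
    by rewrite lee_fin le_normr_Rintegral.
  rewrite EFin_Rintegral_ge0; last by move=> r _; apply: cvg_norm; exact: cf2.
  apply: (@le_trans _ _ (\int[mu]_(r in `[a, b])
      (D^-1%:E * (D * `|q^`().[r]| / (q.[r] ^+ 2 + D ^+ 2))%:E))%E).
    apply: ge0_le_integral.
    - exact: measurable_itv.
    - by move=> r _; rewrite lee_fin.
    - apply/measurable_EFinP; apply: continuous_itv_measurable => r _.
      by apply: cvg_norm; exact: cf2.
    - apply/measurable_EFinP; apply: continuous_itv_measurable => r _.
      apply: cvgM; first exact: cvg_cst.
      apply: cvgM; last exact: cdenV.
      by apply: cvgM; [exact: cvg_cst|apply: cvg_norm; exact: cp].
    - move=> r _; rewrite -EFinM lee_fin /f2 normrM -[leRHS]mul1r ler_pM//.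
        by rewrite ler_norml sin_geN1 sin_le1.
      rewrite 2!normrM normfV normrX (gtr0_norm (dpos r)).
      have -> : D^-1 * (D * `|q^`().[r]| / (q.[r] ^+ 2 + D ^+ 2)) =
         `|q^`().[r]| * (q.[r] ^+ 2 + D ^+ 2) / (q.[r] ^+ 2 + D ^+ 2) ^+ 2.
        by field; rewrite den gt_eqF.
      rewrite ler_pM2r ?invr_gt0 ?exprn_gt0// ler_wpM2l//.
      by rewrite ler_norml; apply/andP; split; have := sqr_ge0 q.[r]; have := sqr_ge0 D; lra.
  rewrite ge0_integralZl; last 4 first.
  - exact: measurable_itv.
  - apply/measurable_EFinP; apply: continuous_itv_measurable => r _.
    apply: cvgM; last exact: cdenV.
    by apply: cvgM; [exact: cvg_cst|apply: cvg_norm; exact: cp].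
  - by move=> r _; rewrite lee_fin divr_ge0 ?mulr_ge0 ?(ltW D0)// ltW.
  - by rewrite lee_fin invr_ge0 ltW.
  apply: (@le_trans _ _ (D^-1%:E * ((pi : R) * (size q).-1%:R)%:E)%E).
    by apply: lee_wpmul2l; [rewrite lee_fin invr_ge0 ltW|exact: arctan_total_variation].
  rewrite -EFinM lee_fin mulrC ler_pM2r ?invr_gt0// ler_wpM2l ?pi_ge0// ler_nat.
  by rewrite -ltnS (leq_ltn_trans _ (leqnn _))// -subn1 leq_subLR.
have F3 : (`|\int[mu]_(r in `[a, b]) f3 r|%:E <=
    \int[mu]_(r in `[a, b]) (D ^+ 2 / (r * (q.[r] ^+ 2 + D ^+ 2)))%:E)%E.
  apply: (@le_trans _ _ (\int[mu]_(r in `[a, b]) `|f3 r|)%R%:E).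
    by rewrite lee_fin le_normr_Rintegral.
  rewrite EFin_Rintegral_ge0; last by move=> r h; apply: cvg_norm; exact: cf3.
  apply: ge0_le_integral.
  - exact: measurable_itv.
  - by move=> r _; rewrite lee_fin.
  - apply/measurable_EFinP; apply: continuous_itv_measurable => r h.
    by apply: cvg_norm; exact: cf3.
  - apply/measurable_EFinP; apply: continuous_itv_measurable => r /andP[ar _].
    have r0 : r != 0 by rewrite gt_eqF// (lt_le_trans a0).
    apply: cvgM; first exact: cvg_cst.
    apply: cvgV; first by rewrite mulf_neq0.
    by apply: cvgM; [exact: cvg_id|exact: cden].
  - move=> r; rewrite /= in_itv/= => /andP[ar _].
    have r0 : 0 < r by rewrite (lt_le_trans a0).
    rewrite lee_fin /f3 normrM -[leRHS]mul1r ler_pM//.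
      by rewrite ler_norml cos_geN1 cos_le1.
    by rewrite ger0_norm// divr_ge0 ?sqr_ge0// mulr_ge0// ltW.
move: I12; rewrite -/(f1 _) RintegralD// => I12.
have {I12} -> : \int[mu]_(x in `[a, b]) f1 x = H b - H a - \int[mu]_(x in `[a, b]) f2 x.
  by rewrite /H -I12 addrK.
have T : `|H b - H a - \int[mu]_(x in `[a, b]) f2 x + \int[mu]_(x in `[a, b]) f3 x| <=
    (1 + pi * d%:R) / D + `|\int[mu]_(r in `[a, b]) f3 r|.
  apply: (le_trans (ler_normD _ _)); rewrite lerD2r.
  rewrite mulrDl mul1r; apply: (le_trans (ler_normB _ _)).
  apply: lerD; last by rewrite -lee_fin.
  apply: (le_trans (ler_normB _ _)); apply: (le_trans (lerD (H1 b) (H1 a))).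
  by rewrite le_eqVlt; apply/orP; left; apply/eqP; field; rewrite gt_eqF.
apply: (@le_trans _ _ ((1 + pi * d%:R) / D + `|\int[mu]_(r in `[a, b]) f3 r|)%:E).
  by rewrite lee_fin.
by rewrite EFinD leeD2l.
Qed.

End oscillation.

(** * Polar coordinates *)

Section dilation.
Variable R : realType.
Local Notation mu := (@lebesgue_measure R).
Local Notation RR := (measurableTypeR R).

Lemma integral_mkindic d (T : measurableType d) (m : {measure set T -> \bar R})
    (D : set T) (f : T -> \bar R) :
  (\int[m]_(x in D) f x = \int[m]_x (f x * (\1_D x)%:E))%E.
Proof.
rewrite integral_mkcond; apply: eq_integral => x _; rewrite /patch indicE.
by case: ifP => _; rewrite ?mule1 ?mule0.
Qed.

Lemma measurable_scale (c : R) :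
  measurable_fun setT (fun x : RR => (c * x : RR)).
Proof. by apply: measurable_funM. Qed.

Lemma lebesgue_measure_scale (c : R) (A : set RR) : 0 < c -> measurable A ->
  mu A = (c%:E * mu ((fun x : RR => c * x : RR)%R @^-1` A))%E.
Proof.
move=> c0 mA; pose cn := NngNum (ltW c0).
pose sc := (fun x : RR => c * x : RR).
apply: (@lebesgue_measure_unique R (mscale cn (pushforward mu sc))) => //.
  exact: measurable_scale.
move=> msc X /ocitvP[->|[[a b] /= ab ->]]; first by rewrite !measure0.
rewrite /mscale/= /pushforward.
have -> : sc @^-1` `]a, b]%classic = `]a / c, b / c]%classic.
  apply/seteqP; split => x; rewrite /sc /= !in_itv/= ltr_pdivrMr// ler_pdivlMr// mulrC//.
rewrite !lebesgue_measure_itv/= !lte_fin ab ltr_pM2r ?invr_gt0// ab -!EFinD -EFinM.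
by congr EFin; field; rewrite gt_eqF.
Qed.

Lemma ge0_integral_scale1 (c : R) (f : RR -> \bar R) : 0 < c ->
  measurable_fun setT f -> (forall x, 0 <= f x)%E ->
  (\int[mu]_x f x = c%:E * \int[mu]_x f (c * x)%R)%E.
Proof.
move=> c0 mf f0; pose cn := NngNum (ltW c0).
pose sc := (fun x : RR => c * x : RR).
have msc : measurable_fun setT sc := measurable_scale c.
rewrite (eq_measure_integral (mscale cn (pushforward mu sc))); last first.
  by move=> A mA _; exact: lebesgue_measure_scale.
rewrite ge0_integral_mscale//; congr (_ * _)%E.
by rewrite ge0_integral_pushforward.
Qed.

Lemma ge0_integral_Rn_succ n (f : Rn R n.+1 -> \bar R) :
  measurable_fun setT f -> (forall x, 0 <= f x)%E ->
  (\int[lebesgue_Rn R n.+1]_x f x =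
   \int[mu]_a \int[lebesgue_Rn R n]_x f (consRn (a, x)))%E.
Proof.
move=> mf f0; have mc := @measurable_consRn R n.
rewrite (eq_measure_integral (pushforward (mu \x lebesgue_Rn R n)%E (@consRn R n))); last first.
  by [].
rewrite ge0_integral_pushforward//= fubini_tonelli1//.
exact: measurableT_comp.
Qed.

Definition scaleRn n (c : R) (x : Rn R n) : Rn R n := map_tuple (fun t : RR => c * t : RR) x.

Lemma tnth_scaleRn n (c : R) (x : Rn R n) i : tnth (scaleRn c x) i = c * tnth x i.
Proof. exact: tnth_map. Qed.

Lemma scaleRn_cons n (c : R) (a : RR) (x : Rn R n) :
  scaleRn c (consRn (a, x)) = consRn (c * a, scaleRn c x).
Proof. exact/val_inj. Qed.

Lemma measurable_scaleRn2 n :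
  measurable_fun setT (fun z : Rn R n * RR => scaleRn z.2 z.1).
Proof.
apply/measurable_fun_tnthP => i.
rewrite (_ : _ \o _ = fun z : Rn R n * RR => z.2 * tnth z.1 i); last first.
  by apply/funext => z /=; rewrite tnth_scaleRn.
apply: measurable_funM; first exact: measurable_snd.
exact: (measurableT_comp (measurable_tnth i) measurable_fst).
Qed.

Lemma measurable_scaleRn n (c : R) : measurable_fun setT (@scaleRn n c).
Proof.
apply/measurable_fun_tnthP => i.
rewrite (_ : _ \o _ = fun z : Rn R n => c * tnth z i); last first.
  by apply/funext => z /=; rewrite tnth_scaleRn.
by apply: measurable_funM => //; exact: measurable_tnth.
Qed.

Lemma ge0_integral_scaleRn n (c : R) (f : Rn R n -> \bar R) : 0 < c ->
  measurable_fun setT f -> (forall x, 0 <= f x)%E ->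
  (\int[lebesgue_Rn R n]_x f x =
   (c ^+ n)%:E * \int[lebesgue_Rn R n]_x f (scaleRn c x))%E.
Proof.
move=> c0; elim: n f => [|n ih] f mf f0.
  rewrite expr0 mul1e; apply: eq_integral => x _; congr f; apply: val_inj.
  by rewrite [x]tuple0.
have mfs : measurable_fun setT (f \o scaleRn c).
  by apply: measurableT_comp => //; exact: measurable_scaleRn.
rewrite [LHS]ge0_integral_Rn_succ// [in RHS]ge0_integral_Rn_succ//.
have mF (g : Rn R n.+1 -> \bar R) : measurable_fun setT g ->
    measurable_fun setT (g \o @consRn R n).
  by move=> mg; apply: measurableT_comp => //; exact: measurable_consRn.
have mG (g : Rn R n.+1 -> \bar R) : measurable_fun setT g -> (forall x, 0 <= g x)%E ->
    measurable_fun setT (fun a : RR => \int[lebesgue_Rn R n]_x g (consRn (a, x)))%E.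
  move=> mg g0.
  exact: (@measurable_fun_fubini_tonelli_F _ _ _ _ _ (lebesgue_Rn R n) _ (mF _ mg) (fun z => g0 _)).
rewrite (ge0_integral_scale1 c0); last 2 first.
- exact: mG.
- by move=> a; apply: integral_ge0.
rewrite exprS EFinM -muleA; congr (_ * _)%E.
rewrite -ge0_integralZl//; last 3 first.
- exact: (mG _ mfs (fun x => f0 _)).
- by move=> a _; apply: integral_ge0.
- by rewrite lee_fin exprn_ge0// ltW.
apply: eq_integral => a _; rewrite ih//; last exact: measurable_fun_pair2 (mF _ mf).
by congr (_ * _)%E; apply: eq_integral => x _; rewrite scaleRn_cons.
Qed.

End dilation.

Section polar_coordinates.
Variables (R : realType) (n : nat).
Local Notation mu := (@lebesgue_measure R).
Local Notation RR := (measurableTypeR R).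
Local Notation leb := (lebesgue_Rn R n).
Local Notation sigma := (@sphere_measure R n).
Implicit Types x : Rn R n.

Lemma enorm_ge0 x : 0 <= enorm x.
Proof. exact: sqrtr_ge0. Qed.

Lemma enorm_scaleRn (c : R) x : 0 <= c -> enorm (scaleRn c x) = c * enorm x.
Proof.
move=> c0; rewrite /enorm.
rewrite (eq_bigr (fun i => c ^+ 2 * tnth x i ^+ 2)); last first.
  by move=> i _; rewrite tnth_scaleRn exprMn.
by rewrite -mulr_sumr sqrtrM ?sqr_ge0// sqrtr_sqr ger0_norm.
Qed.

Lemma normalizeE x : normalize x = scaleRn (enorm x)^-1 x.
Proof. by apply: eq_from_tnth => i; rewrite tnth_mktuple tnth_scaleRn mulrC. Qed.

Lemma scaleRn_comp (c e : R) x : scaleRn c (scaleRn e x) = scaleRn (c * e) x.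
Proof. by apply: eq_from_tnth => i; rewrite !tnth_scaleRn mulrA. Qed.

Lemma scaleRn1 x : scaleRn 1 x = x.
Proof. by apply: eq_from_tnth => i; rewrite !tnth_scaleRn mul1r. Qed.

Lemma normalize_sphere x : 0 < enorm x -> sphere (normalize x).
Proof.
by move=> x0; rewrite /sphere/= normalizeE enorm_scaleRn ?invr_ge0 ?ltW// mulVf// gt_eqF.
Qed.

Lemma normalize_scaleRn (c : R) x : 0 < c -> sphere x -> normalize (scaleRn c x) = x.
Proof.
move=> c0 x1; rewrite normalizeE enorm_scaleRn ?ltW// x1 mulr1 scaleRn_comp mulVf ?gt_eqF//.
exact: scaleRn1.
Qed.

Definition cone1 : set (Rn R n) := [set x | 0 < enorm x <= 1].

Lemma measurable_cone1 : measurable cone1.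
Proof.
rewrite (_ : cone1 = @enorm R n @^-1` `]0, 1]%classic).
  by rewrite -[X in measurable X]setTI; exact: measurable_enorm.
by apply/seteqP; split => x /=; rewrite in_itv.
Qed.

(** By its definition through cones, the surface measure is n times the image under [normalize] of
    Lebesgue measure on the punctured unit ball, so this is a change of variables. *)
Lemma ge0_integral_sphere (g : Rn R n -> \bar R) :
  measurable_fun setT g -> (forall x, 0 <= g x)%E ->
  (\int[sigma]_(x in @sphere R n) g x =
   n%:R%:E * \int[leb]_(x in cone1) g (normalize x))%E.
Proof.
move=> mg g0; have mC := measurable_cone1; have mN := @measurable_normalize R n.
pose nn := NngNum (ler0n R n).
rewrite (eq_measure_integral (mscale nn (pushforward (mrestr leb mC) (@normalize R n)))); last first.
  by move=> A mA _; rewrite /= /sphere_measure /mscale/= /pushforward /mrestr setIC.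
rewrite ge0_integral_mscale//; last 2 first.
- exact: measurable_sphere.
- exact: measurable_funTS.
congr (_ * _)%E.
rewrite ge0_integral_pushforward//; last 2 first.
- exact: measurable_sphere.
- exact: measurable_funTS.
have mS : measurable (@normalize R n @^-1` @sphere R n).
  rewrite -[X in measurable X]setTI; apply: mN => //; exact: measurable_sphere.
have cS : cone1 `<=` @normalize R n @^-1` @sphere R n.
  by move=> x /andP[x0 _]; exact: normalize_sphere.
rewrite (ge0_negligible_integral (N := (@normalize R n @^-1` @sphere R n) `\` cone1)); last first.
- rewrite /= /mrestr setDE -setIA [X in _ `&` X]setIC setICr setI0; exact: measure0.
- by move=> x _ /=.
- by apply: measurable_funTS; exact: measurableT_comp.
- exact: mS.
- exact: measurableD.
rewrite setDD (setIidr cS).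
apply: eq_measure_integral => A mA AC; rewrite /= /mrestr; congr (leb _).
exact: setIidl.
Qed.

Let posR : set RR := `]0, +oo[%classic.

(** 1 / r cut off to r > 0, so that radial integrals live on the whole line and Tonelli applies to a
    full product space. *)
Definition rker (r : RR) : R := r `^ (-1) * \1_posR r.

Lemma rkerE (r : R) : 0 < r -> rker r = r^-1.
Proof.
move=> r0; have h : posR r by rewrite /posR/= in_itv/= r0.
by rewrite /rker indicE mem_set// mulr1 powR_inv1// ltW.
Qed.

Lemma rker0 (r : R) : r <= 0 -> rker r = 0.
Proof.
move=> r0; have h : ~ posR r by rewrite /posR/= in_itv/= andbT; apply/negP; rewrite -leNgt.
by rewrite /rker indicE memNset// mulr0.
Qed.

Lemma rker_ge0 r : 0 <= rker r.
Proof. by rewrite /rker mulr_ge0 ?powR_ge0. Qed.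

Lemma measurable_rker : measurable_fun setT rker.
Proof.
apply: measurable_funM; first exact: measurable_powR.
by apply: measurable_indic; exact: measurable_itv.
Qed.

Lemma measurable_polar_fun (H : Rn R n -> \bar R) : measurable_fun setT H ->
  measurable_fun setT (fun z : Rn R n * RR => H (scaleRn z.2 z.1) * (rker z.2)%:E)%E.
Proof.
move=> mH; apply: emeasurable_funM.
  by apply: (measurableT_comp mH); exact: measurable_scaleRn2.
apply/measurable_EFinP; apply: (measurableT_comp measurable_rker).
exact: measurable_snd.
Qed.

Definition polar_inner (H : Rn R n -> \bar R) (x : Rn R n) : \bar R :=
  (\int[mu]_r (H (scaleRn r x) * (rker r)%:E))%E.

Lemma polar_innerE (H : Rn R n -> \bar R) x :
  (polar_inner H x = \int[mu]_(r in posR) (H (scaleRn r x) * (r^-1)%:E))%E.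
Proof.
rewrite /polar_inner [RHS]integral_mkindic; apply: eq_integral => r _; rewrite indicE.
case: (boolP (r \in posR)) => rp.
  by rewrite mule1 rkerE//; move: rp; rewrite inE /posR/= in_itv/= andbT.
rewrite mule0 rker0 ?mule0//; move: rp; rewrite notin_setE /posR/= in_itv/= andbT.
by move/negP; rewrite -leNgt.
Qed.

Lemma measurable_polar_inner (H : Rn R n -> \bar R) : measurable_fun setT H ->
  (forall x, 0 <= H x)%E -> measurable_fun setT (polar_inner H).
Proof.
move=> mH H0.
apply: (@measurable_fun_fubini_tonelli_F _ _ _ _ _ mu _ (measurable_polar_fun mH)).
by move=> z; rewrite mule_ge0// lee_fin rker_ge0.
Qed.

(** The measure dr / r is invariant under dilations, so an integral along a ray depends on its
    direction only. *)
Lemma polar_inner_normalize (H : Rn R n -> \bar R) x : measurable_fun setT H ->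
  (forall x, 0 <= H x)%E -> 0 < enorm x -> polar_inner H (normalize x) = polar_inner H x.
Proof.
move=> mH H0 x0; rewrite /polar_inner (ge0_integral_scale1 x0); last 2 first.
- exact: measurable_fun_pair2 (measurable_polar_fun mH).
- by move=> r; rewrite mule_ge0// lee_fin rker_ge0.
rewrite -ge0_integralZl; last 4 first.
- exact: measurableT.
- have := measurable_fun_pair2 (normalize x) (measurable_polar_fun mH).
  by move=> /measurableT_comp; apply; exact: measurable_scale.
- by move=> r _; rewrite mule_ge0// lee_fin rker_ge0.
- by rewrite lee_fin ltW.
apply: eq_integral => r _; rewrite muleCA; congr (_ * _)%E.
  by rewrite normalizeE scaleRn_comp mulrAC divff ?gt_eqF// mul1r.
rewrite -EFinM; congr EFin; have [r0|r0] := ltP 0 r.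
  by rewrite !rkerE ?mulr_gt0// invfM mulrA divff ?mul1r// gt_eqF.
by rewrite !rker0 ?mulr0// pmulr_rle0.
Qed.

(** Serves to recover the factor |y|^-n at the end of [ge0_polar]. *)
Lemma integral_tail_power (y : R) : (0 < n)%N -> 0 < y ->
  (\int[mu]_(r in `[y, +oo[) (n%:R * r ^- n.+1)%:E = (y ^- n)%:E)%E.
Proof.
move=> n0 y0.
have rpos r : y <= r -> 0 < r by exact: lt_le_trans.
have dF r : y <= r -> is_derive r (1 : R) (fun r : R => - r ^- n) (n%:R * r ^- n.+1).
  move=> /rpos r0; have rn0 : r ^+ n != 0 by rewrite expf_neq0// gt_eqF.
  have hX : is_derive r (1 : R) (fun r : R => r ^+ n) (n%:R * r ^+ n.-1).
    rewrite (_ : (fun r : R => _) = horner 'X^n); last by apply/funext => t; rewrite hornerXn.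
    by apply: is_derive_eq (is_derive_poly _ _) _; rewrite derivXn hornerMn hornerXn mulr_natl.
  have hV := is_deriveN (@is_deriveV _ (fun r : R => r ^+ n) r _ (1 : R) rn0 hX).
  apply: is_derive_eq hV _; rewrite /GRing.scale/= mulNr opprK.
  rewrite mulrC -mulrA; congr (_ * _).
  case: (n) n0 rn0 => // m _ rm0 /=.
  rewrite [r ^+ m.+2]exprS [r ^+ m.+1]exprS; field.
  by rewrite expf_neq0 gt_eqF.
rewrite (@ge0_continuous_FTC2y _ _ (fun r : R => - r ^- n) _ 0).
- by rewrite -EFinB sub0r opprK.
- by move=> r /rpos r0; rewrite mulr_ge0// invr_ge0 exprn_ge0// ltW.
- apply: continuous_in_subspaceT => r; rewrite inE/= in_itv/= andbT => /rpos r0.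
  apply: cvgM; first exact: cvg_cst.
  by apply: cvgV; [rewrite expf_neq0// gt_eqF|exact: exprn_continuous].
- rewrite -oppr0; apply: cvgN.
  apply/(@gtr0_cvgV0 _ _ _ _ (fun r : R => r ^+ n)).
    by near=> r; apply: exprn_gt0; near: r; exact: nbhs_pinfty_gt.
  apply/cvgryPge => A; near=> r.
  have r1 : 1 <= r by near: r; apply: nbhs_pinfty_ge; rewrite num_real.
  have rA : A <= r by near: r; apply: nbhs_pinfty_ge; rewrite num_real.
  apply: (le_trans rA); case: (n) n0 => // m _.
  by rewrite exprS ler_peMr ?(le_trans ler01)// exprn_ege1.
- by move=> r yr; have [] := dF _ (ltW yr).
- by apply: cvg_at_right_filter; exact: is_derive_continuous_at (dF _ (lexx y)).
- move=> r; rewrite in_itv/= andbT => yr.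
  by rewrite derive1E; have [_ ->] := dF _ (ltW yr).
Unshelve. all: by end_near.
Qed.

(** By [ge0_integral_sphere] and dilation invariance, the right-hand side is n times the integral
    over x in the punctured unit ball of the integral of H(r x) dr / r. For fixed r the substitution
    y = r x turns |x| <= 1 into |y| <= r and produces r^-n; integrating n r^(-n-1) over r >= |y|
    leaves |y|^-n. *)
Lemma ge0_polar (H : Rn R n -> \bar R) : (0 < n)%N -> measurable_fun setT H ->
  (forall x, 0 <= H x)%E ->
  (\int[leb]_(x in [set x | (0 < enorm x)%R]) (H x * (enorm x ^- n)%:E) =
   \int[sigma]_(x in @sphere R n) \int[mu]_(r in `]0%R, +oo[)
     (H (scaleRn r x) * (r^-1)%:E))%E.
Proof.
move=> n0 mH H0; have mG := measurable_polar_inner mH H0.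
have G0 x : (0 <= polar_inner H x)%E.
  by apply: integral_ge0 => r _; rewrite mule_ge0// lee_fin rker_ge0.
under [RHS]eq_integral do rewrite -polar_innerE.
rewrite ge0_integral_sphere//.
rewrite [X in (_ * X)%E](eq_integral (polar_inner H)); last first.
  by move=> x; rewrite inE => /andP[x0 _]; exact: polar_inner_normalize.
rewrite [in RHS]integral_mkindic.
pose posn : set (Rn R n) := [set x | 0 < enorm x].
have mposn : measurable posn.
  rewrite (_ : posn = @enorm R n @^-1` `]0, +oo[%classic).
    by rewrite -[X in measurable X]setTI; exact: measurable_enorm.
  by apply/seteqP; split => x /=; rewrite in_itv/= andbT.
pose A : set (Rn R n * RR) := [set z | 0 < enorm z.1 <= z.2].
have mA : measurable A.
  have -> : A = (fst @^-1` posn) `&`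
      ((fun z : Rn R n * RR => z.2 - enorm z.1) @^-1` `[0, +oo[%classic).
    apply/seteqP; split => z /=; rewrite /A/= in_itv/= andbT subr_ge0.
      by move=> /andP[].
    by move=> [-> ->].
  apply: measurableI.
    by rewrite -[X in measurable X]setTI; exact: measurable_fst.
  rewrite -[X in measurable X]setTI.
  suff : measurable_fun setT (fun z : Rn R n * RR => z.2 - enorm z.1).
    by apply => //; exact: measurable_itv.
  apply: measurable_funB; first exact: measurable_snd.
  exact: (measurableT_comp (@measurable_enorm R n) measurable_fst).
(* The kernel that remains after y = r x: r^(-n-1) on 0 < |y| <= r. *)
pose K (y : Rn R n) (r : RR) : R := rker r * r `^ (- n%:R) * \1_A (y, r).
have K0 y r : 0 <= K y r by rewrite /K mulr_ge0// mulr_ge0 ?powR_ge0 ?rker_ge0.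
have mK : measurable_fun setT (fun z : Rn R n * RR => K z.1 z.2).
  apply: measurable_funM; last first.
    rewrite (_ : (fun z => _) = \1_A); first exact: measurable_indic.
    by apply/funext => -[].
  apply: measurable_funM.
    exact: (measurableT_comp measurable_rker measurable_snd).
  exact: (measurableT_comp (measurable_powR _) measurable_snd).
have mKE : measurable_fun setT (fun z : Rn R n * RR => (K z.1 z.2)%:E).
  exact/measurable_EFinP.
have mH1 : measurable_fun setT (H \o fst : Rn R n * RR -> \bar R).
  by apply: measurableT_comp => //; exact: measurable_fst.
have mHK r : measurable_fun setT (fun y : Rn R n => H y * (K y r)%:E)%E.
  by apply: emeasurable_funM => //; exact: (measurable_fun_pair1 r mKE).
have mHK2 : measurable_fun setT (fun z : Rn R n * RR => H z.1 * (K z.1 z.2)%:E)%E.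
  by apply: emeasurable_funM; [exact: mH1|exact: mKE].
have HK0 (z : Rn R n * RR) : (0 <= H z.1 * (K z.1 z.2)%:E)%E.
  by rewrite mule_ge0// lee_fin.
transitivity (n%:R%:E * \int[leb]_y \int[mu]_r (H y * (K y r)%:E))%E; last first.
  congr (_ * _)%E.
  rewrite (fubini_tonelli (m1 := leb) (m2 := mu)
    (fun z : Rn R n * RR => H z.1 * (K z.1 z.2)%:E)%E); last 2 first.
  - exact: mHK2.
  - by move=> z; rewrite mule_ge0// lee_fin.
  transitivity (\int[leb]_x \int[mu]_r
      (H (scaleRn r x) * (rker r)%:E * (\1_cone1 x)%:E))%E; last first.
    apply: eq_integral => x _.
    rewrite -[in RHS]ge0_integralZr//; last 2 first.
    - exact: measurable_fun_pair2 (measurable_polar_fun mH).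
    - by move=> r _; rewrite mule_ge0// lee_fin rker_ge0.
  rewrite (fubini_tonelli (m1 := leb) (m2 := mu)
    (fun z : Rn R n * RR => H (scaleRn z.2 z.1) * (rker z.2)%:E * (\1_cone1 z.1)%:E)%E); last 2 first.
  - apply: emeasurable_funM; first exact: measurable_polar_fun.
    apply/measurable_EFinP; apply: (measurableT_comp _ measurable_fst).
    by apply: measurable_indic; exact: measurable_cone1.
  - by move=> z; rewrite mule_ge0// ?lee_fin// mule_ge0// lee_fin rker_ge0.
  apply: eq_integral => r _ /=.
  have [r0|r0] := ltP 0 r; last first.
    rewrite integral0_eq; last by move=> y _; rewrite /K rker0// !mul0r mule0.
    by rewrite integral0_eq// => x _; rewrite rker0// mule0 mul0e.
  rewrite (ge0_integral_scaleRn r0); last 2 first.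
  - apply: emeasurable_funM => //.
    exact: (measurable_fun_pair1 r mKE).
  - by move=> y; rewrite mule_ge0// lee_fin.
  rewrite -ge0_integralZl//; last 3 first.
  - exact: (measurableT_comp (mHK r) (measurable_scaleRn r)).
  - by move=> x _; rewrite mule_ge0// lee_fin.
  - by rewrite lee_fin exprn_ge0// ltW.
  apply: eq_integral => x _; rewrite muleCA -muleA; congr (_ * _)%E.
  rewrite -!EFinM; congr EFin.
  rewrite /K powRN powR_mulrn ?ltW//.
  have -> : \1_A (scaleRn r x, r) = \1_cone1 x :> R.
    have AE : A (scaleRn r x, r) = cone1 x.
      by rewrite /A /cone1/= (enorm_scaleRn _ (ltW r0)) pmulr_rgt0// ger_pMr.
    by rewrite !indicE; congr (nat_of_bool _)%:R; apply/idP/idP; rewrite !inE AE.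
  by rewrite mulrA mulrCA divff ?mulr1// expf_neq0// gt_eqF.
rewrite integral_mkindic -ge0_integralZl//; last 2 first.
- exact: (@measurable_fun_fubini_tonelli_F _ _ _ _ _ mu _ mHK2 HK0).
- by move=> y _; apply: integral_ge0 => r _; rewrite mule_ge0// lee_fin.
apply: eq_integral => y _.
rewrite ge0_integralZl//; last 2 first.
- exact: (measurable_fun_pair2 y mKE).
- by move=> r _; rewrite lee_fin.
rewrite muleCA -muleA; congr (_ * _)%E.
rewrite -ge0_integralZl//; last 2 first.
- exact: (measurable_fun_pair2 y mKE).
- by move=> r _; rewrite lee_fin.
rewrite indicE; case: (boolP (y \in _)) => y0; last first.
  rewrite mule0 integral0_eq// => r _; rewrite -EFinM /K indicE memNset ?mulr0//.
  by move: y0; rewrite notin_setE /A/= => /negP/negbTE ->.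
have {}y0 : 0 < enorm y by move: y0; rewrite inE.
rewrite mule1 -integral_tail_power// [LHS]integral_mkindic.
apply: eq_integral => r _; rewrite -!EFinM; congr EFin.
rewrite -[LHS]mulrA; congr (_ * _).
have [r0|r0] := ltP 0 r; last first.
  rewrite /K rker0// !mul0r indicE memNset ?mulr0//= in_itv/= andbT; apply/negP; rewrite -ltNge.
  exact: le_lt_trans y0.
rewrite /K rkerE// powRN powR_mulrn ?ltW// exprS invfM; congr (_ * _).
by rewrite !indicE; congr (nat_of_bool _)%:R; apply/idP/idP; rewrite !inE /A/= in_itv/= andbT y0.
Qed.

End polar_coordinates.

(** * Dyadic decomposition of the radial integral *)

Section dyadic.
Variable R : realType.
Local Notation mu := (@lebesgue_measure R).
Local Notation RR := (measurableTypeR R).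

Lemma ge0_integral_setU_le (A B C : set RR) (f : RR -> \bar R) :
  measurable A -> measurable B -> measurable C -> C `<=` A `|` B ->
  measurable_fun setT f -> (forall x, 0 <= f x)%E ->
  (\int[mu]_(x in C) f x <= \int[mu]_(x in A) f x + \int[mu]_(x in B) f x)%E.
Proof.
move=> mA mB mC CAB mf f0.
have mAB : measurable (A `|` B) by exact: measurableU.
have mBA : measurable (B `\` A) by exact: measurableD.
apply: (@le_trans _ _ (\int[mu]_(x in A `|` (B `\` A)) f x)%E).
  apply: ge0_subset_integral => //.
  - exact: measurableU.
  - exact: measurable_funTS.
  - move=> x /CAB[Ax|Bx]; first by left.
    by have [Ax|nAx] := pselect (A x); [left|right].
rewrite ge0_integral_setU//.
- apply: leeD2l; apply: ge0_subset_integral => //.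
  exact: measurable_funTS.
- exact: measurable_funTS.
- by apply/disj_setPS => x [Ax [_ nAx]]; exact: nAx.
Qed.

(** Case [eta = 1] of the weighted estimate: the weight is at least exp(-s) on [-1, 1], so removing
    it costs exp s. A single variable calls for no smallness. *)
Lemma poly_psi_integral : exists2 k0 : R, 0 < k0 &
  forall (p : {poly R}) (d j : nat), (0 < d)%N -> (size p <= d.+1)%N ->
  (\int[mu]_(t in `[(-1)%R, 1%R]) psi (2 * d%:R)^-1 `|p.[t]|
   <= psi (2 * d%:R)^-1 `|p`_j| * k0%:E)%E.
Proof.
have [s s0 hs] := poly_psi_integral_small (@ltr01 R).
exists (expR s); first exact: expR_gt0.
move=> p d j d0 sp; have := hs p d j d0 sp; rewrite mule1 => h.
have mp : measurable_fun setT (fun t : R => psi (2 * d%:R)^-1 `|p.[t]|).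
  apply: (measurableT_comp (measurable_psi _)) => /=; apply: measurableT_comp => //.
  by apply: continuous_measurable_fun; exact: continuous_horner.
have mexp : measurable_fun setT (fun t : R => (expR (- (s * t ^+ 2)))%:E).
  apply/measurable_EFinP; apply: measurableT_comp => //; apply: measurableT_comp => //.
  by apply: measurable_funM => //; exact: measurable_funX.
have mpe (D : set R) : measurable_fun D
   (fun t : R => psi (2 * d%:R)^-1 `|p.[t]| * (expR (- (s * t ^+ 2)))%:E)%E.
  by apply: measurable_funTS; exact: emeasurable_funM mp mexp.
rewrite muleC; apply: le_trans (lee_wpmul2l _ h); last by rewrite lee_fin expR_ge0.
rewrite -ge0_integralZl; last 4 first.
- exact: measurable_itv.
- exact: mpe.
- by move=> t _; rewrite mule_ge0 ?psi_ge0// lee_fin expR_ge0.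
- by rewrite lee_fin expR_ge0.
apply: ge0_le_integral.
- exact: measurable_itv.
- by move=> t _; exact: psi_ge0.
- exact: measurable_funTS mp.
- by apply: emeasurable_funM; [exact: measurable_cst|exact: mpe].
move=> t; rewrite /= in_itv/= -ler_norml => t1.
rewrite muleCA -[leLHS]mule1 lee_wpmul2l ?psi_ge0// -EFinM lee_fin -expRD.
rewrite -expR0 ler_expR subr_ge0 ler_piMr// -[t ^+ 2]real_normK ?num_real//.
by rewrite expr_le1.
Qed.

Lemma measurable_psi_poly_inv (b : R) (q : {poly R}) :
  measurable_fun setT (fun r : RR => psi b `|q.[r]| * (r `^ (-1))%:E)%E.
Proof.
apply: emeasurable_funM.
  apply: (measurableT_comp (measurable_psi _)) => /=; apply: measurableT_comp => //.
  by apply: continuous_measurable_fun; exact: continuous_horner.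
by apply/measurable_EFinP; exact: measurable_powR.
Qed.

(** The dilation r = 2 u t sends [u, 2 u] into [-1, 1] and multiplies the j-th coefficient by (2
    u)^j. The factor 2 is 2 u from dr times the bound 1 / u for 1 / r. *)
Lemma psi_poly_block : exists2 k0 : R, 0 < k0 &
  forall (q : {poly R}) (d j : nat) (u : R), (0 < d)%N -> (size q <= d.+1)%N -> 0 < u ->
  (\int[mu]_(r in `[u, (2 * u)%R]) (psi (2 * d%:R)^-1 `|q.[r]| * (r `^ (-1))%:E)
   <= psi (2 * d%:R)^-1 (`|q`_j| * (2 * u) ^+ j) * (2 * k0)%:E)%E.
Proof.
have [k0 k00 hk] := poly_psi_integral; exists k0 => // q d j u d0 sq u0.
set b := (2 * d%:R)^-1; set c := 2 * u.
have c0 : 0 < c by rewrite mulr_gt0.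
have mp : measurable_fun setT (fun t : R => psi b `|q.[t]|).
  apply: (measurableT_comp (measurable_psi _)) => /=; apply: measurableT_comp => //.
  by apply: continuous_measurable_fun; exact: continuous_horner.
apply: (@le_trans _ _ (\int[mu]_(r in `[u, c]) ((u^-1)%:E * psi b `|q.[r]|))%E).
  apply: ge0_le_integral.
  - exact: measurable_itv.
  - by move=> r _; rewrite mule_ge0 ?psi_ge0// lee_fin powR_ge0.
  - exact: measurable_funTS (measurable_psi_poly_inv b q).
  - by apply: emeasurable_funM; [exact: measurable_cst|exact: measurable_funTS mp].
  - move=> r; rewrite /= in_itv/= => /andP[ur _].
    have r0 := lt_le_trans u0 ur.
    by rewrite muleC lee_wpmul2r ?psi_ge0// lee_fin powR_inv1 ?lef_pV2 ?posrE// ltW.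
rewrite ge0_integralZl; last 4 first.
- exact: measurable_itv.
- exact: measurable_funTS mp.
- by move=> r _; exact: psi_ge0.
- by rewrite lee_fin invr_ge0 ltW.
rewrite integral_mkindic.
have mI : measurable_fun setT (fun x : RR => (\1_`[u, c]%classic x : R)%:E).
  by apply/measurable_EFinP; apply: measurable_indic; exact: measurable_itv.
rewrite (ge0_integral_scale1 c0); last 2 first.
- by apply: emeasurable_funM; [exact: mp|exact: mI].
- by move=> r; rewrite mule_ge0 ?psi_ge0// lee_fin.
pose q' := \poly_(i < size q) (q`_i * c ^+ i).
have q'E t : q'.[t] = q.[c * t].
  rewrite horner_poly horner_coef; apply: eq_bigr => i _.
  by rewrite [(c * t) ^+ i]exprMn mulrA.
have sq' : (size q' <= d.+1)%N by rewrite (leq_trans (size_poly _ _)).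
have q'j : q'`_j = q`_j * c ^+ j.
  by rewrite coef_poly; case: ltnP => // h; rewrite nth_default// mul0r.
have := hk q' d j d0 sq'; rewrite q'j normrM (ger0_norm (exprn_ge0 _ (ltW c0))) => h.
rewrite muleA -EFinM (_ : u^-1 * c = 2); last by rewrite /c mulrC mulfK// gt_eqF.
rewrite [(2 * k0)%:E]EFinM muleCA; apply: lee_wpmul2l; first by rewrite lee_fin.
apply: le_trans h; rewrite [leRHS]integral_mkindic.
apply: ge0_le_integral => //.
- by move=> r _; rewrite mule_ge0 ?psi_ge0// lee_fin.
- apply: emeasurable_funM.
    exact: (measurableT_comp mp (measurable_scale c)).
  exact: (measurableT_comp mI (measurable_scale c)).
- apply: emeasurable_funM.
    apply: (measurableT_comp (measurable_psi _)) => /=; apply: measurableT_comp => //.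
    by apply: continuous_measurable_fun; exact: continuous_horner.
  by apply/measurable_EFinP; apply: measurable_indic; exact: measurable_itv.
- move=> t _; rewrite q'E; apply: lee_wpmul2l; first exact: psi_ge0.
  rewrite lee_fin !indicE; case: (boolP (c * t \in _)) => // h1.
  rewrite mem_set//= in_itv/=; move: h1; rewrite inE/= in_itv/= => /andP[h1 h2].
  have t0 : 0 <= t by rewrite -(pmulr_rge0 _ c0) (le_trans (ltW u0)).
  by rewrite (le_trans _ t0)//= -(ler_pM2l c0) mulr1.
Qed.

(** The factor by which the bound of [psi_poly_block] shrinks when [u] is doubled; it is below 1 for
    positive d and j. *)
Definition dratio (d j : nat) : R := 2 `^ (- (j%:R / (2 * d%:R))).

(** One block [2^l a, 2^(l+1) a] for each [l]. The exponent l + 1 comes from the right endpoint, at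
    which [psi_poly_block] evaluates the monomial. *)
Lemma psi_poly_dyadic : exists2 k0 : R, 0 < k0 &
  forall (q : {poly R}) (d j N : nat) (a : R), (0 < d)%N -> (0 < j)%N ->
  (size q <= d.+1)%N -> 0 < a -> 0 < `|q`_j| ->
  (\int[mu]_(r in `[a, (2 ^+ N * a)%R]) (psi (2 * d%:R)^-1 `|q.[r]| * (r `^ (-1))%:E)
   <= (k0 * (`|q`_j| * a ^+ j) `^ (- (2 * d%:R)^-1) *
       \sum_(0 <= l < N) (dratio d j) ^+ l.+1)%:E)%E.
Proof.
have [k0 k00 hk] := psi_poly_block; exists (2 * k0); first by rewrite mulr_gt0.
move=> q d j N a d0 j0 sq a0 c0; elim: N => [|N ih].
  rewrite expr0 mul1r big_nil mulr0.
  rewrite set_itv1. rewrite integral_set1//.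
have f0 (x : RR) : (0 <= psi (2 * d%:R)^-1 `|q.[x]| * (x `^ (-1))%:E)%E.
  by rewrite mule_ge0 ?psi_ge0// lee_fin powR_ge0.
apply: le_trans (ge0_integral_setU_le (A := `[a, (2 ^+ N * a)%R]%classic)
  (B := `[(2 ^+ N * a)%R, (2 * (2 ^+ N * a))%R]%classic) _ _ _ _
  (measurable_psi_poly_inv _ _) f0) _.
- exact: measurable_itv.
- exact: measurable_itv.
- exact: measurable_itv.
- move=> x /=; rewrite !in_itv/= => /andP[ax xb]; have [xN|Nx] := leP x (2 ^+ N * a).
    by left; rewrite ax.
  by right; rewrite ltW//= mulrA -exprS.
have u0 : 0 < 2 ^+ N * a by rewrite mulr_gt0// exprn_gt0.
apply: (le_trans (leeD ih (hk q d j _ d0 sq u0))).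
rewrite big_nat_recr//= mulrDr EFinD; apply: leeD2l.
rewrite mulrA -exprS exprMn mulrCA psiM ?exprn_gt0//; last first.
  by rewrite mulr_ge0// ?exprn_ge0 ?ltW.
have ca0 : 0 < `|q`_j| * a ^+ j by rewrite mulr_gt0// exprn_gt0.
rewrite /psi gt_eqF// -!EFinM lee_fin mulrC -mulrA ler_pM2l ?mulr_gt0// mulrC ler_wpM2l ?powR_ge0//.
have h2 : 0 <= 2 ^+ N.+1 :> R by rewrite exprn_ge0.
rewrite /dratio -(powR_mulrn j h2) -(powR_mulrn N.+1 (ler0n R 2)).
rewrite -(powR_mulrn N.+1 (powR_ge0 _ _)) -!powRrM le_eqVlt; apply/orP; left; apply/eqP.
by rewrite !mulrN mulNr; congr (_ `^ (- _)); rewrite mulrC.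
Qed.

(** The left-hand side is at most min(1, D / y), hence at most every power of D / y with exponent in
    ]0, 1]. This turns the remainder of [oscillatory_by_parts] into an integral of [psi]. *)
Lemma cauchy_kernel_le_powR (D y be : R) : 0 < D -> 0 < y -> 0 < be <= 1 ->
  D ^+ 2 / (y ^+ 2 + D ^+ 2) <= D `^ be / y `^ be.
Proof.
move=> D0 y0 /andP[be0 be1].
have den : 0 < y ^+ 2 + D ^+ 2 by rewrite addr_gt0 ?exprn_gt0.
rewrite ler_pdivrMr// mulrAC ler_pdivlMr ?powR_gt0//.
have [yD|Dy] := leP y D.
  apply: (@le_trans _ _ (D ^+ 2 * D `^ be)).
    by rewrite ler_wpM2l ?sqr_ge0//; apply: ge0_ler_powR => //; rewrite ?nnegrE ltW.
  by rewrite mulrC ler_wpM2l ?powR_ge0// lerDr sqr_ge0.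
have yE : y = D * (y / D) by rewrite mulrCA divff ?mulr1// gt_eqF.
have z1 : 1 <= y / D by rewrite ler_pdivlMr// mul1r ltW.
rewrite {1}yE (powRM _ (ltW D0) (divr_ge0 (ltW y0) (ltW D0))) mulrCA ler_wpM2l ?powR_ge0//.
have : (y / D) `^ be <= y / D.
  by rewrite -[leRHS]powRr1 ?(le_trans ler01)//; apply: ler_powR.
move=> h; apply: (@le_trans _ _ (D ^+ 2 * (y / D))).
  by rewrite ler_wpM2l ?sqr_ge0.
have -> : D ^+ 2 * (y / D) = D * y by field; rewrite gt_eqF.
have := sqr_ge0 D; nra.
Qed.

Lemma geometric_sum_le (rho : R) (N : nat) : 0 < rho -> rho < 1 ->
  \sum_(0 <= l < N) rho ^+ l.+1 <= rho / (1 - rho).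
Proof.
move=> r0 r1; have r1' : 0 < 1 - rho by rewrite subr_gt0.
suff -> : \sum_(0 <= l < N) rho ^+ l.+1 = (rho - rho ^+ N.+1) / (1 - rho).
  by rewrite ler_pM2r ?invr_gt0// gerBl exprn_ge0// ltW.
elim: N => [|N ih]; first by rewrite big_nil expr1 subrr mul0r.
rewrite big_nat_recr//= ih [rho ^+ N.+2]exprS; field; by rewrite gt_eqF.
Qed.

(** [D] is left free on purpose: [uray_far] takes D = d for a bounded result, [uray_tail] takes
    first D and then [a] large for a small one. *)
Lemma oscillatory_bound : exists2 k0 : R, 0 < k0 &
  forall (p : {poly R}) (d j : nat) (D a b : R), (0 < d)%N -> (0 < j)%N ->
  (size p <= d.+1)%N -> 0 < a -> a < b -> 0 < D -> 0 < `|p`_j| ->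
  `|\int[mu]_(r in `[a, b]) (cos p.[r] / r)| <=
  (1 + pi * d%:R) / D + k0 * (D / (j%:R * `|p`_j| * a ^+ j)) `^ ((2 * d%:R)^-1) *
     (dratio d j / (1 - dratio d j)).
Proof.
have [k0 k00 hk] := psi_poly_dyadic; exists k0; first by [].
move=> p d j D a b d0 j0 sp a0 ab D0 pj; set rho := dratio d j.
have d0' : 0 < d%:R :> R by rewrite ltr0n.
have j0' : 0 < j%:R :> R by rewrite ltr0n.
set be := (2 * d%:R)^-1.
have be0 : 0 < be by rewrite invr_gt0 mulr_gt0.
have be1 : be <= 1 by rewrite invf_le1 ?mulr_gt0// -natrM ler1n muln_gt0.
have rho0 : 0 < rho by rewrite powR_gt0.
have rho1 : rho < 1.
  rewrite /rho /dratio /powR pnatr_eq0/= -[ltRHS]expR0 ltr_expR mulNr oppr_lt0.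
  by rewrite mulr_gt0 ?ln_gt0 ?ltr1n// divr_gt0// mulr_gt0.
pose q := 'X * p^`().
have qj : q`_j = p`_j *+ j.
  by rewrite /q coefXM; case: (j) j0 => // m _; rewrite coef_deriv.
have sq : (size q <= d.+1)%N.
  have [p'0|p'0] := eqVneq p^`() 0; first by rewrite /q p'0 mulr0 size_poly0.
  rewrite /q mulrC size_mulX// (leq_trans _ sp)// lt_size_deriv//.
  by apply: contra_neq p'0 => ->; rewrite deriv0.
have qjn : `|q`_j| = j%:R * `|p`_j| by rewrite qj normrMn mulr_natl.
have qj0 : 0 < `|q`_j| by rewrite qjn mulr_gt0.
rewrite -lee_fin; apply: (le_trans (oscillatory_by_parts D0 a0 ab sp)).
rewrite EFinD; apply: leeD2l.
have [N hN] : exists N, b <= 2 ^+ N * a.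
  have ab0 : 0 < a / b by rewrite divr_gt0// (lt_trans a0).
  have [N _ /(_ N (leqnn N))] := near_infty_natSinv_expn_lt (PosNum ab0).
  rewrite /= div1r ltr_pdivlMr ?(lt_trans a0)// mulrC ltr_pdivrMr ?exprn_gt0// => h.
  by exists N; rewrite mulrC ltW.
apply: (@le_trans _ _ (\int[mu]_(r in `[a, (2 ^+ N * a)%R])
   ((D `^ be)%:E * (psi be `|q.[r]| * (r `^ (-1))%:E)))%E).
  apply: (@le_trans _ _ (\int[mu]_(r in `[a, b])
     ((D `^ be)%:E * (psi be `|q.[r]| * (r `^ (-1))%:E)))%E); last first.
    apply: ge0_subset_integral.
    - exact: measurable_itv.
    - exact: measurable_itv.
    - apply: emeasurable_funM; first exact: measurable_cst.
      exact: measurable_funTS (measurable_psi_poly_inv be q).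
    - by move=> r _; rewrite mule_ge0 ?lee_fin ?powR_ge0// mule_ge0 ?psi_ge0// lee_fin powR_ge0.
    - by move=> r /=; rewrite !in_itv/= => /andP[-> rb]; exact: le_trans hN.
  apply: ge0_le_integral.
  - exact: measurable_itv.
  - move=> r; rewrite /= in_itv/= => /andP[ar _].
    by rewrite lee_fin divr_ge0 ?sqr_ge0// mulr_ge0 ?addr_ge0 ?sqr_ge0// (le_trans (ltW a0)).
  - apply/measurable_EFinP; apply: continuous_itv_measurable => r /andP[ar _].
    have r0 : r != 0 by rewrite gt_eqF// (lt_le_trans a0).
    apply: cvgM; first exact: cvg_cst.
    apply: cvgV.
      by rewrite mulf_neq0// gt_eqF// ltr_wpDl ?sqr_ge0// exprn_gt0.
    apply: cvgM; first exact: cvg_id.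
    by apply: cvgD; [apply: cvgM; exact: continuous_horner|exact: cvg_cst].
  - apply: emeasurable_funM; first exact: measurable_cst.
    exact: measurable_funTS (measurable_psi_poly_inv be q).
  - move=> r; rewrite /= in_itv/= => /andP[ar _].
    have r0 : 0 < r by rewrite (lt_le_trans a0).
    rewrite -/q (powR_inv1 (ltW r0)) invfM mulrA mulrAC EFinM muleA; apply: lee_wpmul2r.
      by rewrite lee_fin invr_ge0 ltW.
    have [qr0|qr0] := eqVneq `|q.[r]| 0.
      by rewrite /psi qr0 eqxx gt0_muley ?leey// lte_fin powR_gt0.
    have qr1 : 0 < `|q.[r]| by rewrite lt_neqAle eq_sym qr0 normr_ge0.
    rewrite /psi (negbTE qr0) -EFinM lee_fin powRN.
    rewrite -[q.[r] ^+ 2]real_normK ?num_real//.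
    by apply: cauchy_kernel_le_powR => //; rewrite be0.
rewrite ge0_integralZl; last 4 first.
- exact: measurable_itv.
- exact: measurable_funTS (measurable_psi_poly_inv be q).
- by move=> r _; rewrite mule_ge0 ?psi_ge0// lee_fin powR_ge0.
- by rewrite lee_fin powR_ge0.
apply: (le_trans (lee_wpmul2l _ (hk q d j N a d0 j0 sq a0 qj0))); first by rewrite lee_fin powR_ge0.
rewrite -EFinM lee_fin qjn -/be -/rho.
have h := geometric_sum_le N rho0 rho1.
have c0 : 0 < j%:R * `|p`_j| * a ^+ j by rewrite !mulr_gt0// exprn_gt0.
rewrite powRM ?invr_ge0 ?(ltW D0) ?(ltW c0)//.
have -> : (j%:R * `|p`_j| * a ^+ j)^-1 `^ be = (j%:R * `|p`_j| * a ^+ j) `^ (- be).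
  by rewrite -powR_inv1 ?(ltW c0)// -powRrM mulN1r.
rewrite mulrA mulrCA -!mulrA; apply: ler_wpM2l; first exact: ltW.
rewrite mulrCA; apply: ler_wpM2l; first exact: powR_ge0.
by apply: ler_wpM2l; first exact: powR_ge0.
Qed.

End dyadic.

(** * Polynomials in several variables *)

(* A polynomial of degree at most D in each variable is given by its coefficients
   [c : n.-tuple 'I_D.+1 -> R]. *)
Section multivariate.
Variable R : realType.
Local Notation mu := (@lebesgue_measure R).
Local Notation RR := (measurableTypeR R).

Section tuple_sum.
Variables (I : finType) (V : nmodType).

Lemma sum_tuple_cons n (F : n.+1.-tuple I -> V) :
  \sum_t F t = \sum_i \sum_(t : n.-tuple I) F (cons_tuple i t).
Proof.
rewrite pair_bigA/= (reindex (fun p : I * n.-tuple I => cons_tuple p.1 p.2))//=.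
exists (fun t => (thead t, behead_tuple t)) => [[i t] _|t _] /=.
  by congr pair; apply/val_inj.
by rewrite [RHS]tuple_eta.
Qed.

End tuple_sum.

Definition mon D n (al : n.-tuple 'I_D.+1) (x : Rn R n) : R :=
  \prod_(i < n) tnth x i ^+ tnth al i.

Definition pev D n (c : n.-tuple 'I_D.+1 -> R) (x : Rn R n) : R :=
  \sum_al c al * mon al x.

Lemma mon_cons D n (k : 'I_D.+1) (al : n.-tuple 'I_D.+1) (a : RR) (x : Rn R n) :
  mon (cons_tuple k al) (consRn (a, x)) = a ^+ k * mon al x.
Proof.
rewrite /mon big_ord_recl !tnth0; congr (_ * _).
by apply: eq_bigr => i _; rewrite !tnthS.
Qed.

Lemma pev_cons D n (c : n.+1.-tuple 'I_D.+1 -> R) (a : RR) (x : Rn R n) :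
  pev c (consRn (a, x)) = \sum_(k < D.+1) a ^+ k * pev (fun al => c (cons_tuple k al)) x.
Proof.
rewrite /pev sum_tuple_cons; apply: eq_bigr => k _.
by rewrite mulr_sumr; apply: eq_bigr => al _; rewrite mon_cons mulrCA.
Qed.

Lemma measurable_mon D n (al : n.-tuple 'I_D.+1) : measurable_fun setT (mon al).
Proof.
apply: measurable_prod => i _; apply: measurable_funX; exact: (measurable_tnth i).
Qed.

Lemma measurable_pev D n (c : n.-tuple 'I_D.+1 -> R) : measurable_fun setT (pev c).
Proof.
apply: measurable_sum => al; apply: measurable_funM => //; exact: measurable_mon.
Qed.

Lemma measurable_psi_pev D n (b : R) (c : n.-tuple 'I_D.+1 -> R) :
  measurable_fun setT (fun x => psi b `|pev c x|).
Proof.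
apply: (measurableT_comp (measurable_psi _)) => /=; apply: measurableT_comp => //.
exact: measurable_pev.
Qed.

Definition wgt1 (s : R) (t : RR) : R := expR (- (s * t ^+ 2)) * \1_`[(-1)%R, 1%R]%classic t.

Definition wgt n (s : R) (x : Rn R n) : R := \prod_(i < n) wgt1 s (tnth x i).

Lemma wgt1_ge0 s t : 0 <= wgt1 s t.
Proof. by rewrite mulr_ge0// expR_ge0. Qed.

Lemma wgt_ge0 n s (x : Rn R n) : 0 <= wgt s x.
Proof. by apply: prodr_ge0 => i _; exact: wgt1_ge0. Qed.

Lemma measurable_wgt1 s : measurable_fun setT (wgt1 s).
Proof.
apply: measurable_funM; last by apply: measurable_indic; exact: measurable_itv.
apply: measurableT_comp => //; apply: measurableT_comp => //.
by apply: measurable_funM => //; exact: measurable_funX.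
Qed.

Lemma measurable_wgt n s : measurable_fun setT (@wgt n s).
Proof.
apply: measurable_prod => i _; apply: measurableT_comp; first exact: measurable_wgt1.
exact: (measurable_tnth i).
Qed.

Lemma wgt_cons n s (a : RR) (x : Rn R n) : wgt s (consRn (a, x)) = wgt1 s a * wgt s x.
Proof.
rewrite /wgt big_ord_recl !tnth0; congr (_ * _).
by apply: eq_bigr => i _; rewrite !tnthS.
Qed.

(** Induction on n. With the other variables fixed, the one-variable estimate is applied in the
    first variable with the coefficient of index [thead al], itself a polynomial in the others; each
    variable yields one factor [eta]. [D] only sizes the index type, while the exponent depends on
    the bound [d] for the degree in each variable. *)
Lemma pev_psi_integral_small (eta : R) : 0 < eta -> exists2 s : R, 0 <= s &
  forall n D (d : nat) (c : n.-tuple 'I_D.+1 -> R) (al : n.-tuple 'I_D.+1), (0 < d)%N ->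
  (forall be, c be != 0 -> forall i, (tnth be i <= d)%N) ->
  (\int[lebesgue_Rn R n]_x (psi (2 * d%:R)^-1 `|pev c x| * (wgt s x)%:E)
    <= psi (2 * d%:R)^-1 `|c al| * (eta ^+ n)%:E)%E.
Proof.
move=> eta0; have [s s0 hs] := poly_psi_integral_small eta0.
exists s => //; elim=> [|n ih] D d c al d0 hc.
  (* Without variables the measure is a Dirac mass and the polynomial is its single coefficient. *)
  rewrite expr0 mule1 integral_dirac//; last first.
    apply: emeasurable_funM; first exact: measurable_psi_pev.
    by apply/measurable_EFinP; exact: measurable_wgt.
  rewrite /= diracE mem_set// mul1e /wgt big_ord0 mule1.
  rewrite /pev (bigD1 al)//= big1 ?addr0; last first.
    by move=> be; rewrite [be]tuple0 [al]tuple0 eqxx.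
  by rewrite /mon big_ord0 mulr1.
pose k := thead al; pose al' := behead_tuple al.
have alE : al = cons_tuple k al' by rewrite [LHS]tuple_eta; exact/val_inj.
(* The default value of [inord] for j > D is never read, as [P] stops at degree D. *)
pose cc (j : nat) (be : n.-tuple 'I_D.+1) := c (cons_tuple (inord j) be).
pose P (x : Rn R n) : {poly R} := \poly_(j < D.+1) pev (cc j) x.
have cc_le j be : cc j be != 0 -> ((inord j : 'I_D.+1) <= d)%N /\ forall i, (tnth be i <= d)%N.
  move=> h; split; first by have := hc _ h ord0; rewrite tnth0.
  by move=> i; have := hc _ h (lift ord0 i); rewrite tnthS.
have PE x a : (P x).[a] = pev c (consRn (a, x)).
  rewrite pev_cons /P horner_poly; apply: eq_bigr => j _.
  by rewrite mulrC /cc inord_val.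
have sP x : (size (P x) <= d.+1)%N.
  apply/leq_sizeP => j dj; rewrite coef_poly; case: ltnP => // jD.
  rewrite /pev big1// => be _; apply/eqP; rewrite mulf_eq0; apply/orP; left.
  apply/negPn/negP => /cc_le[]; rewrite inordK// => jd _.
  by move: dj; rewrite ltnNge jd.
have Pk x : (P x)`_k = pev (cc k) x by rewrite coef_poly ltn_ord.
have mF : measurable_fun setT (fun x : Rn R n.+1 =>
    psi (2 * d%:R)^-1 `|pev c x| * (wgt s x)%:E)%E.
  apply: emeasurable_funM; first exact: measurable_psi_pev.
  by apply/measurable_EFinP; exact: measurable_wgt.
have F0 (x : Rn R n.+1) : (0 <= psi (2 * d%:R)^-1 `|pev c x| * (wgt s x)%:E)%E.
  by rewrite mule_ge0 ?psi_ge0// lee_fin wgt_ge0.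
have mFc := measurableT_comp mF (@measurable_consRn R n).
rewrite ge0_integral_Rn_succ//.
rewrite (fubini_tonelli (m1 := mu) (m2 := lebesgue_Rn R n) _ mFc (fun z => F0 _)).
have mwE : measurable_fun setT (fun x : Rn R n => (wgt s x)%:E).
  by apply/measurable_EFinP; exact: measurable_wgt.
apply: (@le_trans _ _ (\int[lebesgue_Rn R n]_x
   (psi (2 * d%:R)^-1 `|pev (cc k) x| * (wgt s x)%:E * eta%:E))%E).
  apply: ge0_le_integral => //.
  - by move=> x _; apply: integral_ge0 => t _ /=; exact: F0.
  - exact: (@measurable_fun_fubini_tonelli_G _ _ _ _ _ mu _ mFc (fun z => F0 _)).
  - apply: emeasurable_funM; last exact: measurable_cst.
    by apply: emeasurable_funM; [exact: measurable_psi_pev|exact: mwE].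
  move=> x _ /=.
  have := hs (P x) d k d0 (sP x); rewrite Pk => h.
  rewrite muleAC; apply: le_trans (lee_wpmul2r _ h); last by rewrite lee_fin wgt_ge0.
  rewrite muleC [X in (_ <= _ * X)%E]integral_mkindic.
  have mp : measurable_fun setT (fun t : R => psi (2 * d%:R)^-1 `|(P x).[t]|).
    apply: (measurableT_comp (measurable_psi _)) => /=; apply: measurableT_comp => //.
    by apply: continuous_measurable_fun; exact: continuous_horner.
  have me : measurable_fun setT (fun t : RR => (wgt1 s t)%:E).
    by apply/measurable_EFinP; exact: measurable_wgt1.
  have wE (t : RR) : (psi (2 * d%:R)^-1 `|(P x).[t]| * (expR (- (s * t ^+ 2)))%:E *
      (\1_`[(-1)%R, 1%R]%classic t)%:E = psi (2 * d%:R)^-1 `|(P x).[t]| * (wgt1 s t)%:E)%E.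
    by rewrite -muleA -EFinM.
  under [X in (_ <= _ * X)%E]eq_integral do rewrite wE.
  rewrite -ge0_integralZl; last 4 first.
  - exact: measurableT.
  - by apply: emeasurable_funM; [exact: mp|exact: me].
  - by move=> t _; rewrite mule_ge0 ?psi_ge0// lee_fin wgt1_ge0.
  - by rewrite lee_fin wgt_ge0.
  rewrite le_eqVlt; apply/orP; left; apply/eqP; apply: eq_integral => t _.
  by rewrite PE wgt_cons EFinM muleA muleC.
rewrite ge0_integralZr; last 4 first.
- exact: measurableT.
- by apply: emeasurable_funM; [exact: measurable_psi_pev|exact: mwE].
- by move=> x _; rewrite mule_ge0 ?psi_ge0// lee_fin wgt_ge0.
- by rewrite lee_fin ltW.
have hcc be : cc k be != 0 -> forall i, (tnth be i <= d)%N by move=> /cc_le[].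
have := ih D d (cc k) al' d0 hcc.
rewrite /cc inord_val -alE => h.
apply: (le_trans (lee_wpmul2r _ h)); first by rewrite lee_fin ltW.
by rewrite -muleA -EFinM -exprSr.
Qed.

(** Iterating over the variables needs a product weight, and a bound free of n needs a weight that
    depends only on the norm in the ball; the Gaussian is both. *)
Lemma wgt_cone1 n s (x : Rn R n) : 0 <= s -> cone1 x -> expR (- s) <= wgt s x.
Proof.
move=> s0 /andP[_ x1].
have xx1 : \sum_(i < n) tnth x i ^+ 2 <= 1.
  have h0 : 0 <= \sum_(i < n) tnth x i ^+ 2 by apply: sumr_ge0 => i _; exact: sqr_ge0.
  by rewrite -(sqr_sqrtr h0) expr_le1// enorm_ge0.
have xi i : -1 <= tnth x i <= 1.
  rewrite -ler_norml -[leRHS]sqrtr1 -sqrtr_sqr ler_wsqrtr// (le_trans _ xx1)//.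
  rewrite (bigD1 i)//= lerDl; apply: sumr_ge0 => j _; exact: sqr_ge0.
rewrite /wgt (eq_bigr (fun i => expR (- (s * tnth x i ^+ 2)))); last first.
  by move=> i _; rewrite /wgt1 indicE mem_set ?mulr1//= in_itv/= xi.
rewrite -expR_sum ler_expR sumrN lerN2 -mulr_sumr.
by rewrite ler_piMr.
Qed.

(** Removing the weight on the unit ball costs C = exp s, the same in all dimensions, and keeps the
    gain eta^n. *)
Lemma pev_psi_cone1 (eta : R) : 0 < eta -> exists2 C : R, 0 < C &
  forall n D (d : nat) (c : n.-tuple 'I_D.+1 -> R) (al : n.-tuple 'I_D.+1), (0 < d)%N ->
  (forall be, c be != 0 -> forall i, (tnth be i <= d)%N) ->
  (\int[lebesgue_Rn R n]_(x in @cone1 R n) psi (2 * d%:R)^-1 `|pev c x|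
    <= psi (2 * d%:R)^-1 `|c al| * (C * eta ^+ n)%:E)%E.
Proof.
move=> eta0; have [s s0 hs] := pev_psi_integral_small eta0.
exists (expR s); first exact: expR_gt0.
move=> n D d c al d0 hc.
have mwE : measurable_fun setT (fun x : Rn R n => (wgt s x)%:E).
  by apply/measurable_EFinP; exact: measurable_wgt.
have mpw : measurable_fun setT (fun x : Rn R n => psi (2 * d%:R)^-1 `|pev c x| * (wgt s x)%:E)%E.
  by apply: emeasurable_funM; [exact: measurable_psi_pev|exact: mwE].
rewrite EFinM muleCA; apply: le_trans (lee_wpmul2l _ (hs n D d c al d0 hc)); last first.
  by rewrite lee_fin expR_ge0.
rewrite -ge0_integralZl; last 4 first.
- exact: measurableT.
- exact: mpw.
- by move=> x _; rewrite mule_ge0 ?psi_ge0// lee_fin wgt_ge0.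
- by rewrite lee_fin expR_ge0.
rewrite [leLHS]integral_mkindic; apply: ge0_le_integral.
- exact: measurableT.
- by move=> x _; rewrite mule_ge0 ?psi_ge0// lee_fin.
- apply: emeasurable_funM; first exact: measurable_psi_pev.
  by apply/measurable_EFinP; apply: measurable_indic; exact: measurable_cone1.
- by apply: emeasurable_funM; [exact: measurable_cst|exact: mpw].
move=> x _; rewrite muleCA -EFinM; apply: lee_wpmul2l; first exact: psi_ge0.
rewrite lee_fin indicE.
case: (boolP (x \in _)) => [|_]; last by rewrite mulr_ge0 ?expR_ge0 ?wgt_ge0.
rewrite inE => /(wgt_cone1 s0) h; rewrite -ler_pdivrMl ?expR_gt0// mulr1 -expRN//.
Qed.

End multivariate.

(** * Homogeneous parts, rays, and the dimension-free integral over the sphere *)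

Section homogeneous.
Variable R : realType.

Definition wt D n (al : n.-tuple 'I_D.+1) : nat := \sum_(i < n) tnth al i.

Lemma wt_cons D n (k : 'I_D.+1) (al : n.-tuple 'I_D.+1) : wt (cons_tuple k al) = (k + wt al)%N.
Proof.
rewrite /wt big_ord_recl tnth0; congr addn.
by apply: eq_bigr => i _; rewrite tnthS.
Qed.

Lemma leq_tnth_wt D n (al : n.-tuple 'I_D.+1) i : (tnth al i <= wt al)%N.
Proof. by rewrite /wt (bigD1 i)//= leq_addr. Qed.

Definition hom D n (j : nat) (c : n.-tuple 'I_D.+1 -> R) (al : n.-tuple 'I_D.+1) : R :=
  if wt al == j then c al else 0.

Definition hom_norm D n (j : nat) (c : n.-tuple 'I_D.+1 -> R) : R :=
  \sum_al `|hom j c al|.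

Lemma mon_scaleRn D n (al : n.-tuple 'I_D.+1) (r : R) (x : Rn R n) :
  mon al (scaleRn r x) = r ^+ wt al * mon al x.
Proof.
rewrite /mon /wt -prodrXr -big_split/=; apply: eq_bigr => i _.
by rewrite tnth_scaleRn exprMn.
Qed.

Lemma pev_hom_scaleRn D n j (c : n.-tuple 'I_D.+1 -> R) (r : R) (x : Rn R n) :
  pev (hom j c) (scaleRn r x) = r ^+ j * pev (hom j c) x.
Proof.
rewrite /pev mulr_sumr; apply: eq_bigr => al _; rewrite mon_scaleRn /hom.
by case: eqP => [->|_]; rewrite ?mul0r ?mulr0// mulrCA.
Qed.

Definition ray D n (c : n.-tuple 'I_D.+1 -> R) (x : Rn R n) : {poly R} :=
  \sum_al (c al * mon al x) *: 'X^(wt al).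

Lemma horner_ray D n (c : n.-tuple 'I_D.+1 -> R) (x : Rn R n) (r : R) :
  (ray c x).[r] = pev c (scaleRn r x).
Proof.
rewrite /ray horner_sum; apply: eq_bigr => al _.
by rewrite hornerZ hornerXn mon_scaleRn mulrAC -mulrA.
Qed.

Lemma coef_ray D n (c : n.-tuple 'I_D.+1 -> R) (x : Rn R n) j :
  (ray c x)`_j = pev (hom j c) x.
Proof.
rewrite /ray coef_sum; apply: eq_bigr => al _; rewrite coefZ coefXn /hom eq_sym.
by case: eqP => _; rewrite ?mulr1 ?mulr0 ?mul0r.
Qed.

Definition deg_le D n (d : nat) (c : n.-tuple 'I_D.+1 -> R) : Prop :=
  forall al, c al != 0 -> (wt al <= d)%N.

Lemma size_ray D n d (c : n.-tuple 'I_D.+1 -> R) (x : Rn R n) : deg_le d c ->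
  (size (ray c x) <= d.+1)%N.
Proof.
move=> hc; apply/leq_sizeP => j dj; rewrite coef_ray /pev big1// => al _.
apply/eqP; rewrite mulf_eq0; apply/orP; left; rewrite /hom; case: (wt al =P j) => [h|//].
by apply/negPn/negP => /hc; rewrite h leqNgt dj.
Qed.

(** The sum factors over the coordinates into n geometric series, each at most 2. *)
Lemma sum_half_wt D n :
  \sum_(al : n.-tuple 'I_D.+1) (2^-1 : R) ^+ wt al <= 2 ^+ n.
Proof.
elim: n => [|n ih].
  rewrite (bigD1 [tuple])//= big1 ?addr0; last by move=> al /negP[]; apply/eqP; exact: tuple0.
  by rewrite /wt big_ord0 expr0.
rewrite sum_tuple_cons.
under eq_bigr => k _ do under eq_bigr => t _ do rewrite wt_cons exprD.
under eq_bigr => k _ do rewrite -mulr_sumr.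
rewrite -mulr_suml exprS; apply: ler_pM => //.
- by apply: sumr_ge0 => k _; rewrite exprn_ge0.
- by apply: sumr_ge0 => k _; rewrite exprn_ge0.
have := @geometric_sum_le R 2^-1 D.
rewrite big_mkord => h; rewrite big_ord_recl expr0.
apply: (@le_trans _ _ (1 + 2^-1 / (1 - 2^-1))).
  by rewrite lerD2l; apply: h; lra.
by rewrite le_eqVlt; apply/orP; left; apply/eqP; field.
Qed.

Lemma hom_norm_le D n j (c : n.-tuple 'I_D.+1 -> R) : 0 < hom_norm j c ->
  exists2 al, wt al = j & hom_norm j c <= 2 ^+ (n + j) * `|c al|.
Proof.
move=> h0; have [al0 hal0] : exists al : n.-tuple 'I_D.+1, wt al == j.
  apply/existsP; apply: contraTT h0; rewrite negb_exists => /forallP h.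
  by rewrite /hom_norm big1 ?ltxx// => al _; rewrite /hom (negbTE (h al)) normr0.
have [al /eqP walj hal] := @Order.TotalTheory.arg_maxP _ _ _ al0
  (fun al => wt al == j) (fun al => `|c al|) hal0.
exists al => //.
(* The weight 2^j 2^-(wt be) equals 1 on the monomials of degree j; extended to all monomials, its
   sum is at most 2^(n + j), which replaces a count of monomials. *)
apply: (@le_trans _ _ (\sum_(be : n.-tuple 'I_D.+1) 2 ^+ j * (2^-1) ^+ wt be * `|c al|)).
  rewrite /hom_norm; apply: ler_sum => be _; rewrite /hom; case: eqP => [wb|_].
    have := hal be; rewrite wb eqxx => /(_ isT) /= h.
    by rewrite -exprMn divff// expr1n mul1r.
  by rewrite normr0 mulr_ge0// mulr_ge0 ?exprn_ge0.
rewrite -mulr_suml -mulr_sumr ler_wpM2r// addnC exprD ler_wpM2l ?exprn_ge0//.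
exact: sum_half_wt.
Qed.

(** Here [eta = 1/4] pays: 4^-n compensates the factor n of the surface measure and the factor 2^((n
    + j) / (2 j)) <= 2^n lost by passing to the largest coefficient, because n 2^n 4^-n <= 1. *)
Lemma sphere_psi_integral : exists2 C : R, 0 < C &
  forall n D j (c : n.-tuple 'I_D.+1 -> R), (0 < n)%N -> (0 < j)%N -> 0 < hom_norm j c ->
  (\int[@sphere_measure R n]_(x in @sphere R n)
     ((hom_norm j c `^ (2 * j%:R)^-1)%:E * psi (2 * j%:R)^-1 `|pev (hom j c) x|) <= C%:E)%E.
Proof.
have [C C0 hC] := @pev_psi_cone1 R (4^-1) ltac:(by rewrite invr_gt0).
exists C => // n D j c n0 j0 h0; set b := (2 * j%:R)^-1.
have j0' : 0 < j%:R :> R by rewrite ltr0n.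
have b0 : 0 < b by rewrite invr_gt0 mulr_gt0.
have [al wal hal] := hom_norm_le h0.
have cal0 : 0 < `|c al|.
  by have := lt_le_trans h0 hal; rewrite pmulr_rgt0// exprn_gt0.
rewrite ge0_integral_sphere; last 2 first.
- by apply: emeasurable_funM; [exact: measurable_cst|exact: measurable_psi_pev].
- by move=> x; rewrite mule_ge0 ?psi_ge0// lee_fin powR_ge0.
have hhom be : hom j c be != 0 -> forall i, (tnth be i <= j)%N.
  rewrite /hom; case: (wt be =P j) => [wb _ i|_]; last by rewrite eqxx.
  by rewrite -wb leq_tnth_wt.
have := hC n D j (hom j c) al j0 hhom; rewrite {2}/hom wal eqxx -/b => h.
apply: (@le_trans _ _ (n%:R%:E *
  ((hom_norm j c `^ b)%:E * (psi b `|c al| * (C * 4^-1 ^+ n)%:E)))%E).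
  apply: lee_wpmul2l; first by rewrite lee_fin.
  rewrite ge0_integralZl; last 4 first.
  - exact: measurable_cone1.
  - apply: measurable_funTS; apply: (measurableT_comp (measurable_psi_pev b (hom j c))).
    exact: measurable_normalize.
  - by move=> x _; exact: psi_ge0.
  - by rewrite lee_fin powR_ge0.
  apply: lee_wpmul2l; first by rewrite lee_fin powR_ge0.
  apply: le_trans h; apply: ge0_le_integral.
  - exact: measurable_cone1.
  - by move=> x _; exact: psi_ge0.
  - apply: measurable_funTS; apply: (measurableT_comp (measurable_psi_pev b (hom j c))).
    exact: measurable_normalize.
  - by apply: measurable_funTS; exact: measurable_psi_pev.
  (* By homogeneity |P_j(x / |x|)| >= |P_j(x)| in the unit ball, so the singular power of the
     direction is at most that of the point. *)
  move=> x /andP[x0 x1]; apply: le_psi => //; first exact: ltW.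
  rewrite normalizeE pev_hom_scaleRn normrM ler_peMl// ger0_norm ?exprn_ge0 ?invr_ge0 ?enorm_ge0//.
  by rewrite exprn_ege1// invf_ge1.
rewrite /psi gt_eqF// -!EFinM lee_fin.
have key : hom_norm j c `^ b * `|c al| `^ (- b) <= 2 ^+ n.
  rewrite powRN ler_pdivrMr ?powR_gt0//.
  apply: (@le_trans _ _ ((2 ^+ (n + j) * `|c al|) `^ b)).
    apply: ge0_ler_powR => //; rewrite ?nnegrE; [exact: ltW|exact: ltW|].
    by rewrite mulr_ge0// exprn_ge0.
  rewrite powRM ?exprn_ge0// ler_wpM2r ?powR_ge0//.
  rewrite -!powR_mulrn// -powRrM; apply: ler_powR; first by rewrite ler1n.
  rewrite /b ler_pdivrMr ?mulr_gt0// natrD.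
  have n1 : 1 <= n%:R :> R by rewrite ler1n.
  have j1 : 1 <= j%:R :> R by rewrite ler1n.
  nra.
move: key; set u := _ `^ b; set v := _ `^ (- b); set w := 4^-1 ^+ n => key.
have -> : n%:R * (u * (v * (C * w))) = u * v * (n%:R * w) * C by ring.
rewrite ler_piMl ?(ltW C0)// /w.
apply: (@le_trans _ _ (2 ^+ n * (n%:R * 4^-1 ^+ n))).
  by rewrite ler_wpM2r// mulr_ge0 ?exprn_ge0.
rewrite mulrCA -exprMn.
have -> : 2 * 4^-1 = 2^-1 :> R by field.
by rewrite exprVn ler_pdivrMr ?exprn_gt0// mul1r -natrX ler_nat ltnW// ltn_expl.
Qed.

(** The constant polynomial 1 in [pev_psi_cone1] bounds the volume of the ball by C 4^-n, and n 4^-n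
    <= 1. It is needed to integrate the additive constant in Young's inequality. *)
Lemma sphere_measure_bounded : exists2 C : R, 0 < C &
  forall n, (0 < n)%N -> (@sphere_measure R n (@sphere R n) <= C%:E)%E.
Proof.
have [C C0 hC] := @pev_psi_cone1 R (4^-1) ltac:(by rewrite invr_gt0).
exists C => // n n0.
have := hC n 0 1 (fun=> 1) (nseq_tuple n ord0) isT (fun be _ i => leq_trans (leq_ord _) (leq0n _)).
have E (al : n.-tuple 'I_1) : al = nseq_tuple n ord0.
  by apply: eq_from_tnth => i; rewrite [LHS]ord1 [RHS]ord1.
under eq_integral => x _.
  rewrite /pev (bigD1 (nseq_tuple n ord0))//= big1 ?addr0; last first.
    by move=> al; rewrite (E al) eqxx.
  rewrite /mon big1 ?mulr1 ?normr1 ?psi1; last first.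
    by move=> i _; rewrite [tnth (nseq_tuple _ _) i]ord1 expr0.
  over.
rewrite normr1 psi1 mul1e => h.
rewrite -[leLHS]mul1e -integral_cst; last exact: measurable_sphere.
rewrite ge0_integral_sphere//.
apply: (@le_trans _ _ (n%:R%:E * (C * 4^-1 ^+ n)%:E)%E).
  by apply: lee_wpmul2l => //; rewrite lee_fin.
rewrite -EFinM lee_fin mulrCA ler_piMr ?(ltW C0)//.
rewrite exprVn ler_pdivrMr ?exprn_gt0// mul1r -natrX ler_nat ltnW// ltn_expl//.
Qed.

End homogeneous.

(** * Truncated integrals *)

Section radial_integral.
Variable R : realType.
Local Notation mu := (@lebesgue_measure R).
Local Notation RR := (measurableTypeR R).
Implicit Types p q : {poly R}.

Definition ucos p (a b : R) : R := \int[mu]_(r in `[a, b]) (cos p.[r] / r).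

Lemma continuous_cos_poly p (r : R) : {for r, continuous (fun x : R => cos p.[x])}.
Proof.
apply: (@continuous_comp _ _ _ (horner p) cos); last exact: continuous_cos.
exact: continuous_horner.
Qed.

Lemma continuous_cos_poly_div p (r : R) : 0 < r ->
  {for r, continuous (fun x : R => cos p.[x] / x)}.
Proof.
move=> r0; apply: cvgM; first exact: continuous_cos_poly.
by apply: cvgV; [rewrite gt_eqF|exact: cvg_id].
Qed.

Lemma ucos_integrable p a b : 0 < a ->
  mu.-integrable `[a, b] (EFin \o (fun r : R => cos p.[r] / r)).
Proof.
move=> a0; apply: continuous_itv_integrable => r /andP[ar _].
by apply: continuous_cos_poly_div; exact: lt_le_trans ar.
Qed.

Lemma integral_inv (a b : R) : 0 < a -> a < b ->
  (\int[mu]_(r in `[a, b]) (r^-1)%:E)%E = (ln b - ln a)%:E.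
Proof.
move=> a0 ab; apply: (FTC2_is_derive ab).
- by move=> r /andP[ar _]; apply: is_derive1_ln; exact: lt_le_trans ar.
- move=> r /andP[ar _]; apply: cvgV; last exact: cvg_id.
  by rewrite gt_eqF// (lt_le_trans a0).
Qed.

Lemma ucos_id p a : ucos p a a = 0.
Proof. by rewrite /ucos set_itv1 Rintegral_set1. Qed.

Lemma ucos_le p a b : 0 < a -> a <= b -> `|ucos p a b| <= ln b - ln a.
Proof.
move=> a0; rewrite le_eqVlt => /predU1P[<-|ab]; first by rewrite ucos_id normr0 subrr.
apply: (le_trans (le_normr_Rintegral _ (ucos_integrable p b a0))); first exact: measurable_itv.
rewrite -lee_fin EFin_Rintegral_ge0; last first.
  move=> r /andP[ar _]; apply: cvg_norm; apply: continuous_cos_poly_div.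
  exact: lt_le_trans ar.
rewrite -integral_inv//; apply: ge0_le_integral.
- exact: measurable_itv.
- by move=> r _; rewrite lee_fin.
- apply/measurable_EFinP; apply: continuous_itv_measurable => r /andP[ar _].
  by apply: cvg_norm; apply: continuous_cos_poly_div; exact: lt_le_trans ar.
- apply/measurable_EFinP; apply: continuous_itv_measurable => r /andP[ar _].
  by apply: cvgV; [rewrite gt_eqF// (lt_le_trans a0)|exact: cvg_id].
- move=> r; rewrite /= in_itv/= => /andP[ar _].
  have r0 := lt_le_trans a0 ar.
  rewrite lee_fin normrM normfV (gtr0_norm r0) ler_piMl ?invr_ge0 ?(ltW r0)//.
  by rewrite ler_norml cos_geN1 cos_le1.
Qed.

Lemma ucos_split p a m b : 0 < a -> a <= m -> m <= b -> ucos p a b = ucos p a m + ucos p m b.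
Proof.
move=> a0 am mb; rewrite /ucos.
have E : `[a, b]%classic = `[a, m]%classic `|` `]m, b]%classic.
  by rewrite -itv_bndbnd_setU.
have iab := ucos_integrable p b a0.
have imb : mu.-integrable `]m, b] (EFin \o (fun r : R => cos p.[r] / r)).
  apply: integrableS iab; [exact: measurable_itv|exact: measurable_itv|].
  by rewrite E; exact: subsetUr.
rewrite E Rintegral_setU; first by rewrite (Rintegral_itv_obnd_cbnd imb).
- exact: measurable_itv.
- exact: measurable_itv.
- by rewrite -E.
- apply/disj_setPS => r /= [] /=; rewrite !in_itv/= => /andP[_ rm] /andP[mr _].
  by move: rm; rewrite leNgt mr.
Qed.

Lemma cos_lipschitz (x y : R) : `|cos x - cos y| <= `|x - y|.
Proof.
wlog xy : x y / x <= y.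
  move=> h; have [/h//|yx] := leP x y.
  by rewrite distrC [leRHS]distrC; apply: h; exact: ltW.
have [c _ hc] := @MVT_segment R cos (fun t => - sin t) x y xy
  (fun t _ => is_derive_cos t) (continuous_subspaceT (@continuous_cos R)).
rewrite distrC hc normrM normrN [leRHS]distrC ler_piMl//.
by rewrite ler_norml sin_geN1 sin_le1.
Qed.

(** The integral of 1 / r is not bounded as [a] tends to 0; an error linear in r cancels this weight
    and leaves S / b on a segment of length at most b. *)
Lemma ucos_near p q (S a b : R) : 0 < a -> a <= b -> 0 <= S ->
  (forall r, a <= r <= b -> `|p.[r] - q.[r]| <= S * (r / b)) ->
  `|ucos p a b - ucos q a b| <= S.
Proof.
move=> a0 ab S0 h; have b0 := lt_le_trans a0 ab.
have cpq (r : R) : a <= r <= b -> {for r, continuous (fun r : R => cos p.[r] / r - cos q.[r] / r)}.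
  move=> /andP[ar _]; have r0 := lt_le_trans a0 ar.
  by apply: cvgB; apply: continuous_cos_poly_div.
rewrite /ucos -RintegralB; [|exact: measurable_itv|exact: ucos_integrable|exact: ucos_integrable].
apply: (le_trans (le_normr_Rintegral _ (continuous_itv_integrable cpq))).
  exact: measurable_itv.
rewrite -lee_fin EFin_Rintegral_ge0; last first.
  by move=> r hr; apply: cvg_norm; exact: cpq.
apply: (@le_trans _ _ (\int[mu]_(r in `[a, b]) (S / b)%:E)%E).
  apply: ge0_le_integral.
  - exact: measurable_itv.
  - by move=> r _; rewrite lee_fin.
  - apply/measurable_EFinP; apply: continuous_itv_measurable => r hr.
    by apply: cvg_norm; exact: cpq.
  - exact: measurable_cst.
  - move=> r; rewrite /= in_itv/= => hr; have /andP[ar _] := hr.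
    have r0 := lt_le_trans a0 ar.
    rewrite lee_fin -mulrBl normrM normfV (gtr0_norm r0) ler_pdivrMr//.
    apply: (le_trans (cos_lipschitz _ _)); apply: (le_trans (h r hr)).
    by rewrite mulrA mulrAC.
have muab : (mu `[a, b]%classic = (b - a)%:E)%E.
  rewrite lebesgue_measure_itv/= lte_fin; move: ab; rewrite le_eqVlt => /predU1P[<-|->//].
  by rewrite ltxx subrr.
rewrite integral_cst/=; last exact: measurable_itv.
by rewrite muab -EFinM lee_fin mulrAC ler_pdivrMr// ler_wpM2l// gerBl ltW.
Qed.

Lemma measurable_ucos d (T : measurableType d) (f : T -> {poly R}) (a b : R) : 0 < a ->
  measurable_fun setT (fun z : T * RR => (f z.1).[z.2]) ->
  measurable_fun setT (fun x => ucos (f x) a b).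
Proof.
move=> a0 mf.
(* Adding 1 to the cosine makes the integrand non-negative, as Tonelli requires; the integral of 1 /
   r is subtracted afterwards. *)
pose g (z : T * RR) : \bar R :=
  ((1 + cos (f z.1).[z.2]) * (z.2 `^ (-1) * \1_`[a, b]%classic z.2))%:E.
have g0 z : (0 <= g z)%E.
  rewrite lee_fin mulr_ge0//; last by rewrite mulr_ge0 ?powR_ge0.
have mg : measurable_fun setT g.
  apply/measurable_EFinP; apply: measurable_funM.
    apply: measurable_funD => //; apply: measurableT_comp mf.
    by apply: continuous_measurable_fun; exact: continuous_cos.
  apply: measurable_funM.
    exact: (measurableT_comp (measurable_powR _) measurable_snd).
  apply: (measurableT_comp _ measurable_snd); apply: measurable_indic; exact: measurable_itv.
have mF := @measurable_fun_fubini_tonelli_F _ _ _ _ _ mu _ mg g0.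
have -> : (fun x => ucos (f x) a b) =
    (fun x => fine (fubini_F mu g x) - \int[mu]_(r in `[a, b]) (r^-1)).
  apply/funext => x.
  have i1 : mu.-integrable `[a, b] (EFin \o (fun r : R => r^-1)).
    apply: continuous_itv_integrable => r /andP[ar _].
    by apply: cvgV; [rewrite gt_eqF// (lt_le_trans a0)|exact: cvg_id].
  apply/eqP; rewrite eq_sym subr_eq; apply/eqP.
  rewrite /ucos -RintegralD; [|exact: measurable_itv|exact: ucos_integrable|exact: i1].
  rewrite /Rintegral; congr fine; rewrite /fubini_F [RHS]integral_mkindic.
  apply: eq_integral => r _; rewrite /g/= -EFinM indicE; congr EFin.
  case: (boolP (r \in _)) => hr; last by rewrite !mulr0.
  have r0 : 0 < r by move: hr; rewrite inE/= in_itv/= => /andP[]/(lt_le_trans a0).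
  by rewrite !mulr1 powR_inv1 ?(ltW r0)// mulrDl mul1r addrC.
apply: measurable_funB => //; exact: (measurableT_comp (fine_measurable measurableT) mF).
Qed.

End radial_integral.

(** * Truncated integrals in polar coordinates *)

Section polar_truncation.
Variables (R : realType) (n : nat).
Hypothesis n0 : (0 < n)%N.
Local Notation mu := (@lebesgue_measure R).
Local Notation RR := (measurableTypeR R).
Local Notation leb := (lebesgue_Rn R n).
Local Notation sigma := (@sphere_measure R n).
Local Notation S := (@sphere R n).
Implicit Types (x : Rn R n) (w : Rn R n -> R) (a b : R).

Definition annulus a b : set (Rn R n) := [set x | a <= enorm x <= b].

Lemma measurable_annulus a b : measurable (annulus a b).
Proof.
rewrite (_ : annulus a b = @enorm R n @^-1` `[a, b]%classic).
  by rewrite -[X in measurable X]setTI; apply: measurable_enorm => //; exact: measurable_itv.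
by apply/seteqP; split => x /=; rewrite in_itv.
Qed.

Definition kern w x : R := w (normalize x) / enorm x ^+ n.

Lemma measurable_kern w : measurable_fun setT w -> measurable_fun setT (kern w).
Proof.
move=> mw; apply: measurable_funM.
  by apply: measurableT_comp => //; exact: measurable_normalize.
rewrite (_ : (fun x => _) = (fun x => (enorm x ^+ n) `^ (-1))).
  apply: (measurableT_comp (measurable_powR _)); apply: measurable_funX.
  exact: measurable_enorm.
by apply/funext => x; rewrite powR_inv1// exprn_ge0// enorm_ge0.
Qed.

Lemma ge0_polar_annulus (g w : Rn R n -> R) a b : 0 < a ->
  measurable_fun setT g -> (forall x, 0 <= g x) ->
  measurable_fun setT w -> (forall x, 0 <= w x) ->
  (\int[leb]_(x in annulus a b) (g x * kern w x)%:E =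
   \int[sigma]_(x in S) ((w x)%:E * \int[mu]_(r in `[a, b]) (g (scaleRn r x) / r)%:E))%E.
Proof.
move=> a0 mg g0 mw w0.
pose H x : \bar R := (g x * w (normalize x) * \1_(annulus a b) x)%:E.
have mH : measurable_fun setT H.
  apply/measurable_EFinP; apply: measurable_funM; last first.
    by apply: measurable_indic; exact: measurable_annulus.
  apply: measurable_funM => //; apply: measurableT_comp => //; exact: measurable_normalize.
have H0 x : (0 <= H x)%E by rewrite lee_fin !mulr_ge0.
transitivity (\int[leb]_(x in [set x | (0 < enorm x)%R]) (H x * (enorm x ^- n)%:E))%E.
  rewrite [LHS]integral_mkindic [RHS]integral_mkindic; apply: eq_integral => x _.
  rewrite /H -!EFinM; congr EFin; rewrite /kern !indicE.
  case: (boolP (x \in annulus a b)) => hx; last by rewrite !mulr0 !mul0r.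
  rewrite mem_set/=; first by rewrite !mulr1 mulrA.
  by move: hx; rewrite inE => /andP[ax _]; exact: lt_le_trans ax.
rewrite (ge0_polar n0 mH H0); apply: eq_integral => x; rewrite inE => Sx.
rewrite -ge0_integralZl; last 4 first.
- exact: measurable_itv.
- apply: (@eq_measurable_fun _ _ _ _ _ (fun r : RR => (g (scaleRn r x) * r `^ (-1))%:E)).
    move=> r; rewrite inE/= in_itv/= => /andP[ar _].
    by rewrite powR_inv1// (le_trans (ltW a0)).
  apply: measurable_funTS; apply/measurable_EFinP; apply: measurable_funM.
    apply: (measurableT_comp mg); exact: (measurable_fun_pair2 x (@measurable_scaleRn2 R n)).
  exact: measurable_powR.
- move=> r; rewrite /= in_itv/= => /andP[ar _].
  by rewrite lee_fin divr_ge0// (le_trans (ltW a0)).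
- by rewrite lee_fin.
rewrite [LHS]integral_mkindic [RHS]integral_mkindic; apply: eq_integral => r _.
rewrite /H -!EFinM; congr EFin.
have [r0|r0] := ltP 0 r; last first.
  rewrite !indicE [r \in `]0, +oo[%classic]memNset; last first.
    by rewrite /= in_itv/= andbT => /(le_lt_trans r0); rewrite ltxx.
  rewrite [r \in `[a, b]%classic]memNset ?mulr0//= in_itv/= => /andP[ar _].
  by have := lt_le_trans a0 ar; rewrite ltNge r0.
rewrite normalize_scaleRn// !indicE [r \in `]0, +oo[%classic]mem_set/=; last by rewrite in_itv/= r0.
have -> : (scaleRn r x \in annulus a b) = (r \in `[a, b]%classic).
  by apply/idP/idP; rewrite !inE /annulus/= in_itv/= enorm_scaleRn ?(ltW r0)// Sx mulr1.
by rewrite mulr1; ring.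
Qed.

Lemma measurable_pev_ray D (c : n.-tuple 'I_D.+1 -> R) :
  measurable_fun setT (fun z : Rn R n * RR => (ray c z.1).[z.2]).
Proof.
rewrite (_ : (fun z => _) = (fun z : Rn R n * RR => pev c (scaleRn z.2 z.1))).
  by apply: (measurableT_comp (measurable_pev c)); exact: measurable_scaleRn2.
by apply/funext => z; rewrite horner_ray.
Qed.

Definition uray D (c : n.-tuple 'I_D.+1 -> R) a b x : R := ucos (ray c x) a b.

Lemma measurable_uray D (c : n.-tuple 'I_D.+1 -> R) a b : 0 < a -> measurable_fun setT (uray c a b).
Proof. by move=> a0; apply: measurable_ucos => //; exact: measurable_pev_ray. Qed.

Definition Jray D w (c : n.-tuple 'I_D.+1 -> R) a b : R :=
  \int[sigma]_(x in S) (w x * uray c a b x).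

Lemma uray_le D (c : n.-tuple 'I_D.+1 -> R) a b x : 0 < a -> a <= b ->
  `|uray c a b x| <= ln b - ln a.
Proof. exact: ucos_le. Qed.

Lemma integrable_mul_bounded w (f : Rn R n -> R) (M : R) :
  measurable_fun setT w -> sigma.-integrable S (EFin \o w) ->
  measurable_fun setT f -> (forall x, S x -> `|f x| <= M) ->
  sigma.-integrable S (EFin \o (fun x => w x * f x)).
Proof.
move=> mw iw mf fM; have mS := @measurable_sphere R n.
have iwM : sigma.-integrable S (fun x => (M%:E * (EFin \o w) x)%E) by exact: integrableZl.
apply: le_integrable iwM => //.
  by apply/measurable_EFinP; apply: measurable_funTS; exact: measurable_funM.
move=> x Sx; rewrite /= lee_fin !normrM mulrC ler_wpM2r//.
by rewrite (le_trans (fM x Sx))// ler_norm.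
Qed.

Lemma Jray_integrable D w (c : n.-tuple 'I_D.+1 -> R) a b : 0 < a -> a <= b ->
  measurable_fun setT w -> sigma.-integrable S (EFin \o w) ->
  sigma.-integrable S (EFin \o (fun x => w x * uray c a b x)).
Proof.
move=> a0 ab mw iw; apply: (@integrable_mul_bounded _ _ (ln b - ln a)) => //.
- exact: measurable_uray.
- by move=> x _; exact: uray_le.
Qed.

(** Integrability on the annulus is deduced from the sphere, so that signed integrands can
    afterwards be treated as differences of non-negative ones. *)
Lemma polar_annulus (g w G : Rn R n -> R) a b : 0 < a ->
  measurable_fun setT g -> (forall x, 0 <= g x) ->
  measurable_fun setT w -> (forall x, 0 <= w x) ->
  (forall x, S x -> (\int[mu]_(r in `[a, b]) (g (scaleRn r x) / r)%:E = (G x)%:E)%E) ->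
  sigma.-integrable S (EFin \o (fun x => w x * G x)) ->
  leb.-integrable (annulus a b) (EFin \o (fun x => g x * kern w x)) /\
  \int[leb]_(x in annulus a b) (g x * kern w x) = \int[sigma]_(x in S) (w x * G x).
Proof.
move=> a0 mg g0 mw w0 hG iG.
have E : (\int[leb]_(x in annulus a b) (g x * kern w x)%:E =
    \int[sigma]_(x in S) (w x * G x)%:E)%E.
  rewrite ge0_polar_annulus//; apply: eq_integral => x; rewrite inE => Sx.
  by rewrite hG// EFinM.
have kern0 x : 0 <= kern w x by rewrite divr_ge0// exprn_ge0// enorm_ge0.
split; last by rewrite /Rintegral E.
apply/integrableP; split.
  apply/measurable_EFinP; apply: measurable_funTS; apply: measurable_funM => //.
  exact: measurable_kern.
rewrite (eq_integral (fun x => (g x * kern w x)%:E)); last first.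
  by move=> x _; rewrite /= ger0_norm// mulr_ge0.
rewrite E; have /integrableP[mwG] := iG; apply: le_lt_trans.
apply: ge0_le_integral.
- exact: measurable_sphere.
- move=> x Sx; rewrite EFinM -hG// mule_ge0 ?lee_fin//; apply: integral_ge0 => r.
  rewrite /= in_itv/= => /andP[ar _].
  by rewrite lee_fin divr_ge0// (le_trans (ltW a0)).
- exact: mwG.
- exact: measurableT_comp.
- by move=> x _; rewrite /= lee_fin ler_norm.
Qed.

Definition trunc_cos D w (c : n.-tuple 'I_D.+1 -> R) a b : R :=
  \int[leb]_(x in annulus a b) (cos (pev c x) * kern w x).

Lemma integral_cos_ray D (c : n.-tuple 'I_D.+1 -> R) a b x : 0 < a -> a < b ->
  (\int[mu]_(r in `[a, b]) ((1 + cos (pev c (scaleRn r x))) / r)%:E =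
   (ln b - ln a + uray c a b x)%:E)%E.
Proof.
move=> a0 ab; have i1 : mu.-integrable `[a, b] (EFin \o (fun r : R => r^-1)).
  apply: continuous_itv_integrable => r /andP[ar _].
  by apply: cvgV; [rewrite gt_eqF// (lt_le_trans a0)|exact: cvg_id].
have i2 := ucos_integrable (ray c x) b a0.
rewrite EFinD -integral_inv// /uray /ucos /Rintegral fineK; last first.
  by apply: integrable_fin_num => //; exact: measurable_itv.
rewrite -integralD//.
by apply: eq_integral => r _; rewrite /= -EFinD horner_ray mulrDl mul1r.
Qed.

(** cos = (1 + cos) - 1 is a difference of two non-negative functions, each covered by
    [polar_annulus]. *)
Lemma ge0_trunc_cos D w (c : n.-tuple 'I_D.+1 -> R) a b : 0 < a -> a < b ->
  measurable_fun setT w -> (forall x, 0 <= w x) -> sigma.-integrable S (EFin \o w) ->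
  leb.-integrable (annulus a b) (EFin \o (fun x => cos (pev c x) * kern w x)) /\
  trunc_cos w c a b = Jray w c a b.
Proof.
move=> a0 ab mw w0 iw; have mS := @measurable_sphere R n.
have mann := measurable_annulus a b.
have iu := Jray_integrable c a0 (ltW ab) mw iw.
have iL : sigma.-integrable S (EFin \o (fun x => w x * (ln b - ln a))).
  by apply: (@integrable_mul_bounded _ _ `|ln b - ln a|).
have iLu : sigma.-integrable S (EFin \o (fun x => w x * (ln b - ln a + uray c a b x))).
  rewrite (_ : _ \o _ = (EFin \o (fun x => w x * (ln b - ln a))) \+
    (EFin \o (fun x => w x * uray c a b x))).
    exact: integrableD.
  by apply/funext => x; rewrite /= -EFinD mulrDr.
have [i1 e1] := @polar_annulus (fun x => 1 + cos (pev c x)) w _ a b a0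
  ltac:(apply: measurable_funD => //; apply: measurableT_comp (measurable_pev c);
        exact: continuous_measurable_fun (@continuous_cos R))
  (fun x => ltac:(have := cos_geN1 (pev c x); lra)) mw w0
  (fun x _ => integral_cos_ray c x a0 ab) iLu.
have [i2 e2] := @polar_annulus (fun=> 1) w (fun=> ln b - ln a) a b a0
  (@measurable_cst _ _ _ _ _ _) (fun=> ler01) mw w0
  (fun x _ => ltac:(under eq_integral do rewrite mul1r; exact: integral_inv)) iL.
have E : (fun x => cos (pev c x) * kern w x) =
    (fun x => (1 + cos (pev c x)) * kern w x - 1 * kern w x).
  by apply/funext => x; ring.
split.
  rewrite E (_ : _ \o _ = ((EFin \o (fun x => (1 + cos (pev c x)) * kern w x)%R) \-
    (EFin \o (fun x => 1 * kern w x)%R))%E)//.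
  exact: integrableB.
rewrite /trunc_cos E RintegralB// e1 e2 -RintegralB// /Jray.
by apply: eq_Rintegral => x _; ring.
Qed.

Lemma trunc_cos_Jray D w (c : n.-tuple 'I_D.+1 -> R) a b : 0 < a -> a < b ->
  measurable_fun setT w -> sigma.-integrable S (EFin \o w) ->
  leb.-integrable (annulus a b) (EFin \o (fun x => cos (pev c x) * kern w x)) /\
  trunc_cos w c a b = Jray w c a b.
Proof.
move=> a0 ab mw iw; have mS := @measurable_sphere R n.
have mann := measurable_annulus a b.
pose wp x := Num.max (w x) 0; pose wn x := Num.max (- w x) 0.
have mwp : measurable_fun setT wp by exact: measurable_maxr.
have mwn : measurable_fun setT wn by apply: measurable_maxr => //; exact: measurableT_comp.
have wp0 x : 0 <= wp x by rewrite /wp le_max lexx orbT.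
have wn0 x : 0 <= wn x by rewrite /wn le_max lexx orbT.
have wE x : w x = wp x - wn x.
  rewrite /wp /wn; case: (leP (w x) 0) => h.
    by rewrite max_l ?oppr_ge0// sub0r opprK.
  by rewrite max_r ?subr0// oppr_le0 ltW.
have iwp : sigma.-integrable S (EFin \o wp).
  apply: le_integrable iw => //; first by apply/measurable_EFinP; exact: measurable_funTS.
  move=> x _; rewrite /= lee_fin ger0_norm//.
  by rewrite /wp ge_max ler_norm normr_ge0.
have iwn : sigma.-integrable S (EFin \o wn).
  apply: le_integrable iw => //; first by apply/measurable_EFinP; exact: measurable_funTS.
  move=> x _; rewrite /= lee_fin ger0_norm//.
  by rewrite /wn ge_max normr_ge0 andbT -normrN ler_norm.
have [i1 e1] := ge0_trunc_cos c a0 ab mwp wp0 iwp.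
have [i2 e2] := ge0_trunc_cos c a0 ab mwn wn0 iwn.
have E : (fun x => cos (pev c x) * kern w x) =
    (fun x => cos (pev c x) * kern wp x - cos (pev c x) * kern wn x).
  by apply/funext => x; rewrite /kern wE; ring.
split.
  rewrite E (_ : _ \o _ = ((EFin \o (fun x => cos (pev c x) * kern wp x)%R) \-
    (EFin \o (fun x => cos (pev c x) * kern wn x)%R))%E)//.
  exact: integrableB.
rewrite /trunc_cos E RintegralB//.
change (trunc_cos wp c a b - trunc_cos wn c a b = Jray w c a b).
have j1 := Jray_integrable c a0 (ltW ab) mwp iwp.
have j2 := Jray_integrable c a0 (ltW ab) mwn iwn.
rewrite e1 e2 /Jray -RintegralB//.
by apply: eq_Rintegral => x _; rewrite wE mulrBl.
Qed.

End polar_truncation.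

(** * The uniform bound *)

Section far_bound.
Variable R : realType.

Lemma logp_ge0 (s : R) : 0 <= logp s.
Proof. by rewrite /logp le_max lexx orbT. Qed.

(** For s > 1, apply exp v >= 1 + v to v = ln((1 + y) / s). For s <= 1, s ln(1 + y) <= ln(1 + y) <=
    1 + y. *)
Lemma young_log (s y : R) : 0 <= s -> 0 <= y -> s * ln (1 + y) <= s * logp s + (1 + y).
Proof.
move=> s0 y0; have y1 : 0 < 1 + y by rewrite ltr_pwDl.
have lny : ln (1 + y) <= 1 + y.
  have := expR_ge1Dx (ln (1 + y)); rewrite lnK ?posrE//; lra.
have lny0 : 0 <= ln (1 + y) by rewrite ln_ge0// lerDl.
have [s1|s1] := leP s 1.
  have h : s * ln (1 + y) <= ln (1 + y) by rewrite ler_piMl.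
  have := mulr_ge0 s0 (logp_ge0 s); lra.
have sp : 0 < s by rewrite (lt_trans ltr01).
have -> : logp s = ln s by rewrite /logp; apply/max_idPl; rewrite ln_ge0// ltW.
have := expR_ge1Dx (ln (1 + y) - ln s).
rewrite expRD expRN !lnK ?posrE// ler_pdivlMr// => h; nra.
Qed.

(** What [oscillatory_bound] yields for D = d: (1 + pi d) / d <= 1 + pi, and (d / j)^(1 / (2 d)) <=
    1 + d / j. *)
Definition far_cst (k0 : R) (d j : nat) : R :=
  1 + pi + k0 * (1 + d%:R / j%:R) * (dratio R d j / (1 - dratio R d j)).

Lemma dratio_lt1 d j : (0 < d)%N -> (0 < j)%N -> 0 < dratio R d j < 1.
Proof.
move=> d0 j0; rewrite /dratio powR_gt0//=.
rewrite /powR pnatr_eq0/= -[ltRHS]expR0 ltr_expR mulNr oppr_lt0.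
by rewrite mulr_gt0 ?ln_gt0 ?ltr1n// divr_gt0// ?mulr_gt0// ltr0n.
Qed.

Lemma far_cst_ge0 k0 d j : 0 <= k0 -> (0 < d)%N -> (0 < j)%N -> 0 <= far_cst k0 d j.
Proof.
move=> k00 d0 j0; have /andP[r0 r1] := dratio_lt1 d0 j0.
rewrite /far_cst; apply: addr_ge0; first by apply: addr_ge0 => //; exact: pi_ge0.
apply: mulr_ge0; first by rewrite mulr_ge0// addr_ge0// divr_ge0.
by rewrite divr_ge0 ?(ltW r0)// subr_ge0 ltW.
Qed.

(** For d <= 2 j the ratio of consecutive dyadic blocks is at most 2^(-1/4), away from 1, and 1 + d
    / j <= 3. Splitting the degrees at d / 2 secures exactly this. *)
Lemma far_cst_le k0 : 0 <= k0 -> exists2 K, 0 < K &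
  forall d j, (0 < d)%N -> (0 < j)%N -> (d <= 2 * j)%N -> far_cst k0 d j <= K.
Proof.
move=> k00; pose r := (2 : R) `^ (- (4^-1)).
have r0 : 0 < r by rewrite powR_gt0.
have r1 : r < 1.
  rewrite /r /powR pnatr_eq0/= -[ltRHS]expR0 ltr_expR mulNr oppr_lt0.
  by rewrite mulr_gt0 ?ln_gt0 ?ltr1n// invr_gt0.
have pi0 := @pi_ge0 R.
exists (1 + pi + k0 * 3 * (r / (1 - r))).
  have : 0 <= k0 * 3 * (r / (1 - r)).
    by rewrite !mulr_ge0 ?(ltW r0)// invr_ge0 subr_ge0 ltW.
  lra.
move=> d j d0 j0 dj; have /andP[q0 q1] := dratio_lt1 d0 j0.
have j0' : 0 < j%:R :> R by rewrite ltr0n.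
have d0' : 0 < d%:R :> R by rewrite ltr0n.
have dj' : d%:R <= 2 * j%:R :> R by rewrite -natrM ler_nat.
have qr : dratio R d j <= r.
  rewrite /dratio /r; apply: ler_powR; first by rewrite ler1n.
  by rewrite lerN2 ler_pdivlMr ?mulr_gt0//; lra.
rewrite /far_cst lerD2l; apply: ler_pM.
- by rewrite mulr_ge0// addr_ge0// divr_ge0// ltW.
- by rewrite divr_ge0// ?(ltW q0)// subr_ge0 ltW.
- rewrite ler_wpM2l//; suff : d%:R / j%:R <= 2 :> R by lra.
  by rewrite ler_pdivrMr.
- rewrite ler_pdivrMr ?subr_gt0// mulrAC ler_pdivlMr ?subr_gt0//; nra.
Qed.

(** Named so that the [k0] extracted from [uray_far] can be handed to the lemmas below. *)
Definition uray_far_bound (k0 : R) : Prop :=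
  forall n D d j (c : n.-tuple 'I_D.+1 -> R) (x : Rn R n) (a b : R),
  (0 < d)%N -> (0 < j)%N -> deg_le d c -> 0 < a -> a <= b ->
  1 <= `|pev (hom j c) x| * a ^+ j -> `|uray c a b x| <= far_cst k0 d j.

Lemma uray_far : exists2 k0 : R, 0 < k0 & uray_far_bound k0.
Proof.
have [k0 k00 hk] := oscillatory_bound R; exists k0 => // n D d j c x a b d0 j0 hc a0 ab pa.
have d0' : 0 < d%:R :> R by rewrite ltr0n.
have d1' : 1 <= d%:R :> R by rewrite ler1n.
have j0' : 0 < j%:R :> R by rewrite ltr0n.
move: ab; rewrite le_eqVlt => /predU1P[<-|ab].
  by rewrite /uray ucos_id normr0 far_cst_ge0// ltW.
have p0 : 0 < `|pev (hom j c) x|.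
  have : 0 < `|pev (hom j c) x| * a ^+ j by rewrite (lt_le_trans ltr01).
  by rewrite pmulr_lgt0// exprn_gt0.
have := hk (ray c x) d j d%:R a b d0 j0 (size_ray x hc) a0 ab d0'.
rewrite coef_ray => /(_ p0) h; apply: (le_trans h); rewrite /far_cst.
have /andP[q0 q1] := dratio_lt1 d0 j0.
apply: lerD.
  rewrite mulrDl mulfK ?gt_eqF// lerD2r mul1r invf_le1//.
rewrite ler_wpM2r ?divr_ge0 ?(ltW q0) ?subr_ge0 ?(ltW q1)// ler_wpM2l ?(ltW k00)//.
have dj0 : 0 <= d%:R / j%:R :> R by rewrite divr_ge0// ltW.
have be1 : (2 * d%:R)^-1 <= 1 :> R by rewrite invf_le1 ?mulr_gt0//; lra.
have be0 : 0 <= (2 * d%:R)^-1 :> R by rewrite invr_ge0 mulr_ge0// ltW.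
apply: (@le_trans _ _ ((1 + d%:R / j%:R) `^ (2 * d%:R)^-1)); last first.
  by rewrite -[leRHS]powRr1 ?addr_ge0//; apply: ler_powR => //; rewrite lerDl.
apply: ge0_ler_powR => //; rewrite ?nnegrE ?addr_ge0//.
  by rewrite divr_ge0 ?(ltW d0')// !mulr_ge0 ?(ltW j0')// exprn_ge0// ltW.
apply: (@le_trans _ _ (d%:R / j%:R)); last by rewrite lerDr.
rewrite ler_wpM2l ?(ltW d0')// lef_pV2 ?posrE ?mulr_gt0 ?exprn_gt0// -mulrA.
by rewrite ler_peMr// ltW.
Qed.

(* [0, +oo[ is cut where |P_j(x)| r^j = 1: beyond this radius the oscillatory
   estimate applies, and before it |u| is at most a difference of logarithms. *)
Lemma uray_far_log (k0 : R) n D d j (c : n.-tuple 'I_D.+1 -> R) (x : Rn R n) (a b : R) :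
  uray_far_bound k0 ->
  0 <= k0 -> (0 < d)%N -> (0 < j)%N -> deg_le d c -> 0 < a -> a <= b ->
  1 <= hom_norm j c * (2 * a) ^+ j -> 0 < `|pev (hom j c) x| ->
  `|uray c a b x| <= far_cst k0 d j + 1 +
     2 * ln (1 + hom_norm j c `^ (2 * j%:R)^-1 * `|pev (hom j c) x| `^ (- (2 * j%:R)^-1)).
Proof.
move=> hk k00 d0 j0 hc a0 ab Ma p0.
have j0' : 0 < j%:R :> R by rewrite ltr0n.
set p := `|_| in p0 *; set M := hom_norm j c in Ma *; set y := M `^ _ * _.
have K0 := far_cst_ge0 k00 d0 j0; set K := far_cst _ _ _ in K0 *.
have M0 : 0 < M.
  have : 0 < M * (2 * a) ^+ j by rewrite (lt_le_trans ltr01).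
  by rewrite pmulr_lgt0// exprn_gt0// mulr_gt0.
have y0 : 0 < y by rewrite mulr_gt0// powR_gt0.
have L0 : 0 <= ln (1 + y) by rewrite ln_ge0// lerDl ltW.
have [pa|pa] := leP 1 (p * a ^+ j).
  by have := hk n D d j c x a b d0 j0 hc a0 ab pa; rewrite -/K; lra.
pose A := p `^ (- j%:R^-1).
have A0 : 0 < A by rewrite powR_gt0.
have pA : p * A ^+ j = 1.
  rewrite -powR_mulrn ?(ltW A0)// /A -powRrM mulNr mulVf ?gt_eqF//.
  by rewrite powR_inv1 ?(ltW p0)// divff// gt_eqF.
have aA : a <= A.
  rewrite leNgt; apply/negP => Aa; move: pa; rewrite ltNge => /negP; apply.
  by rewrite -pA ler_wpM2l ?(ltW p0)// lerXn2r ?nnegrE ?(ltW A0) ?(ltW a0)// ltW.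
(* M (2 a)^j >= 1 reads - ln a <= (ln M) / j + ln 2, hence ln A - ln a <= (ln M - ln p) / j + ln 2 =
   2 ln y + ln 2. The 2 reflects the exponent 1 / (2 j) in [y]. *)
have lnA : ln A - ln a <= 1 + 2 * ln (1 + y).
  have h1 : ln y <= ln (1 + y) by rewrite ler_ln ?posrE ?addr_gt0// lerDr.
  have h2 : ln y = (2 * j%:R)^-1 * (ln M - ln p).
    by rewrite lnM ?posrE ?powR_gt0// !ln_powR; ring.
  have h3 : ln A = - j%:R^-1 * ln p by rewrite ln_powR.
  have h4 : 0 <= ln M + j%:R * (ln 2 + ln a).
    have := ln_ge0 Ma; rewrite lnM ?posrE ?exprn_gt0 ?mulr_gt0// lnXn ?mulr_gt0//.
    by rewrite lnM ?posrE// mulr_natl.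
  have h5 : ln 2 <= 1 :> R.
    have := @expR_ge1Dx R 1 => h; rewrite -[leRHS]expRK ler_ln ?posrE ?expR_gt0//; lra.
  have h6 : - ln a <= j%:R^-1 * ln M + ln 2.
    rewrite -(ler_pM2l j0') mulrDr mulrA divff ?gt_eqF// mul1r; lra.
  have h7 : 2 * ln y = j%:R^-1 * (ln M - ln p) by rewrite h2 invfM; field; rewrite gt_eqF.
  rewrite h3; lra.
have [Ab|bA] := leP A b.
  rewrite /uray (ucos_split _ a0 aA Ab).
  apply: (le_trans (ler_normD _ _)).
  have e1 := uray_le c x a0 aA.
  have e2 := hk n D d j c x A b d0 j0 hc A0 Ab ltac:(by rewrite -/p pA).
  rewrite /uray in e1 e2; rewrite -/K in e2; lra.
have e1 := uray_le c x a0 ab.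
have e3 : ln b <= ln A by rewrite ler_ln ?posrE ?(lt_le_trans a0)// ltW.
lra.
Qed.

(** In K + 3, the part K + 1 comes from [uray_far_log] and 2 from doubling s log^+ s in [young_log];
    the rest 2 (1 + y) splits into the constant 2 and the [psi] term. *)
Lemma uray_far_young (k0 : R) n D d j (c : n.-tuple 'I_D.+1 -> R) (x : Rn R n) (a b s : R) :
  uray_far_bound k0 ->
  0 <= k0 -> (0 < d)%N -> (0 < j)%N -> deg_le d c -> 0 < a -> a <= b ->
  1 <= hom_norm j c * (2 * a) ^+ j -> 0 <= s ->
  ((s * `|uray c a b x|)%:E <= ((far_cst k0 d j + 3) * (s * (1 + logp s)) + 2)%:E +
     2%:E * ((hom_norm j c `^ (2 * j%:R)^-1)%:E * psi (2 * j%:R)^-1 `|pev (hom j c) x|))%E.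
Proof.
move=> hk k00 d0 j0 hc a0 ab Ma s0.
have j0' : 0 < j%:R :> R by rewrite ltr0n.
have M0 : 0 < hom_norm j c.
  have : 0 < hom_norm j c * (2 * a) ^+ j by rewrite (lt_le_trans ltr01).
  by rewrite pmulr_lgt0// exprn_gt0// mulr_gt0.
(* Where P_j vanishes the right-hand side is +oo. *)
have [p0|p0] := eqVneq `|pev (hom j c) x| 0.
  rewrite p0 /psi eqxx [((_ `^ _)%:E * _)%E]gt0_muley ?lte_fin ?powR_gt0//.
  by rewrite gt0_muley ?lte_fin// addey// leey.
have p1 : 0 < `|pev (hom j c) x| by rewrite lt_neqAle eq_sym p0 normr_ge0.
have := uray_far_log hk k00 d0 j0 hc a0 ab Ma p1.
rewrite /psi (negbTE p0) -!EFinM -EFinD lee_fin.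
set y := hom_norm j c `^ _ * _; set K := far_cst _ _ _; set u := `|uray _ _ _ _| => hu.
have K0 : 0 <= K by exact: far_cst_ge0.
have y0 : 0 <= y by rewrite mulr_ge0// powR_ge0.
have hy := young_log s0 y0.
have hs : s * u <= s * (K + 1 + 2 * ln (1 + y)) by rewrite ler_wpM2l.
have l0 := mulr_ge0 s0 (logp_ge0 s).
have h : 0 <= K * (s * logp s) by rewrite mulr_ge0.
move: hs hy l0 h; rewrite !mulrDr !mulrDl; lra.
Qed.

End far_bound.

(** * Integration over the sphere and induction on the degree *)

Section uniform_bound.
Variable R : realType.
Local Notation sigma := (@sphere_measure R _).
Local Notation S := (@sphere R _).
Implicit Types (n D : nat) (a b : R).

Lemma le_abs_Rintegral d (T : measurableType d) (mu : {measure set T -> \bar R}) (D : set T)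
    (f : T -> R) : measurable D -> mu.-integrable D (EFin \o f) ->
  ((`|\int[mu]_(x in D) f x|)%:E <= \int[mu]_(x in D) (`|f x|)%:E)%E.
Proof.
move=> mD fi; rewrite /Rintegral -[X in `|fine X|]/(\int[mu]_(x in D) (EFin \o f) x)%E.
rewrite -abse_EFin fineK; last exact: integrable_fin_num.
exact: le_abse_integral (measurable_int _ fi).
Qed.

Definition LL n (w : Rn R n -> R) : \bar R :=
  (\int[sigma]_(x in S) (`|w x| * (1 + logp `|w x|))%:E)%E.

Lemma measurable_logp : measurable_fun setT (@logp R).
Proof. by apply: measurable_maxr => //; exact: measurable_ln. Qed.

Lemma measurable_LL n (w : Rn R n -> R) : measurable_fun setT w ->
  measurable_fun setT (fun x => `|w x| * (1 + logp `|w x|)).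
Proof.
move=> mw; have mn : measurable_fun setT (fun x => `|w x|) by exact: measurableT_comp.
apply: measurable_funM => //; apply: measurable_funD => //.
exact: measurableT_comp measurable_logp _.
Qed.

Lemma le_integral_LL n (w : Rn R n -> R) : measurable_fun setT w ->
  (\int[sigma]_(x in S) (`|w x|)%:E <= LL w)%E.
Proof.
move=> mw; apply: ge0_le_integral.
- exact: measurable_sphere.
- by move=> x _; rewrite lee_fin.
- by apply: measurable_funTS; apply/measurable_EFinP; exact: measurableT_comp.
- by apply: measurable_funTS; apply/measurable_EFinP; exact: measurable_LL.
- by move=> x _; rewrite lee_fin ler_peMr// lerDl logp_ge0.
Qed.

Lemma LL_integrable n (w : Rn R n -> R) : measurable_fun setT w -> (LL w < +oo)%E ->
  sigma.-integrable S (EFin \o w).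
Proof.
move=> mw wfin; apply/integrableP; split.
  by apply: measurable_funTS; exact/measurable_EFinP.
exact: le_lt_trans (le_integral_LL mw) wfin.
Qed.

(** The right-hand side of [uray_far_young] for s = |w x|. It serves twice: integrated, for the
    uniform bound, and as dominating function, for the tail at infinity. It is +oo where P_j
    vanishes, provided M_j > 0. *)
Definition far_majorant n D j (K : R) (c : n.-tuple 'I_D.+1 -> R) (w : Rn R n -> R)
    (x : Rn R n) : \bar R :=
  (K%:E * (`|w x| * (1 + logp `|w x|))%:E + 2%:E +
   2%:E * ((hom_norm j c `^ (2 * j%:R)^-1)%:E * psi (2 * j%:R)^-1 `|pev (hom j c) x|))%E.

Lemma LL_integrand_ge0 n (w : Rn R n -> R) x : 0 <= `|w x| * (1 + logp `|w x|).
Proof. by rewrite mulr_ge0// addr_ge0// logp_ge0. Qed.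

Lemma far_majorant_ge0 n D j (K : R) (c : n.-tuple 'I_D.+1 -> R) (w : Rn R n -> R) x :
  0 <= K -> (0 <= far_majorant j K c w x)%E.
Proof.
move=> K0; rewrite adde_ge0//.
  by rewrite adde_ge0// mule_ge0 ?lee_fin// LL_integrand_ge0.
by rewrite !mule_ge0 ?psi_ge0// lee_fin// powR_ge0.
Qed.

Lemma measurable_far_majorant n D j (K : R) (c : n.-tuple 'I_D.+1 -> R) (w : Rn R n -> R) :
  measurable_fun setT w -> measurable_fun setT (far_majorant j K c w).
Proof.
move=> mw; apply: emeasurable_funD; last first.
  apply: emeasurable_funM; first exact: measurable_cst.
  by apply: emeasurable_funM; [exact: measurable_cst|exact: measurable_psi_pev].
apply: emeasurable_funD; last exact: measurable_cst.
apply: emeasurable_funM; first exact: measurable_cst.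
by apply/measurable_EFinP; exact: measurable_LL.
Qed.

Lemma integral_far_majorant : exists2 C : R, 0 < C &
  forall n D j (K : R) (c : n.-tuple 'I_D.+1 -> R) (w : Rn R n -> R) (N : R),
  (0 < n)%N -> (0 < j)%N -> 0 < hom_norm j c -> 0 <= K ->
  measurable_fun setT w -> (LL w <= N%:E)%E ->
  (\int[sigma]_(x in S) far_majorant j K c w x <= (K * N + C)%:E)%E.
Proof.
have [C1 C10 hC1] := sphere_psi_integral R; have [C2 C20 hC2] := sphere_measure_bounded R.
exists (2 * C1 + 2 * C2); first by rewrite addr_gt0// mulr_gt0.
move=> n D j K c w N n0 j0 M0 K0 mw wN; have mS := @measurable_sphere R n.
have mu1 : measurable_fun S (fun x => (`|w x| * (1 + logp `|w x|))%:E).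
  by apply: measurable_funTS; apply/measurable_EFinP; exact: measurable_LL.
have mu2 : measurable_fun S (fun x : Rn R n =>
    ((hom_norm j c `^ (2 * j%:R)^-1)%:E * psi (2 * j%:R)^-1 `|pev (hom j c) x|)%E).
  apply: measurable_funTS.
  by apply: emeasurable_funM; [exact: measurable_cst|exact: measurable_psi_pev].
have ge1 x : (0 <= (`|w x| * (1 + logp `|w x|))%:E)%E by rewrite lee_fin LL_integrand_ge0.
have ge2 (x : Rn R n) :
    (0 <= (hom_norm j c `^ (2 * j%:R)^-1)%:E * psi (2 * j%:R)^-1 `|pev (hom j c) x|)%E.
  by rewrite mule_ge0 ?psi_ge0// lee_fin powR_ge0.
rewrite ge0_integralD//; last 4 first.
- by move=> x _; rewrite adde_ge0// mule_ge0.
- apply: emeasurable_funD; last exact: measurable_cst.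
  by apply: emeasurable_funM; [exact: measurable_cst|exact: mu1].
- by move=> x _; rewrite mule_ge0.
- by apply: emeasurable_funM; [exact: measurable_cst|exact: mu2].
rewrite ge0_integralD//; last 2 first.
- by move=> x _; rewrite mule_ge0.
- by apply: emeasurable_funM; [exact: measurable_cst|exact: mu1].
rewrite ge0_integralZl// ge0_integralZl// integral_cst//.
have e1 : (K%:E * LL w <= (K * N)%:E)%E by rewrite EFinM lee_wpmul2l.
have e2 : ((2 : R)%:E * @sphere_measure R n S <= (2 * C2)%:E)%E.
  by rewrite EFinM; apply: lee_wpmul2l; rewrite ?hC2// lee_fin.
have e3 := hC1 n D j c n0 j0 M0.
apply: le_trans (leeD (leeD e1 e2) (lee_wpmul2l _ e3)) _ => //.
by rewrite -EFinM -!EFinD lee_fin -addrA lerD2l addrC.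
Qed.

Lemma uray_far_majorant (k0 K : R) n D d j (c : n.-tuple 'I_D.+1 -> R)
    (w : Rn R n -> R) (x : Rn R n) a b :
  uray_far_bound k0 ->
  0 <= k0 -> far_cst k0 d j <= K -> (0 < d)%N -> (0 < j)%N -> deg_le d c -> 0 < a -> a <= b ->
  1 <= hom_norm j c * (2 * a) ^+ j ->
  ((`|w x * uray c a b x|)%:E <= far_majorant j (K + 3) c w x)%E.
Proof.
move=> hk k00 hK d0 j0 hc a0 ab Ma.
have := uray_far_young x hk k00 d0 j0 hc a0 ab Ma (normr_ge0 (w x)).
rewrite normrM => h; apply: (le_trans h); apply: leeD2r.
rewrite -EFinM -EFinD lee_fin lerD2r ler_wpM2r ?LL_integrand_ge0//.
by rewrite lerD2r.
Qed.

Lemma Jray_far : exists2 C : R, 0 < C &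
  forall n D d j (c : n.-tuple 'I_D.+1 -> R) (w : Rn R n -> R) a b (N : R), (0 < n)%N ->
  measurable_fun setT w -> (LL w <= N%:E)%E ->
  (0 < d)%N -> (0 < j)%N -> (d <= 2 * j)%N -> deg_le d c -> 0 < a -> a <= b ->
  1 <= hom_norm j c * (2 * a) ^+ j -> `|Jray w c a b| <= C * (N + 1).
Proof.
have [k0 k00 hk] := uray_far R; have [K K0 hK] := far_cst_le (ltW k00).
have [C1 C10 hC1] := integral_far_majorant.
exists (K + 3 + C1); first by rewrite !addr_gt0.
move=> n D d j c w a b N n0 mw wN d0 j0 dj hc a0 ab Ma.
have iw := LL_integrable mw (le_lt_trans wN (ltry _)).
have mS := @measurable_sphere R n.
have M0 : 0 < hom_norm j c.
  have : 0 < hom_norm j c * (2 * a) ^+ j by rewrite (lt_le_trans ltr01).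
  by rewrite pmulr_lgt0// exprn_gt0// mulr_gt0.
have K30 : 0 <= K + 3 by rewrite addr_ge0// ltW.
have N0 : 0 <= N.
  rewrite -lee_fin; apply: le_trans wN; apply: integral_ge0 => x _.
  by rewrite lee_fin LL_integrand_ge0.
rewrite -lee_fin; apply: (le_trans (le_abs_Rintegral mS (Jray_integrable c a0 ab mw iw))).
apply: (@le_trans _ _ ((K + 3) * N + C1)%:E).
  apply: le_trans (hC1 n D j _ c w N n0 j0 M0 K30 mw wN).
  apply: ge0_le_integral.
  - exact: mS.
  - by move=> x _; rewrite lee_fin.
  - apply: measurable_funTS; apply/measurable_EFinP; apply: measurableT_comp => //.
    by apply: measurable_funM => //; exact: measurable_uray.
  - exact: measurable_funTS (measurable_far_majorant j _ c mw).
  - move=> x _; apply: (uray_far_majorant (d := d) w x hk (ltW k00)) => //; exact: hK.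
rewrite lee_fin mulrDr mulr1 [in leRHS]mulrDl.
by have := mulr_ge0 (ltW C10) N0; move: K0; rewrite -!addrA lerD2l; lra.
Qed.

Lemma Jray_near n D (w : Rn R n -> R) (c c' : n.-tuple 'I_D.+1 -> R) a b (N M : R) :
  measurable_fun setT w -> (LL w <= N%:E)%E -> 0 < a -> a <= b -> 0 <= M ->
  (forall x, S x -> `|uray c a b x - uray c' a b x| <= M) ->
  `|Jray w c a b - Jray w c' a b| <= M * N.
Proof.
move=> mw wN a0 ab M0 h; have mS := @measurable_sphere R n.
have iw := LL_integrable mw (le_lt_trans wN (ltry _)).
have i1 := Jray_integrable c a0 ab mw iw.
have i2 := Jray_integrable c' a0 ab mw iw.
rewrite /Jray -RintegralB// -lee_fin.
apply: (le_trans (le_abs_Rintegral mS _)).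
  by have := integrableB mS i1 i2; apply: eq_integrable => // x _; rewrite /= EFinB.
have wN' : (M%:E * \int[sigma]_(x in S) (`|w x|)%:E <= (M * N)%:E)%E.
  by rewrite EFinM lee_wpmul2l// (le_trans (le_integral_LL mw)).
apply: le_trans wN'; rewrite -ge0_integralZl//; last first.
  by apply: measurable_funTS; apply/measurable_EFinP; exact: measurableT_comp.
apply: ge0_le_integral => //.
- apply: measurable_funTS; apply/measurable_EFinP; apply: measurableT_comp => //.
  by apply: measurable_funB; apply: measurable_funM => //; exact: measurable_uray.
- apply: emeasurable_funM; first exact: measurable_cst.
  by apply: measurable_funTS; apply/measurable_EFinP; exact: measurableT_comp.
- by move=> x Sx; rewrite -mulrBr normrM -EFinM lee_fin mulrC ler_wpM2r// h.
Qed.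

Lemma Jray_split n D (w : Rn R n -> R) (c : n.-tuple 'I_D.+1 -> R) a m b :
  measurable_fun setT w -> sigma.-integrable S (EFin \o w) ->
  0 < a -> a <= m -> m <= b -> Jray w c a b = Jray w c a m + Jray w c m b.
Proof.
move=> mw iw a0 am mb; have mS := @measurable_sphere R n.
rewrite /Jray -RintegralD//; last 2 first.
- exact: Jray_integrable.
- by apply: Jray_integrable => //; exact: lt_le_trans am.
by apply: eq_Rintegral => x _; rewrite -mulrDr /uray -ucos_split.
Qed.

Lemma uray_deg0 n D (c : n.-tuple 'I_D.+1 -> R) a b (x y : Rn R n) : deg_le 0 c ->
  uray c a b x = uray c a b y.
Proof.
move=> hc; rewrite /uray; congr ucos; apply: eq_bigr => al _.
have [->|/hc wal] := eqVneq (c al) 0; first by rewrite !mul0r.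
suff mon1 (z : Rn R n) : mon al z = 1 by rewrite !mon1.
apply: big1 => i _; suff -> : tnth al i = 0%N :> nat by [].
by apply/eqP; rewrite -leqn0; exact: leq_trans (leq_tnth_wt al i) wal.
Qed.

Lemma Jray_deg0 n D (w : Rn R n -> R) (c : n.-tuple 'I_D.+1 -> R) a b :
  sigma.-integrable S (EFin \o w) -> \int[sigma]_(x in S) w x = 0 ->
  deg_le 0 c -> Jray w c a b = 0.
Proof.
move=> iw w0 hc; pose x0 : Rn R n := [tuple 0 | i < n].
rewrite /Jray (@eq_Rintegral _ _ _ _ _ (fun x => w x * uray c a b x0)); last first.
  by move=> x _; rewrite (uray_deg0 a b x x0 hc).
by rewrite RintegralZr//; [rewrite w0 mul0r|exact: measurable_sphere].
Qed.

Definition lowpart n D (d : nat) (c : n.-tuple 'I_D.+1 -> R) (al : n.-tuple 'I_D.+1) : R :=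
  if (wt al <= d)%N then c al else 0.

Lemma deg_le_lowpart n D (d : nat) (c : n.-tuple 'I_D.+1 -> R) : deg_le d (lowpart d c).
Proof. by move=> al; rewrite /lowpart; case: leqP => //; rewrite eqxx. Qed.

Lemma mon_sphere_le n D (al : n.-tuple 'I_D.+1) (x : Rn R n) : S x -> `|mon al x| <= 1.
Proof.
move=> Sx; have xx : \sum_(i < n) tnth x i ^+ 2 = 1.
  by rewrite -[RHS](expr1n _ 2) -Sx sqr_sqrtr// sumr_ge0// => i _; exact: sqr_ge0.
rewrite /mon normr_prod prodr_ile1// => i _; rewrite normr_ge0/= normrX exprn_ile1//.
rewrite -(@expr_le1 _ 2)// real_normK ?num_real// -xx (bigD1 i)//= lerDl sumr_ge0// => k _.
exact: sqr_ge0.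
Qed.

(** On the sphere the part of degree j contributes at most M_j r^j <= 2^-j (r / b)^j <= 2^-j (r /
    b), as j >= 1. The sum over j is at most r / b, linear in r as [ucos_near] wants. *)
Lemma ray_lowpart_near n D (d d' : nat) (c : n.-tuple 'I_D.+1 -> R) (x : Rn R n) (r b : R) :
  S x -> deg_le d c -> 0 <= r -> r <= b -> 0 < b ->
  (forall j, (d' < j)%N -> (j <= d)%N -> hom_norm j c * b ^+ j <= (2^-1) ^+ j) ->
  `|(ray c x).[r] - (ray (lowpart d' c) x).[r]| <= r / b.
Proof.
move=> Sx hc r0 rb b0 hb; have rb0 : 0 <= r / b by rewrite divr_ge0// ltW.
have rb1 : r / b <= 1 by rewrite ler_pdivrMr// mul1r.
rewrite !horner_ray /pev -sumrB.
apply: (le_trans (ler_norm_sum _ _ _)).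
apply: (@le_trans _ _ (\sum_al \sum_(j < d.+1 | (d' < j)%N) `|hom j c al| * r ^+ j)).
  apply: ler_sum => al _; rewrite -mulrBl mon_scaleRn normrM normrM (ger0_norm (exprn_ge0 _ r0)).
  have sum0 (P : pred 'I_d.+1) : 0 <= \sum_(j < d.+1 | P j) `|hom j c al| * r ^+ j.
    by apply: sumr_ge0 => j _; rewrite mulr_ge0// exprn_ge0.
  rewrite /lowpart; case: leqP => wal; first by rewrite subrr normr0 mul0r.
  rewrite subr0; have [->|c0] := eqVneq (c al) 0; first by rewrite normr0 mul0r.
  have wd : (wt al < d.+1)%N by rewrite ltnS hc.
  rewrite (bigD1 (Ordinal wd))//= /hom eqxx; apply: ler_wpDr; first exact: sum0.
  by rewrite mulrA ler_piMr ?mulr_ge0 ?exprn_ge0// mon_sphere_le.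
rewrite exchange_big/=.
apply: (@le_trans _ _ (\sum_(j < d.+1 | (d' < j)%N) (2^-1) ^+ j * (r / b))).
  apply: ler_sum => j dj; rewrite -mulr_suml.
  have jd : (j <= d)%N by rewrite -ltnS.
  have -> : r ^+ j = b ^+ j * (r / b) ^+ j by rewrite -exprMn mulrCA divff ?mulr1// gt_eqF.
  rewrite mulrA; apply: ler_pM; rewrite ?exprn_ge0//.
    by rewrite mulr_ge0 ?exprn_ge0 ?(ltW b0)// sumr_ge0.
  - exact: hb.
  - by rewrite -[leRHS]expr1 ler_wiXn2l// (leq_ltn_trans (leq0n d')).
rewrite -mulr_suml ler_piMl//.
have := @geometric_sum_le R 2^-1 d ltac:(by rewrite invr_gt0) ltac:(by rewrite invf_lt1 ?ltr1n).
rewrite (_ : 2^-1 / (1 - 2^-1) = 1); last by field.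
apply: le_trans; rewrite big_mkcond big_ord_recl/= add0r big_mkord ler_sum// => i _.
by case: ifP => // _; rewrite exprn_ge0.
Qed.

(* lam is the largest radius at which every homogeneous part of degree j in ]d', d]
   has size at most 1; there is none when these parts all vanish. *)
Lemma homogeneous_scale n D (d d' : nat) (c : n.-tuple 'I_D.+1 -> R) : deg_le d c ->
  deg_le d' c \/ exists lam : R, exists j0 : nat,
  [/\ 0 < lam, (d' < j0 <= d)%N, hom_norm j0 c * lam ^+ j0 = 1 &
      forall j, (d' < j)%N -> (j <= d)%N -> hom_norm j c * lam ^+ j <= 1].
Proof.
move=> hc; pose P (j : 'I_d.+1) := (d' < j)%N && (0 < hom_norm j c).
(* The radius at which the part of degree j has size 1; lam is the smallest of these. *)
pose F (j : 'I_d.+1) := hom_norm j c `^ (- j%:R^-1).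
have hn0 j : 0 <= hom_norm j c by exact: sumr_ge0.
have FX (j : 'I_d.+1) : P j -> hom_norm j c * F j ^+ j = 1.
  move=> /andP[d'j h0]; have j0 : j%:R != 0 :> R by rewrite pnatr_eq0 -lt0n (leq_trans _ d'j).
  rewrite -powR_mulrn ?powR_ge0// /F -powRrM mulNr mulVf// powR_inv1// divff// gt_eqF//.
case: (pickP P) => [j1 Pj1|P0]; last first.
  left=> al cal; rewrite leqNgt; apply/negP => d'al.
  have wd : (wt al < d.+1)%N by rewrite ltnS hc.
  have := P0 (Ordinal wd); rewrite /P/= d'al/= => /negP; apply.
  rewrite lt0r hn0 andbT psumr_neq0//; apply/hasP; exists al; first by rewrite mem_index_enum.
  by rewrite /hom eqxx normr_gt0.
right; have [j0 Pj0 hj0] := @Order.TotalTheory.arg_minP _ _ _ j1 P F Pj1.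
have /andP[d'j0 h0] := Pj0.
have F0 : 0 < F j0 by rewrite powR_gt0.
exists (F j0), j0; split => //.
- by rewrite d'j0 -ltnS ltn_ord.
- exact: FX.
move=> j d'j jd; have jd' : (j < d.+1)%N by rewrite ltnS.
have := hn0 j; rewrite le_eqVlt => /predU1P[<-|hj]; first by rewrite mul0r.
have Pj : P (Ordinal jd') by rewrite /P/= d'j hj.
rewrite -(FX _ Pj)/= ler_wpM2l// lerXn2r ?nnegrE ?powR_ge0//.
exact: hj0.
Qed.

(* Strong induction on d: on ]0, lam / 2] the parts of degree > d / 2 are negligible,
   on [lam / 2, +oo[ one of them makes the phase oscillate.  Each halving of d costs
   a constant, whence log2 d. *)
Lemma Jray_bound : exists2 C : R, 0 < C &
  forall n D (w : Rn R n -> R) (N : R), (0 < n)%N -> measurable_fun setT w -> (LL w <= N%:E)%E ->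
  \int[sigma]_(x in S) w x = 0 ->
  forall d (c : n.-tuple 'I_D.+1 -> R) a b, (0 < d)%N -> deg_le d c -> 0 < a -> a <= b ->
  `|Jray w c a b| <= C * (N + 1) * (1 + ln d%:R / ln 2).
Proof.
have [C C0 hC] := Jray_far; exists (C + 1); first by rewrite addr_gt0.
move=> n D w N n0 mw wN w0 d.
have iw := LL_integrable mw (le_lt_trans wN (ltry _)).
have N0 : 0 <= N.
  rewrite -lee_fin; apply: le_trans wN; apply: integral_ge0 => x _.
  by rewrite lee_fin mulr_ge0// addr_ge0// logp_ge0.
have N1 : 0 <= (C + 1) * (N + 1) by rewrite mulr_ge0// addr_ge0// ltW.
have ln2 : 0 < ln 2 :> R by rewrite ln_gt0// ltr1n.
elim/ltn_ind: d => d ih c a b d0 hc a0 ab.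
have lnd : 0 <= ln d%:R / ln 2 :> R by rewrite divr_ge0 ?(ltW ln2)// ln_ge0// ler1n.
have [d'd dd] : (d./2 < d)%N /\ (2 * d./2 <= d)%N by clear -d0; lia.
(* Halving lowers log2 by at least one, so 1 + log2(d / 2) <= log2 d and the constant 1 is freed for
   the present step. When the half is 0, the phase is constant and the integral vanishes. *)
have ih' (c' : n.-tuple 'I_D.+1 -> R) a' b' : deg_le d./2 c' -> 0 < a' -> a' <= b' ->
    `|Jray w c' a' b'| <= (C + 1) * (N + 1) * (ln d%:R / ln 2).
  move=> hc' a'0 ab'; have [d'0|d'0] := posnP d./2.
    move: hc'; rewrite d'0 => hc'.
    by rewrite (Jray_deg0 _ _ iw w0 hc') normr0 mulr_ge0.
  apply: (le_trans (ih _ d'd c' a' b' d'0 hc' a'0 ab')); rewrite ler_wpM2l//.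
  rewrite -(ler_pM2r ln2) mulrDl mul1r !divfK ?gt_eqF//.
  have dd2 : 2 * d./2%:R <= d%:R :> R by rewrite -natrM ler_nat.
  by rewrite -lnM ?posrE ?ltr0n// ler_ln// posrE ?mulr_gt0// ltr0n.
have [hc'|[lam [j0 [lam0 /andP[dj0 j0d] hj0 hlam]]]] := homogeneous_scale d./2 hc.
  by apply: (le_trans (ih' _ _ _ hc' a0 ab)); rewrite ler_wpM2l// lerDr.
(* At half the scale M_j l^j <= 2^-j, which makes the sum over j geometric, while [far] still has
   M_j0 (2 u)^j0 >= 1 because 2 u >= lam. *)
pose l := lam / 2; have l0 : 0 < l by rewrite divr_gt0.
have near u v : 0 < u -> u <= v -> v <= l ->
    `|Jray w c u v| <= (C + 1) * (N + 1) * (ln d%:R / ln 2) + N.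
  move=> u0 uv vl; have v0 := lt_le_trans u0 uv.
  have := @Jray_near n D w c (lowpart d./2 c) u v N 1 mw wN u0 uv ler01.
  have ihl := ih' _ _ _ (@deg_le_lowpart n D d./2 c) u0 uv.
  have P x : S x -> `|uray c u v x - uray (lowpart d./2 c) u v x| <= 1.
    move=> Sx; apply: ucos_near => // r /andP[ur rv]; rewrite mul1r.
    apply: (ray_lowpart_near Sx hc) => //; first by rewrite (le_trans (ltW u0)).
    move=> j dj jd; apply: (@le_trans _ _ (hom_norm j c * l ^+ j)).
      by rewrite ler_wpM2l ?sumr_ge0// lerXn2r ?nnegrE ?(ltW v0) ?(ltW l0).
    by rewrite /l exprMn mulrA ler_piMl ?exprn_ge0// hlam.
  rewrite mul1r => /(_ P) h; apply: le_trans (lerD ihl h); rewrite addrC.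
  have := ler_normD (Jray w c u v - Jray w (lowpart d./2 c) u v)
    (Jray w (lowpart d./2 c) u v).
  by rewrite subrK.
have far u v : 0 < u -> u <= v -> l <= u -> `|Jray w c u v| <= C * (N + 1).
  move=> u0 uv lu; apply: (hC n D d j0 c w u v N n0 mw wN d0 _ _ hc u0 uv).
  - by rewrite (leq_trans _ dj0).
  - by clear -dj0; lia.
  - rewrite -[leLHS]hj0 ler_wpM2l ?sumr_ge0// lerXn2r ?nnegrE ?(ltW lam0)//.
      by rewrite mulr_ge0// ltW.
    by move: lu; rewrite /l ler_pdivrMr// mulrC.
have CN : 0 <= C * (N + 1) by rewrite mulr_ge0 ?addr_ge0// ltW.
have [bl|lb] := leP b l.
  apply: (le_trans (near _ _ a0 ab bl)); lra.
have [la|al] := leP l a.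
  have := mulr_ge0 N1 lnd; have := far _ _ a0 ab la; lra.
rewrite (Jray_split c mw iw a0 (ltW al) (ltW lb)).
have h1 := near _ _ a0 (ltW al) (lexx _).
have h2 := far _ _ l0 (ltW lb) (lexx _).
apply: (le_trans (ler_normD _ _)); apply: (le_trans (lerD h1 h2)).
by rewrite [leRHS]mulrDr mulr1 [leRHS]addrC -addrA lerD2l mulrDl mul1r [leLHS]addrC lerD2l lerDl.
Qed.

End uniform_bound.

(** * Existence of the principal value *)

Section principal_value.
Variables (R : realType) (n : nat).
Hypothesis n0 : (0 < n)%N.
Local Notation sigma := (@sphere_measure R n).
Local Notation S := (@sphere R n).
Implicit Types (D d : nat) (a b : R) (x : Rn R n).

Lemma uray_tail D d j (c : n.-tuple 'I_D.+1 -> R) x (e : R) :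
  (0 < d)%N -> (0 < j)%N -> deg_le d c -> pev (hom j c) x != 0 -> 0 < e ->
  exists2 A : R, 0 < A & forall a b, A <= a -> a <= b -> `|uray c a b x| <= e.
Proof.
move=> d0 j0 hc p0 e0; have [k0 k00 hk] := oscillatory_bound R.
have d0' : 0 < d%:R :> R by rewrite ltr0n.
have j0' : 0 < j%:R :> R by rewrite ltr0n.
have /andP[q0 q1] := dratio_lt1 R d0 j0.
set G := k0 * (dratio R d j / (1 - dratio R d j)).
have G0 : 0 <= G by rewrite mulr_ge0 ?(ltW k00)// divr_ge0 ?(ltW q0)// subr_ge0 ltW.
have pd : 0 < 1 + pi * d%:R :> R by rewrite addr_gt0// mulr_gt0// pi_gt0.
pose De := (1 + pi * d%:R) / (e / 2); have De0 : 0 < De by rewrite !divr_gt0.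
pose eta := e / 2 / (G + 1).
have eta0 : 0 < eta by rewrite !divr_gt0// ltr_wpDl.
have p1 : 0 < `|pev (hom j c) x| by rewrite normr_gt0.
pose B := De / (j%:R * `|pev (hom j c) x| * eta ^+ (2 * d)).
exists (Num.max 1 B); first by rewrite lt_max ltr01.
move=> a b; rewrite ge_max => /andP[a1 aB] ab.
have a0 : 0 < a by rewrite (lt_le_trans ltr01).
move: ab; rewrite le_eqVlt => /predU1P[<-|ab]; first by rewrite /uray ucos_id normr0 ltW.
have := hk (ray c x) d j De a b d0 j0 (size_ray x hc) a0 ab De0.
rewrite coef_ray => /(_ p1) h; apply: (le_trans h).
have -> : e = e / 2 + e / 2 by rewrite -splitr.
apply: lerD; first by rewrite /De invfM mulrA divff ?gt_eqF// mul1r invrK.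
rewrite mulrAC -/G; apply: (@le_trans _ _ (G * eta)); last first.
  rewrite /eta mulrA ler_pdivrMr ?ltr_wpDl// mulrC ler_wpM2l ?lerDl//.
  by rewrite ltW// divr_gt0.
apply: ler_wpM2l => //.
have -> : eta = (eta ^+ (2 * d)) `^ (2 * d%:R)^-1.
  rewrite -powR_mulrn ?(ltW eta0)// -powRrM natrM mulfV ?mulf_neq0 ?pnatr_eq0 -?lt0n//.
  by rewrite powRr1// ltW.
have jp0 : 0 < j%:R * `|pev (hom j c) x| * a ^+ j by rewrite !mulr_gt0// exprn_gt0.
apply: ge0_ler_powR.
- by rewrite invr_ge0 mulr_ge0// ltW.
- by rewrite nnegrE divr_ge0// ltW.
- by rewrite nnegrE exprn_ge0// ltW.
have ha : B <= a ^+ j by rewrite (le_trans aB)// -[leLHS]expr1 ler_weXn2l.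
rewrite ler_pdivrMr// mulrC mulrAC -ler_pdivrMl; last by rewrite !mulr_gt0// exprn_gt0.
by rewrite mulrC.
Qed.

Variable w : Rn R n -> R.
Hypotheses (mw : measurable_fun setT w) (wfin : (LL w < +oo)%E).
Hypothesis w0 : \int[sigma]_(x in S) w x = 0.

Let iw : sigma.-integrable S (EFin \o w). Proof. exact: LL_integrable. Qed.

Let mS : measurable S. Proof. exact: measurable_sphere. Qed.

Let LL_fineK : (LL w = (fine (LL w))%:E)%E.
Proof.
rewrite fineK// ge0_fin_numE//; apply: integral_ge0 => x _.
by rewrite lee_fin LL_integrand_ge0.
Qed.

(* Otherwise some intervals [a_k, b_k] with a_k --> +oo carry integrals bounded away
   from 0, contradicting dominated convergence: the majorant is integrable, and its
   finiteness excludes the null set where P_j vanishes. *)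
Lemma Jray_tail D d (c : n.-tuple 'I_D.+1 -> R) (e : R) :
  (0 < d)%N -> deg_le d c -> 0 < e ->
  exists2 A : R, 0 < A & forall a b, A <= a -> a <= b -> `|Jray w c a b| <= e.
Proof.
move=> d0 hc e0.
have [hc'|[lam [j [lam0 /andP[j0 jd] hj _]]]] := homogeneous_scale 0 hc.
  by exists 1 => // a b _ _; rewrite Jray_deg0// normr0 ltW.
apply: contrapT => hn.
(* The summand k drives the intervals to infinity; adding lam ensures M_j (2 a)^j >= 1, hence one
   majorant for all k. *)
have hk (k : nat) : exists ab : R * R,
    [/\ k%:R + lam <= ab.1, ab.1 <= ab.2 & e < `|Jray w c ab.1 ab.2|].
  apply: contrapT => hk; apply: hn; exists (k%:R + lam); first by rewrite ltr_wpDl.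
  move=> a b ka ab; rewrite leNgt; apply/negP => he; apply: hk.
  by exists (a, b); split.
have [ab hab] := choice hk.
have a0 k : 0 < (ab k).1 by have [h _ _] := hab k; apply: lt_le_trans h; rewrite ltr_wpDl.
have abk k : (ab k).1 <= (ab k).2 by have [_ h _] := hab k.
pose f k x := (w x * uray c (ab k).1 (ab k).2 x)%:E.
have [k0 k00 hk0] := uray_far R.
pose K := far_cst k0 d j + 3.
have K0 : 0 <= K by rewrite addr_ge0// far_cst_ge0// ltW.
have M0 : 0 < hom_norm j c.
  have : 0 < hom_norm j c * lam ^+ j by rewrite hj.
  by rewrite pmulr_lgt0// exprn_gt0.
have [C C0 hC] := integral_far_majorant R.
have ig : sigma.-integrable S (far_majorant j K c w).
  apply/integrableP; split; first exact: measurable_funTS (measurable_far_majorant j K c mw).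
  under eq_integral => x _ do rewrite gee0_abs ?far_majorant_ge0//.
  have wN : (LL w <= (fine (LL w))%:E)%E by rewrite -LL_fineK.
  exact: le_lt_trans (hC n D j K c w _ n0 j0 M0 K0 mw wN) (ltry _).
have mf k : measurable_fun S (f k).
  apply: measurable_funTS; apply/measurable_EFinP.
  by apply: measurable_funM => //; exact: measurable_uray.
have f0 : \forall x \ae sigma, S x -> f ^~ x @ \oo --> 0%E.
  apply: filterS (integrable_ae mS ig) => x hx Sx.
  have p0 : pev (hom j c) x != 0.
    apply: contraTneq (hx Sx) => p0.
    rewrite /far_majorant p0 normr0 /psi eqxx gt0_muley ?lte_fin ?powR_gt0//.
    by rewrite gt0_muley ?lte_fin// addey.
  apply: cvg_EFin; first exact: nearW.
  apply/cvgrPdist_le => eps eps0.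
  have eps1 : 0 < eps / (`|w x| + 1) by rewrite divr_gt0// ltr_wpDl.
  have [A A0 hA] := uray_tail d0 j0 hc p0 eps1.
  near=> k; rewrite sub0r normrN /f/= normrM.
  have Ak : A <= (ab k).1.
    have [h _ _] := hab k; apply: le_trans h.
    have : A <= k%:R by near: k; exact: nbhs_infty_ger.
    by move=> h; rewrite (le_trans h)// lerDl ltW.
  apply: (le_trans (ler_wpM2l (normr_ge0 _) (hA _ _ Ak (abk k)))).
  by rewrite mulrCA ler_piMr ?(ltW eps0)// ler_pdivrMr ?ltr_wpDl// mul1r lerDl.
have fg : \forall x \ae sigma, forall k, S x -> (`|f k x| <= far_majorant j K c w x)%E.
  apply: nearW => x k Sx; rewrite /f abse_EFin.
  apply: (uray_far_majorant w x hk0 (ltW k00) (lexx _) d0 j0 hc (a0 k) (abk k)).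
  rewrite -[leLHS]hj ler_wpM2l ?(ltW M0)// lerXn2r ?nnegrE ?(ltW lam0) ?mulr_ge0 ?(ltW (a0 k))//.
  have [h _ _] := hab k; have k0' : 0 <= k%:R :> R by [].
  by have := a0 k; lra.
have [_ _] := dominated_convergence mS mf (measurable_cst _) f0 ig fg.
rewrite integral0 => /fine_cvgP[_] /cvgrPdist_lt/(_ _ e0)[N _ /(_ N (leqnn N))].
rewrite /= sub0r normrN => h; have [_ _] := hab N.
by rewrite ltNge => /negP; apply; exact: ltW.
Unshelve. all: by end_near.
Qed.

(** The phase is compared with its constant term, for which the integral vanishes by the mean-zero
    condition; the error, b / l times the norm of w, tends to 0 with b. *)
Lemma Jray_small D d (c : n.-tuple 'I_D.+1 -> R) (e : R) :
  deg_le d c -> 0 < e ->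
  exists2 del : R, 0 < del & forall a b, 0 < a -> a <= b -> b <= del -> `|Jray w c a b| <= e.
Proof.
move=> hc e0.
have [hc'|[lam [j [lam0 /andP[j0 jd] hj hlam]]]] := homogeneous_scale 0 hc.
  by exists 1 => // a b _ _ _; rewrite Jray_deg0// normr0 ltW.
pose N := fine (LL w); have wN : (LL w <= N%:E)%E by rewrite -LL_fineK.
have N0 : 0 <= N.
  by rewrite fine_ge0//; apply: integral_ge0 => x _; rewrite lee_fin LL_integrand_ge0.
pose l := lam / 2; have l0 : 0 < l by rewrite divr_gt0.
pose del := Num.min l (e * l / (N + 1)).
exists del; first by rewrite lt_min l0 divr_gt0 ?mulr_gt0// ltr_wpDl.
move=> a b a0 ab; rewrite le_min => /andP[bl be]; have b0 := lt_le_trans a0 ab.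
have bl0 : 0 <= b / l by rewrite divr_ge0// ltW.
have P x : S x -> `|uray c a b x - uray (lowpart 0 c) a b x| <= b / l.
  move=> Sx; apply: ucos_near => // r /andP[ar rb].
  have -> : b / l * (r / b) = r / l by field; rewrite !gt_eqF.
  apply: (ray_lowpart_near Sx hc) => //; rewrite ?(le_trans (ltW a0))//.
    exact: le_trans rb bl.
  move=> i i0 id; rewrite /l exprMn mulrA ler_piMl ?exprn_ge0//; exact: hlam.
have := Jray_near mw wN a0 ab bl0 P.
rewrite (Jray_deg0 _ _ iw w0 (@deg_le_lowpart R n D 0 c)) subr0 => h.
apply: (le_trans h); rewrite mulrAC ler_pdivrMr//.
apply: (@le_trans _ _ (b * (N + 1))); first by rewrite ler_wpM2l ?lerDl// ltW.
by rewrite -ler_pdivlMr// ltr_wpDl.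
Qed.

(** Allows every truncation to be cut at radius 1. *)
Lemma near_pv_filter : \forall q \near @pv_filter R, [/\ 0 < q.1, q.1 < 1 & 1 < q.2].
Proof.
exists (`]0, 1[%classic, `]1, +oo[%classic) => /=.
  split; last by exists 1; rewrite num_real; split => // t t1; rewrite /= in_itv/= t1.
  near=> t; rewrite /= in_itv/=; apply/andP; split; near: t.
    exact: nbhs_right_gt.
  exact: nbhs_right_lt.
by move=> -[t u] [/=]; rewrite !in_itv/= => /andP[t0 t1] /andP[u1 _].
Unshelve. all: by end_near.
Qed.

(** Once the integral is cut at radius 1, the two limits are independent; each exists by the Cauchy
    criterion, from [Jray_small] at 0 and [Jray_tail] at infinity. *)
Lemma Jray_cvg D d (c : n.-tuple 'I_D.+1 -> R) : (0 < d)%N -> deg_le d c ->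
  cvg ((fun q : R * R => Jray w c q.1 q.2) @ @pv_filter R).
Proof.
move=> d0 hc.
have c1 : cvg (Jray w c t 1 @[t --> 0^'+]).
  apply: cauchy_cvg; apply: cauchy_exP => e e0.
  have e20 : 0 < e / 2 by rewrite divr_gt0.
  have [del del0 hdel] := Jray_small hc e20.
  pose m := Num.min del 1; have m0 : 0 < m by rewrite lt_min del0 ltr01.
  exists (Jray w c m 1).
  suff : \forall t \near 0^'+, ball (Jray w c m 1) e (Jray w c t 1) by [].
  near=> t.
  have t0 : 0 < t by near: t; exact: nbhs_right_gt.
  have tm : t <= m by near: t; exact: nbhs_right_le.
  have m1 : m <= 1 by rewrite ge_min lexx orbT.
  rewrite /ball/= (Jray_split c mw iw t0 tm m1) opprD addrCA subrr addr0 normrN.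
  apply: le_lt_trans (hdel t m t0 tm _) _; first by rewrite ge_min lexx.
  by rewrite ltr_pdivrMr// ltr_pMr// ltr1n.
have c2 : cvg (Jray w c 1 t @[t --> +oo]).
  apply: cauchy_cvg; apply: cauchy_exP => e e0.
  have e20 : 0 < e / 2 by rewrite divr_gt0.
  have [A A0 hA] := Jray_tail d0 hc e20.
  pose m := Num.max A 1; have m1 : 1 <= m by rewrite le_max lexx orbT.
  exists (Jray w c 1 m).
  suff : \forall t \near +oo, ball (Jray w c 1 m) e (Jray w c 1 t) by [].
  near=> t.
  have tm : m <= t by near: t; apply: nbhs_pinfty_ge; rewrite num_real.
  rewrite /ball/= (Jray_split c mw iw ltr01 m1 tm) opprD addrA subrr sub0r normrN.
  apply: le_lt_trans (hA m t _ tm) _; first by rewrite le_max lexx.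
  by rewrite ltr_pdivrMr// ltr_pMr// ltr1n.
have FF : Filter (@pv_filter R) by exact: filter_prod_filter.
have h1 : Jray w c q.1 1 @[q --> @pv_filter R] --> lim (Jray w c t 1 @[t --> 0^'+]).
  exact: cvg_comp (cvg_fst) c1.
have h2 : Jray w c 1 q.2 @[q --> @pv_filter R] --> lim (Jray w c 1 t @[t --> +oo]).
  exact: cvg_comp (cvg_snd) c2.
have h := cvgD h1 h2.
apply/cvg_ex; exists (lim (Jray w c t 1 @[t --> 0^'+]) + lim (Jray w c 1 t @[t --> +oo])).
refine (cvg_trans _ (h FF)); apply: near_eq_cvg.
apply: filterS near_pv_filter => q [q0 q1 q2].
by rewrite /= (Jray_split c mw iw q0 (ltW q1) (ltW q2)).
Unshelve. all: by end_near.
Qed.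

End principal_value.

(** * Complex kernels *)

Section coefficients.
Variables (R : realType) (n d : nat).

Definition mnm_of_tuple (al : n.-tuple 'I_d.+1) : multinom n :=
  Multinom [tuple (tnth al i : nat) | i < n].

Definition coefs (P : mpoly n R) (al : n.-tuple 'I_d.+1) : R := mcoeff (mnm_of_tuple al) P.

Lemma mnm_of_tupleE (al : n.-tuple 'I_d.+1) i : mnm_of_tuple al i = tnth al i.
Proof. by rewrite mnm_tnth tnth_mktuple. Qed.

Lemma mnm_of_tuple_inj : injective mnm_of_tuple.
Proof.
move=> al be h; apply: eq_from_tnth => i; apply/val_inj => /=.
by rewrite -!mnm_of_tupleE h.
Qed.

Lemma deg_le_coefs (P : mpoly n R) : poly_le d P -> deg_le d (coefs P).
Proof.
move=> Pd al; rewrite /coefs -mcoeff_msupp => /msize_mdeg_lt h.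
rewrite -ltnS; apply: leq_trans Pd; apply: leq_ltn_trans h.
by rewrite mdegE /wt leq_sum// => i _; rewrite mnm_of_tupleE.
Qed.

(** The box of exponents at most d contains the support of P, because no exponent exceeds the total
    degree; the other tuples have coefficient 0. *)
Lemma peval_pev (P : mpoly n R) (x : Rn R n) : poly_le d P -> peval P x = pev (coefs P) x.
Proof.
move=> Pd; rewrite /peval mevalE /pev.
pose F (m : multinom n) := mcoeff m P * \prod_i tnth x i ^+ m i.
pose s := [seq mnm_of_tuple al | al <- index_enum {: n.-tuple 'I_d.+1}].
transitivity (\sum_(m <- s) F m); last first.
  rewrite big_map; apply: eq_bigr => al _; congr (_ * _).
  by apply: eq_bigr => i _; rewrite mnm_of_tupleE.
have us : uniq s by rewrite map_inj_uniq ?index_enum_uniq//; exact: mnm_of_tuple_inj.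
rewrite [RHS](bigID (mem (msupp P)))/= [X in _ + X]big1 ?addr0; last first.
  by move=> m /memN_msupp_eq0 h; rewrite /F h mul0r.
rewrite -[LHS]/(\sum_(m <- msupp P) F m) -big_filter; apply: perm_big; apply: uniq_perm.
- exact: msupp_uniq.
- exact: filter_uniq.
move=> m; rewrite mem_filter; case: (boolP (m \in msupp P)) => //= mP; apply/esym/mapP.
have hm i : (m i < d.+1)%N.
  apply: (@leq_ltn_trans (mdeg m)); first by rewrite mdegE (bigD1 i)//= leq_addr.
  exact: leq_trans (msize_mdeg_lt mP) Pd.
exists [tuple (Ordinal (hm i)) | i < n]; first by rewrite mem_index_enum.
by apply/mnmP => i; rewrite mnm_of_tupleE tnth_mktuple.
Qed.

End coefficients.

Arguments coefs {R n} d P al.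

Section phase_shift.
Variables (R : realType) (n D : nat).

Definition al0 : n.-tuple 'I_D.+1 := [tuple ord0 | i < n].

(** Shifting the phase by pi / 2 only touches the constant coefficient, so sines become cosines of
    polynomials with the same degree bound. *)
Definition cshift (c : n.-tuple 'I_D.+1 -> R) (al : n.-tuple 'I_D.+1) : R :=
  c al - (if al == al0 then pi / 2 else 0).

Lemma wt_al0 : wt al0 = 0%N.
Proof. by rewrite /wt big1// => i _; rewrite tnth_mktuple. Qed.

Lemma deg_le_cshift d (c : n.-tuple 'I_D.+1 -> R) : deg_le d c -> deg_le d (cshift c).
Proof.
move=> hc al; rewrite /cshift; case: (al =P al0) => [->|_]; first by rewrite wt_al0.
by rewrite subr0; exact: hc.
Qed.

Lemma pev_cshift (c : n.-tuple 'I_D.+1 -> R) (x : Rn R n) : pev (cshift c) x = pev c x - pi / 2.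
Proof.
rewrite /pev /cshift.
rewrite (eq_bigr (fun al => c al * mon al x - (if al == al0 then pi / 2 * mon al x else 0))).
  rewrite sumrB -big_mkcond big_pred1_eq/= [mon _ _]big1 ?mulr1// => i _.
  by rewrite tnth_mktuple expr0.
by move=> al _; rewrite mulrBl; case: eqP => // _; rewrite mul0r.
Qed.

Lemma cos_cshift (c : n.-tuple 'I_D.+1 -> R) (x : Rn R n) : cos (pev (cshift c) x) = sin (pev c x).
Proof. by rewrite pev_cshift cosBpihalf. Qed.

End phase_shift.

Section complex_parts.
Variable R : realType.

Lemma le_logp (s t : R) : 0 <= s -> s <= t -> logp s <= logp t.
Proof.
rewrite le_eqVlt => /predU1P[<- _|s0 st].
  by rewrite {1}/logp ln0// maxxx logp_ge0.
by rewrite /logp le_max2 ?ler_ln// posrE// (lt_le_trans s0).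
Qed.

Lemma normcE (z : R[i]) : Normc.normc z = Num.sqrt (complex.Re z ^+ 2 + complex.Im z ^+ 2).
Proof. by case: z. Qed.

Lemma ger_Im_normc (z : R[i]) : `|complex.Im z| <= Normc.normc z.
Proof.
rewrite normcE -sqrtr_sqr ler_sqrt ?lerDr ?sqr_ge0//.
by rewrite addr_ge0 ?sqr_ge0.
Qed.

Lemma normc_le_add (z : R[i]) : Normc.normc z <= `|complex.Re z| + `|complex.Im z|.
Proof.
rewrite normcE -[leRHS]ger0_norm ?addr_ge0// -sqrtr_sqr ler_sqrt ?sqr_ge0//.
rewrite sqrrD !real_normK ?num_real// addrAC lerDl mulrn_wge0// mulr_ge0//.
Qed.

Lemma normC_normc (z : R[i]) : `|z| = (Normc.normc z)%:C%C.
Proof. by rewrite normc_def normcE. Qed.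

Lemma cvg_complex (T : Type) (F : set_system T) (FF : Filter F) (f g : T -> R) (a b : R) :
  f x @[x --> F] --> a -> g x @[x --> F] --> b ->
  ((f x +i* g x)%C : R[i]^o) @[x --> F] --> ((a +i* b)%C : R[i]^o).
Proof.
move=> fa gb; apply/cvgrPdist_le => e e0.
(* Positivity in R[i] forces a zero imaginary part, so [e] is a real number. *)
have [er eim] : 0 < complex.Re e /\ complex.Im e = 0.
  by move: e0; rewrite ltcE/= => /andP[/eqP -> ->].
have e2 : 0 < complex.Re e / 2 by rewrite divr_gt0.
move/cvgrPdist_le/(_ _ e2) : fa => fa; move/cvgrPdist_le/(_ _ e2) : gb => gb.
near=> x.
have h1 : `|a - f x| <= complex.Re e / 2 by near: x.
have h2 : `|b - g x| <= complex.Re e / 2 by near: x.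
rewrite [`|_|]normC_normc lecE/= eim eqxx/=.
apply: (le_trans (normc_le_add ((a - f x) +i* (b - g x))%C)) => /=.
by rewrite [leRHS]splitr lerD.
Unshelve. all: by end_near.
Qed.

End complex_parts.

Section complex_kernel.
Variables (R : realType) (n d : nat) (Omega : Rn R n -> R[i]).
Hypotheses (n0 : (0 < n)%N) (d1 : (0 < d)%N) (LO : LlogL Omega).
Hypothesis mean0 : Cintegral (@sphere_measure R n) (@sphere R n) Omega = 0.
Local Notation sigma := (@sphere_measure R n).
Local Notation S := (@sphere R n).

(** Extended by 0 off the sphere, since Omega is only assumed measurable there while the estimates
    ask for measurability everywhere. *)
Definition wRe : Rn R n -> R := (fun x => complex.Re (Omega x)) \_ S.
Definition wIm : Rn R n -> R := (fun x => complex.Im (Omega x)) \_ S.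

Let mS : measurable S. Proof. exact: measurable_sphere. Qed.

Lemma wReE x : S x -> wRe x = complex.Re (Omega x).
Proof. by move=> Sx; rewrite /wRe patchE mem_set. Qed.

Lemma wImE x : S x -> wIm x = complex.Im (Omega x).
Proof. by move=> Sx; rewrite /wIm patchE mem_set. Qed.

Lemma measurable_wRe : measurable_fun setT wRe.
Proof. by case: LO => -[h _] _; apply/(measurable_restrictT _ mS). Qed.

Lemma measurable_wIm : measurable_fun setT wIm.
Proof. by case: LO => -[_ h] _; apply/(measurable_restrictT _ mS). Qed.

Lemma integral_wRe : \int[sigma]_(x in S) wRe x = 0.
Proof.
move: mean0 => [h _]; rewrite -[RHS]h; apply: eq_Rintegral => x; rewrite inE => Sx.
exact: wReE.
Qed.

Lemma integral_wIm : \int[sigma]_(x in S) wIm x = 0.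
Proof.
move: mean0 => [_ h]; rewrite -[RHS]h; apply: eq_Rintegral => x; rewrite inE => Sx.
exact: wImE.
Qed.

Lemma LL_le_LlogL_norm (w : Rn R n -> R) : measurable_fun setT w ->
  (forall x, S x -> `|w x| <= Normc.normc (Omega x)) -> (LL w <= LlogL_norm Omega)%E.
Proof.
move=> mw hw; apply: ge0_le_integral => //.
- by move=> x _; rewrite lee_fin LL_integrand_ge0.
- by apply: measurable_funTS; apply/measurable_EFinP; exact: measurable_LL.
- apply/measurable_EFinP.
  have mN : measurable_fun S (fun x => Normc.normc (Omega x) : measurableTypeR R).
    rewrite (_ : (fun x => _) = Num.sqrt \o
      (fun x => complex.Re (Omega x) ^+ 2 + complex.Im (Omega x) ^+ 2)); last first.
      by apply/funext => x; rewrite /= normcE.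
    apply: (measurableT_comp (continuous_measurable_fun (@sqrt_continuous R))).
    by case: LO => -[h1 h2] _; apply: measurable_funD; exact: measurable_funX.
  apply: measurable_funM => //; apply: measurable_funD => //.
  exact: (measurableT_comp (@measurable_logp R) mN).
- move=> x Sx; rewrite lee_fin; apply: ler_pM => //.
  + by rewrite addr_ge0// logp_ge0.
  + exact: hw.
  + by rewrite lerD2l le_logp// hw.
Qed.

Lemma LL_wRe : (LL wRe <= LlogL_norm Omega)%E.
Proof.
apply: (LL_le_LlogL_norm measurable_wRe) => x Sx; rewrite wReE//; exact: ger_Re_normc.
Qed.

Lemma LL_wIm : (LL wIm <= LlogL_norm Omega)%E.
Proof.
apply: (LL_le_LlogL_norm measurable_wIm) => x Sx; rewrite wImE//; exact: ger_Im_normc.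
Qed.

Let fRe : (LL wRe < +oo)%E. Proof. by case: LO => _; exact: le_lt_trans LL_wRe. Qed.
Let fIm : (LL wIm < +oo)%E. Proof. by case: LO => _; exact: le_lt_trans LL_wIm. Qed.

(** Real and imaginary parts of (cos P + i sin P)(u + i v), each sine being written as the cosine of
    the shifted phase. *)
Lemma truncated_integralE (P : mpoly n R) (a b : R) : poly_le d P -> 0 < a -> a < b ->
  truncated_integral Omega P a b =
  ((Jray wRe (coefs d P) a b - Jray wIm (cshift (coefs d P)) a b) +i*
   (Jray wIm (coefs d P) a b + Jray wRe (cshift (coefs d P)) a b))%C.
Proof.
move=> Pd a0 ab; set c := coefs d P.
have iRe := LL_integrable measurable_wRe fRe; have iIm := LL_integrable measurable_wIm fIm.
have [i1 <-] := trunc_cos_Jray n0 c a0 ab measurable_wRe iRe.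
have [i2 <-] := trunc_cos_Jray n0 (cshift c) a0 ab measurable_wRe iRe.
have [i3 <-] := trunc_cos_Jray n0 c a0 ab measurable_wIm iIm.
have [i4 <-] := trunc_cos_Jray n0 (cshift c) a0 ab measurable_wIm iIm.
have mA := @measurable_annulus R n a b.
have kernE x : annulus a b x -> hkernel Omega x = (kern wRe x +i* kern wIm x)%C.
  move=> /andP[ax _]; have x0 : 0 < enorm x by exact: lt_le_trans ax.
  have Sx := normalize_sphere x0.
  rewrite /hkernel /kern wReE// wImE//; case: (Omega _) => u v /=.
  rewrite -[X in _ * X]/(((enorm x ^+ n)%:C)^-1)%C -rmorphV/=; last first.
    by rewrite unitfE expf_neq0// gt_eqF.
  by apply/eqP; rewrite eq_complex/= !mulr0 subr0 add0r !eqxx.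
rewrite /truncated_integral /Cintegral; congr (_ +i* _)%C.
  rewrite /trunc_cos -RintegralB//; apply: eq_Rintegral => x; rewrite inE => Ax.
  by rewrite kernE// cos_cshift (peval_pev _ Pd).
rewrite /trunc_cos -RintegralD//; apply: eq_Rintegral => x; rewrite inE => Ax.
by rewrite kernE// cos_cshift (peval_pev _ Pd).
Qed.

Let FF : Filter (@pv_filter R). Proof. exact: filter_prod_filter. Qed.

Let PF : ProperFilter (@pv_filter R). Proof. exact: filter_prod_proper. Qed.

Lemma truncations_cvg (P : mpoly n R) : poly_le d P ->
  let L w c := lim ((fun q : R * R => Jray w c q.1 q.2) @ @pv_filter R) in
  truncations Omega P q @[q --> @pv_filter R] -->
  (((L wRe (coefs d P) - L wIm (cshift (coefs d P))) +i*
   (L wIm (coefs d P) + L wRe (cshift (coefs d P))))%C : R[i]^o).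
Proof.
move=> Pd L; set c := coefs d P.
have hc : deg_le d c by exact: deg_le_coefs.
have hc' := deg_le_cshift hc.
have l1 := Jray_cvg n0 measurable_wRe fRe integral_wRe d1 hc.
have l2 := Jray_cvg n0 measurable_wRe fRe integral_wRe d1 hc'.
have l3 := Jray_cvg n0 measurable_wIm fIm integral_wIm d1 hc.
have l4 := Jray_cvg n0 measurable_wIm fIm integral_wIm d1 hc'.
have h := @cvg_complex _ _ _ FF _ _ _ _ (cvgB l1 l4) (cvgD l3 l2).
refine (cvg_trans _ (h FF FF)); apply: near_eq_cvg.
apply: filterS (near_pv_filter R) => q [q0 q1 q2].
by rewrite /truncations truncated_integralE// (lt_trans q1).
Qed.

Lemma lim_Jray_le (w : Rn R n -> R) (B : R) (c : n.-tuple 'I_d.+1 -> R) :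
  cvg ((fun q : R * R => Jray w c q.1 q.2) @ @pv_filter R) ->
  (forall a b, 0 < a -> a <= b -> `|Jray w c a b| <= B) ->
  `|lim ((fun q : R * R => Jray w c q.1 q.2) @ @pv_filter R)| <= B.
Proof.
move=> hcv hB; rewrite ler_norml; apply/andP; split.
  apply: limr_ge => //; apply: filterS (near_pv_filter R) => q [q0 q1 q2].
  by have := hB q.1 q.2 q0 (ltW (lt_trans q1 q2)); rewrite ler_norml => /andP[].
apply: limr_le => //; apply: filterS (near_pv_filter R) => q [q0 q1 q2].
by have := hB q.1 q.2 q0 (ltW (lt_trans q1 q2)); rewrite ler_norml => /andP[].
Qed.

(** The factor 4 counts the real integrals involved: real or imaginary part of Omega, phase shifted
    or not. *)
Lemma pv_integral_le (P : mpoly n R) (B : R) : poly_le d P ->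
  (forall w (c : n.-tuple 'I_d.+1 -> R) a b, measurable_fun setT w ->
     (LL w <= LlogL_norm Omega)%E -> \int[sigma]_(x in S) w x = 0 ->
     deg_le d c -> 0 < a -> a <= b -> `|Jray w c a b| <= B) ->
  pv_exists Omega P /\ Normc.normc (pv_integral Omega P) <= 4 * B.
Proof.
move=> Pd hB; have h := truncations_cvg Pd; set c := coefs d P in h.
split; first by apply/cvg_ex; eexists; exact: h.
have hc : deg_le d c by exact: deg_le_coefs.
have hc' := deg_le_cshift hc.
have b1 := lim_Jray_le (Jray_cvg n0 measurable_wRe fRe integral_wRe d1 hc)
  (fun a b => hB _ _ a b measurable_wRe LL_wRe integral_wRe hc).
have b2 := lim_Jray_le (Jray_cvg n0 measurable_wRe fRe integral_wRe d1 hc')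
  (fun a b => hB _ _ a b measurable_wRe LL_wRe integral_wRe hc').
have b3 := lim_Jray_le (Jray_cvg n0 measurable_wIm fIm integral_wIm d1 hc)
  (fun a b => hB _ _ a b measurable_wIm LL_wIm integral_wIm hc).
have b4 := lim_Jray_le (Jray_cvg n0 measurable_wIm fIm integral_wIm d1 hc')
  (fun a b => hB _ _ a b measurable_wIm LL_wIm integral_wIm hc').
rewrite /pv_integral (cvg_lim _ h)//.
apply: (le_trans (normc_le_add _)) => /=.
apply: (le_trans (lerD (ler_normB _ _) (ler_normD _ _))).
apply: (le_trans (lerD (lerD b1 b4) (lerD b3 b2))).
by rewrite le_eqVlt; apply/orP; left; apply/eqP; ring.
Qed.

End complex_kernel.

Theorem theorem1p1 (R : realType) :
  exists c : R, 0 < c /\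
    forall (n d : nat) (Omega : Rn R n -> R[i]),
      (0 < n)%N -> (2 <= d)%N ->
      LlogL Omega ->
      Cintegral (@sphere_measure R n) (@sphere R n) Omega = 0 ->
      (forall P : mpoly n R, poly_le d P -> pv_exists Omega P) /\
      (ereal_sup [set (Normc.normc (pv_integral Omega P))%:E
                   | P in @poly_le R n d]
        <= (c * ln d%:R)%:E * (LlogL_norm Omega + 1))%E.
Proof.
have [C C0 hC] := Jray_bound R.
have ln2 : 0 < ln 2 :> R by rewrite ln_gt0// ltr1n.
(* 8 = 4 * 2: four real integrals in [pv_integral_le], and 1 + log2 d <= 2 log2 d, which is where d
   >= 2 enters. *)
exists (8 * C / ln 2); split; first by rewrite divr_gt0// mulr_gt0.
move=> n d Omega n0 d2 LO mean0; have d0 : (0 < d)%N by exact: leq_trans d2.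
have N0 : (0 <= LlogL_norm Omega)%E.
  apply: integral_ge0 => x _; rewrite lee_fin mulr_ge0 ?normc_ge0//.
  by rewrite addr_ge0// logp_ge0.
have NE : (LlogL_norm Omega = (fine (LlogL_norm Omega))%:E)%E.
  by case: LO => _ h; rewrite fineK// ge0_fin_numE.
set N := fine _ in NE; rewrite NE lee_fin in N0.
have hB w (c : n.-tuple 'I_d.+1 -> R) a b : measurable_fun setT w ->
     (LL w <= LlogL_norm Omega)%E -> \int[@sphere_measure R n]_(x in @sphere R n) w x = 0 ->
     deg_le d c -> 0 < a -> a <= b -> `|Jray w c a b| <= C * (N + 1) * (2 * ln d%:R / ln 2).
  move=> mw; rewrite NE => wN w0 hc a0 ab.
  apply: (le_trans (hC n d w N n0 mw wN w0 d c a b d0 hc a0 ab)).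
  rewrite ler_wpM2l ?mulr_ge0 ?(ltW C0) ?addr_ge0//.
  rewrite -(ler_pM2r ln2) mulrDl mul1r !divfK ?gt_eqF//.
  have -> : 2 * ln d%:R = ln d%:R + ln d%:R :> R by ring.
  rewrite lerD2r.
  by rewrite ler_ln ?posrE ?ltr0n ?ler_nat.
have key P (Pd : poly_le d P) := pv_integral_le n0 d0 LO mean0 Pd hB.
split; first by move=> P /key[].
apply: ge_ereal_sup => _ [P /key[_ hP] <-].
rewrite NE -EFinD -EFinM lee_fin; apply: (le_trans hP).
rewrite le_eqVlt; apply/orP; left; apply/eqP; field.
by rewrite gt_eqF.
Qed.
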